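(* Let $s \ge 9$ be an integer, let $\eta > 0$, and let $\mu_1, \ldots, \mu_s$ be real numbers with $\mu_1$ irrational. Put $F(x_1,\ldots,x_s) = (x_1-\mu_1)^3 + \cdots + (x_s-\mu_s)^3$. Then there exists $\tau_0 = \tau_0(s,\eta,\mu_1,\ldots,\mu_s)$ such that for every real $\tau \ge \tau_0$ there exist integers $x_1 > \mu_1, \ldots, x_s > \mu_s$ with \[ |F(x_1,\ldots,x_s) - \tau| < \eta. \] *)

(* Defs.v *)
From HB Require Import structures.
From mathcomp Require Import all_boot all_order all_algebra.
From mathcomp Require Import all_classical all_reals.

Set Implicit Arguments.
Unset Strict Implicit.
Unset Printing Implicit Defensive.

Import Order.TTheory GRing.Theory Num.Theory.
Local Open Scope ring_scope.

(* Variables are indexed from 0, so mu_1, ..., mu_s are the values of mu on 'I_s. *)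
Definition shifted_cubes (R : realType) (s : nat) (mu x : 'I_s -> R) : R :=
  \sum_(i < s) (x i - mu i) ^+ 3.

(* Main.v *)
(** A Davenport-Heilbronn argument with all integrals replaced by finite sums.
    Seven variables range over an interval of length P = r^200 near P and two over one
    of length Y = r^160 near Y; the remaining ones are frozen.  With N = 1000 P^3, the
    nonnegative trigonometric polynomial |sum_l a_l e(l t/N)|^2 times
    (cos(2 pi t/N) - 1 + 2 eta^2/N^2) can only be positive for |t| < eta, so it suffices
    that its sum over t = F(x) - tau is positive.  Expanding it gives Weyl sums at the
    points j/N, j <= T N, and the difference with a multiple of a Fejer kernel, whose sum
    is bounded below by an elementary count, is estimated as follows.
    - On the minor arcs, Weyl's inequality bounds five of the long sums; the other two
      long and two short ones are bounded in mean square, since X^3 + V^3 takes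
      essentially distinct values for X near P, V near Y = P^(4/5) (three lattice points
      near a short arc of a conic force a determinant to vanish).
    - On the major arcs, the product of the nine sums is at most a constant times
      P^7 Y^2 / (q^(2 + 1/40) (1 + P^3 |beta|)^(5/4)), whose tail is small.
    - For bounded q and P^3 |beta|, van der Corput differencing with a step divisible
      by 6 q turns the sum attached to the irrational shift into a linear exponential
      sum with irrational frequency, so it is o(P) unless the numerator is 0; in that
      last case the two kernels have almost the same Fourier coefficients. *)
Require Import Defs.
From HB Require Import structures.
From mathcomp Require Import all_boot all_order all_algebra.
From mathcomp Require Import all_classical all_reals.
From mathcomp Require Import topology normedtype derive trigo exp.
From mathcomp Require Import complex.
From mathcomp Require Import ring lra zify.

Set Implicit Arguments.
Unset Strict Implicit.
Unset Printing Implicit Defensive.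

Import Order.TTheory GRing.Theory Num.Theory numFieldNormedType.Exports.
Local Open Scope ring_scope.
Local Notation Re := (@complex.Re _).
Local Notation Im := (@complex.Im _).

(** Real shifts destroy the periodicity of the Weyl sums, so every fraction a/q up to T may carry a
    peak as high as the one at 0. Only the irrational shift separates them, and it does so with no
    rate: this is why large q and large P^3 |beta| are removed first by a convergent majorant, which
    leaves a number of fractions bounded independently of P. No asymptotic formula is needed for a
    main term, since the lower bound for the Fejer sum comes from solving for a single variable. The
    exponent of Y is squeezed from both sides. Weyl saves about P^(1/4) on each of five sums and the
    mean square costs about P^3 P Y, so P^(15/4) P^4 Y < P^7 Y^2 asks for Y > P^(3/4). In the count
    of near coincidences the differences h <= P^(1/5) are counted trivially, at a cost of P^(1/5)
    Y^2, and this stays below P Y only if Y <= P^(4/5). In powers of r the minor arcs cost 758 + 961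
    = 1719, against 1720 for P^7 Y^2: one factor r is left to beat the constants. *)

Section ComplexExponential.
Variable R : realType.
Implicit Types (t u : R) (z w : R[i]) (n : nat).

(** * The exponential e(t), the distance to the nearest integer, geometric sums *)

Definition cmod z : R := Normc.normc z.

Lemma cmod_sqr z : cmod z ^+ 2 = Re z ^+ 2 + Im z ^+ 2.
Proof. by case: z => a b; rewrite /cmod /= sqr_sqrtr // addr_ge0 ?sqr_ge0. Qed.

Lemma cmod_ge0 z : 0 <= cmod z.
Proof. by case: z => a b; exact: sqrtr_ge0. Qed.

Lemma cmodM z w : cmod (z * w) = cmod z * cmod w.
Proof. exact: Normc.normcM. Qed.

Lemma cmodD z w : cmod (z + w) <= cmod z + cmod w.
Proof. exact: le_normcD. Qed.

Lemma cmodN z : cmod (- z) = cmod z.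
Proof. exact: normcN. Qed.

Lemma cmodB z w : cmod (z - w) <= cmod z + cmod w.
Proof. by rewrite -(cmodN w); exact: cmodD. Qed.

Lemma cmodBC z w : cmod (z - w) = cmod (w - z).
Proof. by rewrite -cmodN opprB. Qed.

Lemma cmod0 : cmod 0 = 0. Proof. exact: Normc.normc0. Qed.
Lemma cmod1 : cmod 1 = 1. Proof. exact: Normc.normc1. Qed.

Lemma cmod_real t : cmod t%:C%C = `|t|.
Proof. by rewrite /cmod /= expr0n addr0 sqrtr_sqr. Qed.

Lemma cmodJ z : cmod (z^*)%C = cmod z.
Proof. by case: z => a b; rewrite /cmod /= sqrrN. Qed.

Lemma cmod_conj_sqr z : z * (z^*)%C = (cmod z ^+ 2)%:C%C.
Proof.
rewrite cmod_sqr; case: z => a b /=.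
by apply/eqP; rewrite eq_complex /=; apply/andP; split; apply/eqP; ring.
Qed.

Lemma Re_cmod z : `|Re z| <= cmod z.
Proof.
rewrite -(ler_pXn2r (n := 2)) ?nnegrE ?cmod_ge0 //.
by rewrite real_normK ?num_real // cmod_sqr lerDl sqr_ge0.
Qed.

Lemma Re_le_cmod z : Re z <= cmod z.
Proof. exact: le_trans (ler_norm _) (Re_cmod z). Qed.

Lemma cmod_sum (I : Type) (r : seq I) (P : pred I) (F : I -> R[i]) :
  cmod (\sum_(i <- r | P i) F i) <= \sum_(i <- r | P i) cmod (F i).
Proof.
elim/big_rec2: _ => [|i y x _ h]; first by rewrite cmod0.
by apply: le_trans (cmodD _ _) _; rewrite lerD2l.
Qed.

Lemma cmod_prod (I : Type) (r : seq I) (P : pred I) (F : I -> R[i]) :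
  cmod (\prod_(i <- r | P i) F i) = \prod_(i <- r | P i) cmod (F i).
Proof. by elim/big_rec2: _ => [|i y x _ <-]; rewrite ?cmod1 ?cmodM. Qed.

Lemma Re_sum (I : Type) (r : seq I) (P : pred I) (F : I -> R[i]) :
  Re (\sum_(i <- r | P i) F i) = \sum_(i <- r | P i) Re (F i).
Proof. by elim/big_rec2: _ => [//|i y x _ <-]; case: (F i); case: x. Qed.

Lemma Re_realM t z : Re (t%:C%C * z) = t * Re z.
Proof. by case: z => a b /=; rewrite mul0r subr0. Qed.

Definition cexp t : R[i] := (cos (2 * pi * t) +i* sin (2 * pi * t))%C.

Lemma cexpD t u : cexp (t + u) = cexp t * cexp u.
Proof.
rewrite /cexp mulrDr cosD sinD; apply/eqP; rewrite eq_complex /=.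
by apply/andP; split; apply/eqP; ring.
Qed.

Lemma cexp0 : cexp 0 = 1.
Proof. by rewrite /cexp mulr0 cos0 sin0. Qed.

Lemma cexpN t : cexp (- t) = (cexp t)^*%C.
Proof. by rewrite /cexp mulrN cosN sinN. Qed.

Lemma cmod_cexp t : cmod (cexp t) = 1.
Proof. by rewrite /cmod /= cos2Dsin2 sqrtr1. Qed.

Lemma cexp_mulN t : cexp t * cexp (- t) = 1.
Proof. by rewrite -cexpD subrr cexp0. Qed.

Lemma cexpMn t n : cexp (n%:R * t) = cexp t ^+ n.
Proof.
elim: n => [|n IH]; first by rewrite mul0r cexp0 expr0.
by rewrite -addn1 natrD mulrDl mul1r cexpD IH exprD expr1.
Qed.

Lemma cexp_sum (I : Type) (r : seq I) (P : pred I) (F : I -> R) :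
  cexp (\sum_(i <- r | P i) F i) = \prod_(i <- r | P i) cexp (F i).
Proof. by elim/big_rec2: _ => [|i y x _ <-]; rewrite ?cexp0 ?cexpD. Qed.

Lemma cexp1 : cexp 1 = 1.
Proof. by rewrite /cexp mulr1 mulr_natl cos2pi sin2pi. Qed.

Lemma cexp_nat n : cexp n%:R = 1.
Proof. by rewrite -[n%:R]mulr1 cexpMn cexp1 expr1n. Qed.

Lemma cexp_int (m : int) : cexp m%:~R = 1.
Proof.
case: m => n; first by rewrite -pmulrn cexp_nat.
by rewrite NegzE mulrNz cexpN -pmulrn cexp_nat rmorph1.
Qed.

Lemma cexpDint t (m : int) : cexp (t + m%:~R) = cexp t.
Proof. by rewrite cexpD cexp_int mulr1. Qed.

Lemma cmod_1Bcexp_sqr t : cmod (1 - cexp t) ^+ 2 = 2 - 2 * cos (2 * pi * t).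
Proof.
rewrite cmod_sqr /= sub0r sqrrN sqrrB expr1n mul1r -addrA cos2Dsin2.
by rewrite mulr_natl; ring.
Qed.

Lemma cmod_1BcexpN t : cmod (1 - cexp (- t)) = cmod (1 - cexp t).
Proof.
have -> : 1 - cexp (- t) = (1 - cexp t)^*%C.
  rewrite cexpN; case: (cexp t) => a b; apply/eqP; rewrite eq_complex /=.
  by apply/andP; split; apply/eqP; ring.
exact: cmodJ.
Qed.

Lemma cmod_1Bcexp_double t :
  cmod (1 - cexp (2 * t)) <= 2 * cmod (1 - cexp t).
Proof.
have -> : 1 - cexp (2 * t) = (1 - cexp t) * (1 + cexp t).
  by rewrite mulr_natl mulr2n cexpD; ring.
rewrite cmodM mulrC ler_wpM2r ?cmod_ge0 //.
by apply: le_trans (cmodD _ _) _; rewrite cmod1 cmod_cexp.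
Qed.

(* On [1/4, 1/2] the modulus is at least 1, and doubling the argument at most
   doubles the modulus. *)
Lemma cmod_1Bcexp_ge t : `|t| <= 2^-1 -> 2 * `|t| <= cmod (1 - cexp t).
Proof.
suff H u : 0 <= u -> u <= 2^-1 -> 2 * u <= cmod (1 - cexp u).
  move=> ht; have [t0|t0] := leP 0 t.
    by rewrite ger0_norm //; apply: H => //; rewrite ger0_norm in ht.
  rewrite ltr0_norm // -cmod_1BcexpN; apply: H; first lra.
  by rewrite ltr0_norm in ht.
have base v : 4^-1 <= v <= 2^-1 -> 1 <= cmod (1 - cexp v).
  move=> /andP[v1 v2]; rewrite -(ler_pXn2r (n := 2)) ?nnegrE ?cmod_ge0 //.
  rewrite expr1n cmod_1Bcexp_sqr.
  suff : cos (2 * pi * v) <= 0 by lra.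
  have pi0 := pi_gt0 R.
  rewrite -(cos_pihalf R) leNgt ltr_cos ?in_itv /=; last 2 first.
  - by apply/andP; split; nra.
  - by apply/andP; split; nra.
  by rewrite -leNgt; nra.
have main n : forall v, 0 <= v -> v <= 2^-1 -> (2 ^+ n.+2)^-1 <= v ->
    2 * v <= cmod (1 - cexp v).
  elim: n => [|n IH] v v0 v2 vn.
    apply: le_trans (base v _); first by lra.
    by apply/andP; split => //; apply: le_trans vn; rewrite expr2; lra.
  have [v4|v4] := leP 4^-1 v.
    by apply: le_trans (base v _); [lra | apply/andP].
  have : 2 * (2 * v) <= cmod (1 - cexp (2 * v)).
    apply: IH; [lra|lra|].
    have -> : (2 ^+ n.+2 : R)^-1 = 2 * (2 ^+ n.+3)^-1.
      by rewrite [2 ^+ n.+3]exprS; field; rewrite expf_neq0 ?pnatr_eq0.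
    by rewrite ler_pM2l.
  have := cmod_1Bcexp_double v; lra.
move=> u0 u2; case: (eqVneq u 0) => [->|un0]; first by rewrite mulr0 cmod_ge0.
have up : 0 < u by rewrite lt_neqAle eq_sym un0.
(* Any [n] with [2^(n+2) >= 1/u] serves as the number of doublings; this crude choice is enough
   because [n < 2^n]. *)
pose n := Num.trunc u^-1.
apply: (main n) => //.
rewrite -[leRHS]invrK lef_pV2 ?posrE ?exprn_gt0 ?invr_gt0 //.
apply: le_trans (ltW (truncnS_gt _)) _.
rewrite -natrX ler_nat -/n; apply: ltnW.
exact: leq_trans (ltn_expl n.+1 (ltnSn 1)) (leq_pexp2l _ (leqnSn _)).
Qed.

Lemma sin_le_id t : 0 <= t -> sin t <= t.
Proof.
move=> t0; have hc : {within `[0, t], continuous (@sin R)}%classic.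
  by apply: continuous_subspaceT => x; exact: continuous_sin.
have [c _ cE] := MVT_segment t0 (fun x _ => is_derive_sin x) hc.
rewrite sin0 !subr0 in cE; rewrite cE -[leRHS]mul1r ler_wpM2r //.
exact: cos_le1.
Qed.

(** [|1 - e(t)| = 2 |sin (pi t)| <= 2 pi |t|], with [pi] rounded up to 4. *)
Lemma cmod_1Bcexp_le t : cmod (1 - cexp t) <= 8 * `|t|.
Proof.
suff H u : 0 <= u -> cmod (1 - cexp u) <= 8 * u.
  have [t0|t0] := leP 0 t; first by rewrite ger0_norm // H.
  by rewrite -cmod_1BcexpN ltr0_norm // H; lra.
move=> u0; have pi0 := pi_gt0 R; have pi4 : pi < 4 :> R.
  by have := pihalf_lt2 R; lra.
have s0 : 0 <= pi * u by apply: mulr_ge0 => //; lra.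
have hE : cmod (1 - cexp u) = 2 * `|sin (pi * u)|.
  apply: (@pexpIrn _ 2) => //; rewrite ?nnegrE ?cmod_ge0 ?mulr_ge0 //.
  rewrite cmod_1Bcexp_sqr exprMn real_normK ?num_real //.
  have -> : 2 * pi * u = (pi * u) *+ 2 by rewrite -mulr_natl; ring.
  by rewrite cos_mulr2n sin2cos2; ring.
rewrite hE.
have : `|sin (pi * u)| <= pi * u.
  have [h|h] := leP 1 (pi * u); first by apply: le_trans (sin_max _) h.
  rewrite ger0_norm ?sin_le_id //; apply: sin_ge0_pi; apply/andP; split => //.
  by have := pi_ge2 R; lra.
nra.
Qed.

Definition dist_int t : R := `|t - (Num.floor (t + 2^-1))%:~R|.

Lemma dist_int_ge0 t : 0 <= dist_int t. Proof. exact: normr_ge0. Qed.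

Lemma dist_int_half t : dist_int t <= 2^-1.
Proof.
rewrite /dist_int; have := floor_le_tmp (t + 2^-1); have := lt_succ_floor (t + 2^-1).
by rewrite intrD => h1 h2; rewrite ler_norml; apply/andP; split; lra.
Qed.

Lemma dist_int_le t (m : int) : dist_int t <= `|t - m%:~R|.
Proof.
have h := dist_int_half t; rewrite /dist_int in h *.
set k := Num.floor _ in h *.
have [->//|km] := eqVneq m k.
have : 1 <= `|(m - k)%:~R| :> R.
  by rewrite -intr_norm -[1]/(1%:~R) ler_int -gtz0_ge1 normr_gt0 subr_eq0.
rewrite intrD mulrNz => h1.
have := ler_distD t m%:~R k%:~R; rewrite [`|m%:~R - t|]distrC; lra.
Qed.

Lemma dist_intE t : exists m : int, dist_int t = `|t - m%:~R|.
Proof. by eexists. Qed.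

Lemma dist_int_id t : `|t| <= 2^-1 -> dist_int t = `|t|.
Proof.
move=> ht; apply/eqP; rewrite eq_le; apply/andP; split.
  by have := dist_int_le t 0; rewrite subr0.
have [m mE] := dist_intE t; rewrite mE.
have [->|m0] := eqVneq m 0; first by rewrite subr0.
have h : 1 <= `|m%:~R| :> R.
  by rewrite -intr_norm -[1]/(1%:~R) ler_int -gtz0_ge1 normr_gt0.
have := ler_distD t m%:~R 0; rewrite !subr0 distrC; lra.
Qed.

Lemma cmod_1Bcexp_dist t : 2 * dist_int t <= cmod (1 - cexp t).
Proof.
rewrite /dist_int; set k := Num.floor _.
have <- : cexp (t - k%:~R) = cexp t by rewrite -mulrNz cexpDint.
by apply: cmod_1Bcexp_ge; exact: dist_int_half.
Qed.

(* A total version of min(n, 1/t) for t >= 0. *)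
Definition trunc_inv n t : R := n%:R / Num.max 1 (n%:R * t).

Lemma trunc_inv_ge0 n t : 0 <= trunc_inv n t.
Proof. by rewrite divr_ge0 // le_max ler01. Qed.

Lemma trunc_inv_le_n n t : trunc_inv n t <= n%:R.
Proof.
by rewrite ler_pdivrMr ?lt_max ?ltr01 // ler_peMr // le_max lexx.
Qed.

Lemma trunc_inv_le_inv n t : 0 < t -> trunc_inv n t <= t^-1.
Proof.
move=> t0; rewrite ler_pdivrMr ?lt_max ?ltr01 //.
by rewrite mulrC ler_pdivlMr // le_max lexx orbT.
Qed.

(** Two bounds at once: the number of terms, and the closed form of the geometric series, whose
    denominator is at least twice the distance from [t] to the nearest integer. *)
Lemma geometric_cexp_le n t u :
  cmod (\sum_(x < n) cexp (t * x%:R + u)) <= trunc_inv n (dist_int t).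
Proof.
have -> : \sum_(x < n) cexp (t * x%:R + u) = cexp u * \sum_(x < n) cexp t ^+ x.
  rewrite big_distrr /=; apply: eq_bigr => x _.
  by rewrite cexpD mulrC [t * _]mulrC cexpMn.
rewrite cmodM cmod_cexp mul1r ler_pdivlMr ?lt_max ?ltr01 //.
have h1 : cmod (\sum_(x < n) cexp t ^+ x) <= n%:R.
  apply: le_trans (cmod_sum _ _ _) _.
  rewrite (eq_bigr (fun _ => 1)); last by move=> x _; rewrite -cexpMn cmod_cexp.
  by rewrite sumr_const card_ord.
have h2 : dist_int t * cmod (\sum_(x < n) cexp t ^+ x) <= 1.
  have := subrX1 (cexp t) n; move/(congr1 cmod).
  rewrite cmodM cmodBC [cmod (_ - 1)]cmodBC => hE.
  have : cmod (1 - cexp t ^+ n) <= 2.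
    by apply: le_trans (cmodB _ _) _; rewrite cmod1 -cexpMn cmod_cexp.
  rewrite hE => h3.
  have := ler_wpM2r (cmod_ge0 (\sum_(x < n) cexp t ^+ x)) (cmod_1Bcexp_dist t).
  lra.
have [_|_] := leP 1 (n%:R * dist_int t); last by rewrite mulr1.
rewrite mulrC -mulrA -[leRHS]mulr1 ler_wpM2l //.
Qed.

End ComplexExponential.

(** * K-th roots, used in place of logarithms *)

Section Roots.
Variable R : realType.
Implicit Types (x y a b : R) (K n : nat).

(** Roots replace logarithms: harmonic sums and divisor functions are bounded by a constant times a
    [K]-th root with [K] as large as required, and a power saving absorbs it. *)
Definition kroot K x : R := x `^ K%:R^-1.

Lemma kroot_ge0 K x : 0 <= kroot K x. Proof. exact: powR_ge0. Qed.

Lemma kroot_gt0 K x : 0 < x -> 0 < kroot K x. Proof. exact: powR_gt0. Qed.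

Lemma krootK K x : (0 < K)%N -> 0 <= x -> kroot K x ^+ K = x.
Proof.
move=> K0 x0; rewrite /kroot -powR_mulrn ?powR_ge0 // -powRrM mulVf ?powRr1 //.
by rewrite pnatr_eq0 -lt0n.
Qed.

Lemma le_kroot K x y : 0 <= x -> x <= y -> kroot K x <= kroot K y.
Proof.
by move=> x0 xy; apply: ge0_ler_powR; rewrite ?nnegrE ?invr_ge0 //; lra.
Qed.

Lemma kroot_ge1 K x : 1 <= x -> 1 <= kroot K x.
Proof. by move=> x1; have <- : kroot K 1 = 1 by [rewrite /kroot powR1]; apply: le_kroot => //; lra. Qed.

Lemma le_kroot_exp K x y : (0 < K)%N -> 0 <= x -> 0 <= y -> x ^+ K <= y -> x <= kroot K y.
Proof.
move=> K0 x0 y0 h; rewrite -(ler_pXn2r K0) ?nnegrE ?kroot_ge0 //.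
by rewrite krootK.
Qed.

Lemma kroot_le_exp K x y : (0 < K)%N -> 0 <= x -> 0 <= y -> y <= x ^+ K -> kroot K y <= x.
Proof.
move=> K0 x0 y0 h; rewrite -(ler_pXn2r K0) ?nnegrE ?kroot_ge0 //.
by rewrite krootK.
Qed.

Lemma expB_le n a b : 0 <= a -> a <= b ->
  b ^+ n.+1 - a ^+ n.+1 <= n.+1%:R * (b - a) * b ^+ n.
Proof.
move=> a0 ab; rewrite subrXX [n.+1%:R * _]mulrC -mulrA ler_wpM2l ?subr_ge0 //.
rewrite -[n.+1 in leRHS]card_ord -sumr_const mulr_suml ler_sum // => i _.
rewrite mul1r /=.
apply: (@le_trans _ _ (b ^+ (n - i) * b ^+ i)).
  by rewrite ler_wpM2l ?exprn_ge0 ?lerXn2r ?nnegrE //; lra.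
by rewrite -exprD subnK // -ltnS.
Qed.

(** The mean value inequality for [n^(1/K)] without derivatives; both sums below telescope with
    it. *)
Lemma kroot_step K n : (0 < K)%N ->
  1 <= K%:R * (kroot K n.+1%:R - kroot K n%:R) * kroot K (n.+1%:R : R) ^+ K.-1.
Proof.
move=> K0; have ab : kroot K (n%:R : R) <= kroot K n.+1%:R.
  by apply: le_kroot; rewrite ?ler_nat.
have := expB_le K.-1 (kroot_ge0 K n%:R) ab; rewrite prednK // !krootK //.
by rewrite -addn1 natrD addrAC subrr add0r.
Qed.

Lemma sum_kroot_div K n : (0 < K)%N ->
  \sum_(l < n) kroot K (l.+1%:R : R) / l.+1%:R <= K%:R * kroot K n%:R.
Proof.
move=> K0; elim: n => [|n IH].
  by rewrite big_ord0 mulr_ge0 ?kroot_ge0.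
rewrite big_ord_recr /=.
suff : kroot K (n.+1%:R : R) / n.+1%:R <=
    K%:R * (kroot K n.+1%:R - kroot K n%:R).
  by move=> h; apply: le_trans (lerD IH h) _; rewrite mulrBr addrCA subrr addr0.
have b0 : 0 < kroot K (n.+1%:R : R) by apply: kroot_gt0; rewrite ltr0n.
rewrite -[X in _ / X](krootK (K := K)) // ler_pdivrMr ?exprn_gt0 //.
have := ler_wpM2l (ltW b0) (kroot_step n K0).
rewrite mulr1 => h; apply: le_trans h _.
by rewrite mulrCA -exprS prednK.
Qed.

Lemma sum_inv_kroot K m n : (0 < K)%N -> (0 < m)%N -> (m <= n)%N ->
  \sum_(m <= l < n) (l.+1%:R * kroot K (l.+1%:R : R))^-1 <= K%:R * (kroot K m%:R)^-1.
Proof.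
move=> K0 m0 mn.
(* The induction runs on the telescoped bound, with the end term still subtracted. *)
suff : \sum_(m <= l < n) (l.+1%:R * kroot K (l.+1%:R : R))^-1 <=
     K%:R * (kroot K m%:R)^-1 - K%:R * (kroot K (n%:R : R))^-1.
  move=> h; apply: le_trans h _; rewrite lerBlDr lerDl mulr_ge0 ?invr_ge0 ?kroot_ge0 //.
elim: n mn => [|n IH]; first by rewrite leqn0 => /eqP ->; rewrite big_geq // subrr.
rewrite leq_eqVlt => /orP[/eqP <-|]; first by rewrite big_geq // subrr.
rewrite ltnS => mn; rewrite big_nat_recr //=.
have a0 : 0 < kroot K (n%:R : R) by apply: kroot_gt0; rewrite ltr0n (leq_trans m0).
have b0 : 0 < kroot K (n.+1%:R : R) by apply: kroot_gt0; rewrite ltr0n.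
have ab : kroot K (n%:R : R) <= kroot K n.+1%:R by apply: le_kroot; rewrite ?ler_nat.
suff : (n.+1%:R * kroot K (n.+1%:R : R))^-1 <=
   K%:R * (kroot K n%:R)^-1 - K%:R * (kroot K (n.+1%:R : R))^-1.
  by move=> h; apply: le_trans (lerD (IH mn) h) _; rewrite addrA subrK.
have := kroot_step n K0.
rewrite -[X in (X * _)^-1](krootK (K := K)) //.
set a := kroot K n%:R in a0 ab *; set b := kroot K n.+1%:R in b0 ab *.
move=> h; rewrite -mulrBr.
have -> : a^-1 - b^-1 = (b - a) / (a * b).
  by field; rewrite !gt_eqF.
rewrite -div1r ler_pdivrMr ?mulr_gt0 ?exprn_gt0 //.
have -> : K%:R * ((b - a) / (a * b)) * (b ^+ K * b) = K%:R * (b - a) * b ^+ K / a.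
  by field; rewrite !gt_eqF.
rewrite ler_pdivlMr // mul1r; apply: (le_trans ab).
have := ler_wpM2l (ltW b0) h; rewrite mulr1 => h'; apply: (le_trans h').
by rewrite mulrCA -exprS prednK.
Qed.

Definition harmonic_sum n : R := \sum_(l < n) (l.+1%:R)^-1.

Lemma harmonic_sum_ge0 n : 0 <= harmonic_sum n.
Proof. by apply: sumr_ge0 => i _; rewrite invr_ge0. Qed.

Lemma harmonic_sum_kroot K n : (0 < K)%N -> harmonic_sum n <= K%:R * kroot K n%:R.
Proof.
move=> K0; apply: le_trans (sum_kroot_div n K0); apply: ler_sum => l _.
by rewrite ler_peMl ?invr_ge0 // kroot_ge1 // ler1n.
Qed.

End Roots.

(** * The divisor function is smaller than any power *)

Section Divisors.
Local Open Scope nat_scope.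
Implicit Types (m k p e : nat).

Definition ndiv m : nat := size (divisors m).

Lemma ndiv_pfactorM p e m : prime p -> coprime p m -> 0 < m ->
  ndiv (p ^ e * m) <= e.+1 * ndiv m.
Proof.
move=> pp cpm m0.
have m1 : 0 < p ^ e * m by rewrite muln_gt0 expn_gt0 prime_gt0.
have := size_allpairs (fun i d => p ^ i * d) (iota 0 e.+1) (divisors m).
rewrite size_iota => <-.
apply: uniq_leq_size; first exact: divisors_uniq.
move=> d; rewrite -dvdn_divisors // => dm.
have d0 : 0 < d := dvdn_gt0 m1 dm.
have [c cpc dE] := pfactor_coprime pp d0.
apply/allpairsP; exists (logn p d, c); rewrite [in X in [/\ X, _ & _]]mem_iota [fst _]/= [snd _]/=; split.
- rewrite leq0n add0n ltnS.
  have := dvdn_leq_log p m1 dm.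
  have -> // : logn p (p ^ e * m) = e.
  rewrite lognM //; last by rewrite expn_gt0 prime_gt0.
  by rewrite pfactorK // (logn_coprime cpm) addn0.
- rewrite -dvdn_divisors //; have : c %| p ^ e * m.
    by apply: dvdn_trans dm; rewrite dE dvdn_mulr.
  by rewrite Gauss_dvdr // coprime_sym coprimeXl.
- by rewrite mulnC.
Qed.

(** For the small primes: the factor [(e + 1)^k] coming from an exponent [e] is paid by a constant
    and by [2^e <= p^e]. *)
Lemma expn_le_exp2 k : exists B, 0 < B /\ forall e, e.+1 ^ k <= B * 2 ^ e.
Proof.
case: k => [|k]; first by exists 1; split => // e; rewrite expn0 mul1n expn_gt0.
exists (k.+1 ^ k.+1); split => [|e]; first by rewrite expn_gt0.
(* Taking only [e %/ (k + 1)] doublings here makes the [(k + 1)]-th power of the right-hand side at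
   most a constant times [2^e]. *)
have h : e.+1 <= k.+1 * 2 ^ (e %/ k.+1).
  apply: (@leq_trans (k.+1 * (e %/ k.+1).+1)); last by rewrite leq_mul2l ltn_expl ?orbT.
  by rewrite mulnC; exact: ltn_ceil.
apply: (@leq_trans ((k.+1 * 2 ^ (e %/ k.+1)) ^ k.+1)); first by rewrite leq_exp2r.
rewrite expnMn leq_mul2l; apply/orP; right; rewrite -expnM leq_exp2l //.
exact: leq_trunc_div.
Qed.

(** A prime [p >= 2^k] costs nothing, since [(e + 1)^k <= 2^(e k) <= p^e]; hence there is no
    constant here. *)
Lemma ndiv_large_primes k m : 0 < m -> (forall p, prime p -> p %| m -> 2 ^ k <= p) ->
  ndiv m ^ k <= m.
Proof.
elim/ltn_ind: m => m IH m0 hp.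
have [m1|m1] := leqP m 1.
  have -> : m = 1 by apply/eqP; rewrite eqn_leq m1.
  by rewrite /ndiv exp1n.
pose p := pdiv m; have pp : prime p := pdiv_prime m1.
have [c cpc mE] := pfactor_coprime pp m0.
have e0 : 0 < logn p m by rewrite logn_gt0 mem_primes pp m0 pdiv_dvd.
set e := logn p m in mE e0.
have c0 : 0 < c by move: m0; rewrite mE muln_gt0 => /andP[].
have cm : c < m.
  by rewrite mE -[X in X < _]muln1 ltn_mul2l c0 /= -[1](expn0 p) ltn_exp2l ?prime_gt1.
have {}IH : ndiv c ^ k <= c.
  by apply: IH => // r rp rc; apply: hp => //; rewrite mE dvdn_mulr.
rewrite [m in X in X <= _]mE [X in _ <= X]mE mulnC.
apply: (@leq_trans ((e.+1 * ndiv c) ^ k)).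
  by case: (k) => [//|k']; rewrite leq_exp2r // ndiv_pfactorM.
rewrite expnMn; apply: leq_mul => //.
apply: (@leq_trans ((2 ^ e) ^ k)).
  by case: (k) => [//|k']; rewrite leq_exp2r // ltn_expl.
rewrite -expnM mulnC expnM leq_exp2r //; apply: hp => //; exact: pdiv_dvd.
Qed.

Lemma ndiv_bound k : exists C, 0 < C /\ forall m, 0 < m -> ndiv m ^ k <= C * m.
Proof.
have [B [B0 HB]] := expn_le_exp2 k.
(* [t] measures how far below [2^k] the prime factors may lie. Each step of the induction removes
   one possible factor, [2^k - (t + 1)], at the cost of one more constant [B]. *)
have main t : forall m, 0 < m ->
    (forall p, prime p -> p %| m -> 2 ^ k <= p + t) -> ndiv m ^ k <= B ^ t * m.
  elim: t => [|t IH] m m0 hp.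
    by rewrite mul1n; apply: ndiv_large_primes => // p pp pm; rewrite -[p]addn0 hp.
  pose p := 2 ^ k - t.+1.
  case: (boolP (prime p && (p %| m))) => [/andP[pp pm]|np]; last first.
    apply: leq_trans (IH m m0 _) _; last by rewrite leq_mul2r expnS leq_pmull ?orbT.
    move=> r rp rm; have := hp r rp rm.
    rewrite leq_eqVlt => /orP[/eqP rE|]; last by rewrite addnS ltnS.
    move: np; suff -> : p = r by rewrite rp rm.
    by rewrite /p rE addnK.
  have [c cpc mE] := pfactor_coprime pp m0; set e := logn p m in mE.
  have c0 : 0 < c by move: m0; rewrite mE muln_gt0 => /andP[].
  have hc : ndiv c ^ k <= B ^ t * c.
    apply: IH => // r rp rc.
    have := hp r rp _; rewrite mE dvdn_mulr // => /(_ isT).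
    rewrite leq_eqVlt => /orP[/eqP rE|]; last by rewrite addnS ltnS.
    have rE' : r = p by rewrite /p rE addnK.
    by move: cpc; rewrite -rE' prime_coprime // rc.
  rewrite mE mulnC.
  apply: (@leq_trans ((e.+1 * ndiv c) ^ k)).
    by case: (k) => [//|k']; rewrite leq_exp2r // ndiv_pfactorM.
  rewrite expnMn.
  apply: (@leq_trans ((B * 2 ^ e) * (B ^ t * c))); first by apply: leq_mul.
  rewrite -mulnA [2 ^ e * _]mulnCA mulnA -expnS leq_mul2l; apply/orP; right.
  by rewrite leq_mul2r; case: (e) => [|e']; rewrite ?orbT // leq_exp2r ?prime_gt1 ?orbT.
exists (B ^ (2 ^ k)); split; first by rewrite expn_gt0 B0.
by move=> m m0; apply: main => // p _ _; rewrite leq_addl.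
Qed.

Lemma card_mul_eq n m : 0 < m ->
  #|[pred p : 'I_n * 'I_n | (0 < p.1) && (0 < p.2) && (p.1 * p.2 == m)]| <= ndiv m.
Proof.
move=> m0; rewrite cardE -(size_map (fun p : 'I_n * 'I_n => nat_of_ord p.1)).
apply: uniq_leq_size.
  rewrite map_inj_in_uniq ?enum_uniq // => [[a b] [c d]].
  rewrite !mem_enum !inE /= => /andP[/andP[a0 _] /eqP e1] /andP[_ /eqP e2] ac.
  have acE : a = c by apply: val_inj.
  congr (_, _) => //; apply: val_inj => /=; apply/eqP.
  by rewrite -(eqn_pmul2l a0) e1 {1}acE e2.
move=> h /mapP[[a b]]; rewrite mem_enum inE /= => /andP[_ /eqP e] ->.
by rewrite -dvdn_divisors // -e dvdn_mulr.
Qed.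

End Divisors.

(** Collecting the terms by [m = h k], each [m] arises at most once for each of its divisors [h]. *)
Lemma sum_mul_le_ndiv (R : realType) (n D : nat) (phi : nat -> R) :
  (forall m, 0 <= phi m) ->
  (forall m, (0 < m < n ^ 2)%N -> (ndiv m <= D)%N) ->
  \sum_(h < n | (0 < h)%N) \sum_(k < n | (0 < k)%N) phi (h * k)%N <=
    D%:R * \sum_(m < n ^ 2 | (0 < m)%N) phi m.
Proof.
move=> phi0 hD; rewrite pair_big /=.
have lt (p : 'I_n * 'I_n) : (p.1 * p.2 < n ^ 2)%N.
  by case: p => a b /=; rewrite expnS expn1; apply: ltn_mul.
rewrite (partition_big (fun p => Ordinal (lt p)) (fun m => 0 < m)%N) /=; last first.
  by move=> p /andP[a b]; rewrite muln_gt0 a b.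
rewrite big_distrr /=; apply: ler_sum => m m0.
rewrite (eq_bigr (fun _ => phi m)); last by move=> p /andP[_ /eqP <-].
rewrite sumr_const -[_ *+ #|_|]mulr_natl ler_wpM2r // ler_nat.
apply: leq_trans (hD m _); last by rewrite m0 ltn_ord.
apply: leq_trans (card_mul_eq n m0); apply: subset_leq_card.
by apply/fintype.subsetP => p; rewrite !inE => /andP[-> /eqP <-] /=.
Qed.

(** * Weyl differencing and Weyl's inequality *)

Section Differencing.
Variable R : realType.
Implicit Types (n h k : nat) (g : nat -> R).

Lemma sum_pos_range (V : nmodType) n (F : nat -> V) :
  \sum_(1 <= h < n) F h = \sum_(h < n | (0 < h)%N) F h.
Proof.
case: n => [|n]; first by rewrite big_geq // big_ord0.
by rewrite [RHS]big_mkcond big_ord_recl /= add0r big_add1 big_mkord.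
Qed.

Lemma sqr_sum_le n (a : nat -> R) :
  (\sum_(i < n) a i) ^+ 2 <= n%:R * \sum_(i < n) a i ^+ 2.
Proof.
have -> : n%:R * \sum_(i < n) a i ^+ 2 =
    \sum_(i < n) \sum_(j < n) (a i ^+ 2 + a j ^+ 2) / 2.
  under [RHS]eq_bigr => i _ do rewrite -mulr_suml big_split /= sumr_const card_ord.
  rewrite -mulr_suml big_split /= sumr_const card_ord sumrMnl mulr_natl; set u := _ *+ n; lra.
rewrite expr2 big_distrl /=; apply: ler_sum => i _.
rewrite big_distrr /=; apply: ler_sum => j _.
have := sqr_ge0 (a i - a j); rewrite ler_pdivlMr // sqrrB; lra.
Qed.

(** Induction on [n]: a new last term contributes its correlations with all the earlier ones, one at
    each distance [h]. *)
Lemma cmod_sqr_cexp_sum n g :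
  cmod (\sum_(x < n) cexp (g x)) ^+ 2 =
    n%:R + 2 * \sum_(1 <= h < n) Re (\sum_(x < n - h) cexp (g (x + h)%N - g x)).
Proof.
elim: n => [|n IH].
  by rewrite big_ord0 cmod0 expr0n big_geq // mulr0 addr0.
have sqD (z w : R[i]) : cmod (z + w) ^+ 2 = cmod z ^+ 2 + cmod w ^+ 2 + 2 * Re (w * (z^*)%C).
  by rewrite !cmod_sqr; case: z => a b; case: w => c d /=; ring.
rewrite big_ord_recr /= sqD IH cmod_cexp expr1n.
have -> : \sum_(1 <= h < n.+1) Re (\sum_(x < n.+1 - h) cexp (g (x + h)%N - g x)) =
    \sum_(1 <= h < n) Re (\sum_(x < n - h) cexp (g (x + h)%N - g x)) +
    \sum_(1 <= h < n.+1) Re (cexp (g n - g (n - h)%N)).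
  rewrite (@eq_big_nat _ _ _ _ _ _ (fun h => Re (\sum_(x < n - h) cexp (g (x + h)%N - g x))
     + Re (cexp (g n - g (n - h)%N)))); last first.
    move=> h /andP[h1 h2]; rewrite subSn // big_ord_recr /= raddfD /= subnK //.
  rewrite big_split /=; congr (_ + _).
  case: (n) => [|m]; first by rewrite !big_geq.
  by rewrite big_nat_recr //= subnn big_ord0 addr0.
have -> : Re (cexp (g n) * ((\sum_(i < n) cexp (g i))^*)%C) =
   \sum_(1 <= h < n.+1) Re (cexp (g n - g (n - h)%N)).
  rewrite rmorph_sum /= big_distrr /= Re_sum big_add1 /= big_mkord.
  rewrite (reindex_inj rev_ord_inj) /=; apply: eq_bigr => i _.
  by rewrite mulrBr cosB mulrN opprK.
rewrite -natr1; ring.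
Qed.

Lemma differencing n g :
  cmod (\sum_(x < n) cexp (g x)) ^+ 2 <=
    n%:R + 2 * \sum_(1 <= h < n) cmod (\sum_(x < n - h) cexp (g (x + h)%N - g x)).
Proof.
rewrite cmod_sqr_cexp_sum lerD2l ler_pM2l // ler_sum // => h _.
exact: Re_le_cmod.
Qed.

Lemma trunc_inv_mono m n (t : R) : (m <= n)%N -> 0 <= t -> trunc_inv m t <= trunc_inv n t.
Proof.
move=> mn t0; have mn' : m%:R <= n%:R :> R by rewrite ler_nat.
rewrite /trunc_inv ler_pdivrMr ?lt_max ?ltr01 //.
have m0 : 0 <= m%:R :> R := ler0n _ _.
rewrite mulrAC ler_pdivlMr ?lt_max ?ltr01 //.
have [h1|h1] := leP 1 (n%:R * t); have [h2|h2] := leP 1 (m%:R * t); nra.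
Qed.

Definition weyl_sum n (th al : R) : R[i] := \sum_(x < n) cexp (al * (x%:R + th) ^+ 3).

Lemma cmod_weyl_sum_le n th al : cmod (weyl_sum n th al) <= n%:R.
Proof.
apply: le_trans (cmod_sum _ _ _) _.
rewrite (eq_bigr (fun _ => 1)); last by move=> x _; rewrite cmod_cexp.
by rewrite sumr_const card_ord.
Qed.

(** Two differencings make the phase linear in [x], with slope [6 al h k]. The shift [th] enters
    only its constant term, so the bound is the same for every real shift. *)
Lemma weyl_inequality n th al :
  cmod (weyl_sum n th al) ^+ 4 <= 10 * n%:R ^+ 3 + 16 * n%:R *
    \sum_(h < n | (0 < h)%N) \sum_(k < n | (0 < k)%N)
      trunc_inv n (dist_int (6 * al * (h * k)%:R)).
Proof.
case: n => [|n0].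
  by rewrite /weyl_sum !big_ord0 cmod0 mulr0 addr0 !expr0n /= mulr0.
set n := n0.+1; have n1 : 1 <= n%:R :> R by rewrite ler1n.
pose G h : R[i] := \sum_(x < n - h) cexp (al * ((x + h)%N%:R + th) ^+ 3 - al * (x%:R + th) ^+ 3).
have h1 : cmod (weyl_sum n th al) ^+ 2 <= n%:R + 2 * \sum_(1 <= h < n) cmod (G h).
  exact: differencing (fun x => al * (x%:R + th) ^+ 3).
have h2 h : (1 <= h < n)%N -> cmod (G h) ^+ 2 <= n%:R +
    2 * \sum_(1 <= k < n) trunc_inv n (dist_int (6 * al * (h * k)%:R)).
  move=> /andP[_ hn].
  apply: le_trans (differencing (n - h)
    (fun x => al * ((x + h)%N%:R + th) ^+ 3 - al * (x%:R + th) ^+ 3)) _.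
  apply: lerD; first by rewrite ler_nat leq_subr.
  rewrite ler_pM2l //.
  apply: (@le_trans _ _ (\sum_(1 <= k < n - h) trunc_inv n (dist_int (6 * al * (h * k)%:R)))).
    apply: ler_sum => k _.
    rewrite (eq_bigr (fun x : 'I_(n - h - k) => cexp ((6 * al * (h * k)%:R) * x%:R +
      al * (h%:R * k%:R) * (6 * th + 3 * h%:R + 3 * k%:R)))); last first.
      by move=> x _; congr cexp; rewrite !natrD natrM; ring.
    apply: le_trans (geometric_cexp_le _ _ _) _.
    by apply: trunc_inv_mono (dist_int_ge0 _); rewrite -subnDA leq_subr.
  rewrite [leRHS](@big_cat_nat _ _ _ (n - h)) ?leq_subr ?subn_gt0 //=.
  by rewrite lerDl sumr_ge0 // => k _; exact: trunc_inv_ge0.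
have h3 : (\sum_(1 <= h < n) cmod (G h)) ^+ 2 <= n%:R * \sum_(1 <= h < n) cmod (G h) ^+ 2.
  rewrite !big_add1 /= !big_mkord; apply: le_trans (sqr_sum_le _ (fun i => cmod (G i.+1))) _.
  by rewrite ler_wpM2r ?ler_nat // sumr_ge0 // => i _; exact: sqr_ge0.
have h4 : \sum_(1 <= h < n) cmod (G h) ^+ 2 <= n%:R * n%:R + 2 *
    \sum_(1 <= h < n) \sum_(1 <= k < n) trunc_inv n (dist_int (6 * al * (h * k)%:R)).
  apply: (@le_trans _ _ (\sum_(1 <= h < n) (n%:R +
    2 * \sum_(1 <= k < n) trunc_inv n (dist_int (6 * al * (h * k)%:R))))).
    by rewrite big_nat [leRHS]big_nat; apply: ler_sum.
  rewrite big_split /= -mulr_sumr lerD2r sumr_const_nat -[_ *+ (n - 1)]mulr_natl ler_wpM2r //.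
  by rewrite ler_nat subSS subn0.
have -> : \sum_(h < n | (0 < h)%N) \sum_(k < n | (0 < k)%N)
      trunc_inv n (dist_int (6 * al * (h * k)%:R)) =
    \sum_(1 <= h < n) \sum_(1 <= k < n) trunc_inv n (dist_int (6 * al * (h * k)%:R)).
  by rewrite sum_pos_range; apply: eq_bigr => h _; rewrite sum_pos_range.
move: h1 h3 h4; set S := \sum_(1 <= h < n) cmod (G h).
set S2 := \sum_(1 <= h < n) cmod (G h) ^+ 2; set T := \sum_(1 <= h < n) _.
have S0 : 0 <= S by apply: sumr_ge0 => h _; exact: cmod_ge0.
have := cmod_ge0 (weyl_sum n th al); set f := cmod _ => f0 h1 h3 h4.
have h5 : (f ^+ 2) ^+ 2 <= (n%:R + 2 * S) ^+ 2.
  by rewrite lerXn2r ?nnegrE ?sqr_ge0 //; lra.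
have h6 : (n%:R + 2 * S) ^+ 2 <= 2 * n%:R ^+ 2 + 8 * S ^+ 2.
  by have := sqr_ge0 (n%:R - 2 * S); rewrite sqrrB sqrrD; lra.
have h7 : n%:R * S2 <= n%:R * (n%:R * n%:R + 2 * T) by rewrite ler_wpM2l //; lra.
have h8 : n%:R ^+ 2 <= n%:R ^+ 3 :> R by rewrite [leRHS]exprS ler_peMl ?sqr_ge0.
rewrite -exprM in h5.
have -> : 10 * n%:R ^+ 3 + 16 * n%:R * T = 2 * n%:R ^+ 3 + 8 * (n%:R * (n%:R * n%:R + 2 * T)).
  by ring.
lra.
Qed.

End Differencing.

(** * Distribution of multiples modulo 1 over a block of length q *)

Section Residues.
Variable R : realType.
Implicit Types (n q a b c m : nat).

Lemma sum_residues (V : nmodType) q a c (g : nat -> V) : (0 < q)%N -> coprime a q ->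
  \sum_(i < q) g ((a * i + c) %% q)%N = \sum_(b < q) g b.
Proof.
move=> q0 cop.
pose s (i : 'I_q) := Ordinal (ltn_pmod (a * i + c) q0).
have s_inj : injective s.
  move=> i j /(congr1 val) /= /eqP; rewrite eqn_modDr.
  move=> /eqP h; apply: val_inj => /=.
  have {}h : (i == j %[mod q])%N.
    wlog : i j h / (j <= i)%N.
      move=> H; case: (leqP j i) => [/H|/ltnW/H]; first by apply.
      by rewrite eq_sym; apply.
    move=> ji; move/eqP: h; rewrite !eqn_mod_dvd ?leq_mul2l ?ji ?orbT //.
    by rewrite -mulnBr Gauss_dvdr // coprime_sym.
  by move: h; rewrite !modn_small // => /eqP.
by rewrite [RHS](reindex_inj s_inj).
Qed.

(** A residue [b] is at distance at least [min(b, q - b)] from every multiple of [q], and the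
    perturbation [e] lowers this by at most [c]. *)
Lemma dist_int_residue q b (w : int) (e c : R) : (b < q)%N -> `|e| <= c / q%:R ->
  ((minn b (q - b))%:R - c) / q%:R <= dist_int ((b%:R + q%:R * w%:~R) / q%:R + e).
Proof.
move=> bq he; have q0 : 0 < q%:R :> R by rewrite ltr0n; case: (q) bq.
have [m ->] := dist_intE ((b%:R + q%:R * w%:~R) / q%:R + e).
have -> : (b%:R + q%:R * w%:~R) / q%:R + e - m%:~R =
    (b%:R + q%:R * (w - m)%:~R) / q%:R + e :> R.
  by rewrite intrD mulrNz; field; rewrite gt_eqF.
move: (w - m) => z.
suff h : (minn b (q - b))%:R / q%:R <= `|(b%:R + q%:R * z%:~R) / q%:R| :> R.
  have := lerB_normD ((b%:R + q%:R * z%:~R) / q%:R) e.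
  by rewrite mulrBl; lra.
rewrite normrM [`|_^-1|]ger0_norm ?invr_ge0 // ler_pM2r ?invr_gt0 //.
have bq' : b%:R <= q%:R :> R by rewrite ler_nat ltnW.
have m1 : (minn b (q - b))%:R <= b%:R :> R by rewrite ler_nat geq_minl.
have m2 : (minn b (q - b))%:R <= q%:R - b%:R :> R.
  by rewrite -natrB 1?ltnW // ler_nat geq_minr.
have [z0|z0] := leP 0 z.
  have z0' : 0 <= z%:~R :> R by rewrite ler0z.
  have := mulr_ge0 (ltW q0) z0' => u; have b0 : 0 <= b%:R :> R := ler0n _ _.
  by rewrite ger0_norm; lra.
have z0' : z%:~R + 1 <= 0 :> R by rewrite -[1]/(1%:~R) -intrD -[0]/(0%:~R) ler_int; lia.
have u : q%:R * (z%:~R + 1) <= 0 :> R by rewrite pmulr_rle0.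
by rewrite ler0_norm; lra.
Qed.

Lemma sum_inv_ord q : \sum_(b < q) (b%:R : R)^-1 <= harmonic_sum R q.
Proof.
case: q => [|q]; first by rewrite /harmonic_sum !big_ord0.
rewrite big_ord_recl /= invr0 add0r /harmonic_sum big_ord_recr /=.
by rewrite lerDl invr_ge0.
Qed.

Lemma sum_inv_revord q : \sum_(b < q) ((q - b)%:R : R)^-1 = harmonic_sum R q.
Proof.
rewrite (reindex_inj rev_ord_inj) /=; apply: eq_bigr => b _.
by rewrite subKn.
Qed.

Lemma inv_minn_le b q : (b < q)%N ->
  ((minn b (q - b))%:R : R)^-1 <= b%:R^-1 + (q - b)%:R^-1.
Proof. by move=> bq; rewrite /minn; case: ltnP => _; rewrite ?lerDl ?lerDr invr_ge0. Qed.

Lemma sum_blocks q Z (phi : nat -> R) : (0 < q)%N -> (forall m, 0 <= phi m) ->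
  \sum_(m < Z | (0 < m)%N) phi m <= \sum_(t < (Z %/ q).+1) \sum_(i < q) phi (t * q + i)%N.
Proof.
move=> q0 phi0.
have -> : \sum_(t < (Z %/ q).+1) \sum_(i < q) phi (t * q + i)%N = \sum_(m < (Z %/ q).+1 * q) phi m.
  elim: (_.+1) => [|t IH]; first by rewrite mul0n !big_ord0.
  rewrite big_ord_recr /= IH mulSn addnC big_split_ord /=; congr (_ + _).
apply: (@le_trans _ _ (\sum_(m < Z) phi m)).
  rewrite [leLHS]big_mkcond; apply: ler_sum => m _; case: ifP => _ //.
rewrite (big_ord_widen ((Z %/ q).+1 * q) phi); last by rewrite ltnW // ltn_ceil.
by rewrite [leLHS]big_mkcond; apply: ler_sum => m _; case: ifP.
Qed.

Lemma block_minor n q a m0 (al : R) : (0 < q)%N -> coprime a q -> 0 <= al ->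
  `|al - a%:R / q%:R| <= (q%:R ^+ 2)^-1 ->
  \sum_(i < q) trunc_inv n (dist_int (al * (m0 + i)%:R)) <=
    8 * n%:R + 4 * q%:R * harmonic_sum R q.
Proof.
move=> q0 cop al0 hal.
have qR : 0 < q%:R :> R by rewrite ltr0n.
(* Rounding the starting point of the block costs at most [1/q], and the drift of [al] from [a/q]
   along the block at most another [1/q]. *)
pose c := Num.trunc (q%:R * al * m0%:R).
(* Residues less than 4 away from 0 or [q] take the trivial bound [n]; for the others the error
   [2/q] is at most half of the distance. *)
pose G (b : nat) : R := n%:R * (b < 4)%:R + n%:R * (q - b < 4)%:R +
  2 * q%:R * (b%:R^-1 + (q - b)%:R^-1).
have cge : 0 <= q%:R * al * m0%:R by rewrite !mulr_ge0.
have cle : c%:R <= q%:R * al * m0%:R by case/andP: (truncn_itv cge).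
have clt : q%:R * al * m0%:R < c%:R + 1 by rewrite natr1; case/andP: (truncn_itv cge).
apply: (@le_trans _ _ (\sum_(i < q) G ((a * i + c) %% q)%N)).
  apply: ler_sum => i _.
  set b := ((a * i + c) %% q)%N; have bq : (b < q)%N := ltn_pmod _ q0.
  have Gp : 0 <= 2 * q%:R * (b%:R^-1 + (q - b)%:R^-1) :> R.
    by rewrite !mulr_ge0 ?addr_ge0 ?invr_ge0.
  have [b4|b4] := ltnP b 4.
    apply: le_trans (trunc_inv_le_n _ _) _.
    by rewrite /G b4 mulr1 -addrA lerDl addr_ge0 // mulr_ge0.
  have [qb4|qb4] := ltnP (q - b) 4.
    apply: le_trans (trunc_inv_le_n _ _) _.
    by rewrite /G qb4 mulr1 addrAC lerDr addr_ge0 // mulr_ge0.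
  have hm : (4 <= minn b (q - b))%N by rewrite leq_min b4.
  have hmR : 4 <= (minn b (q - b))%:R :> R by rewrite ler_nat.
  pose e := al * (m0 + i)%:R - (a * i + c)%:R / q%:R.
  have he : `|e| <= 2 / q%:R.
    rewrite ler_pdivlMr // -[X in _ * X]ger0_norm // -normrM.
    have -> : e * q%:R = (q%:R * al * m0%:R - c%:R) +
       (q%:R ^+ 2 * (al - a%:R / q%:R)) * (i%:R / q%:R).
      by rewrite /e !natrD natrM; field; rewrite gt_eqF.
    apply: le_trans (ler_normD _ _) _.
    have t1 : `|q%:R * al * m0%:R - c%:R| <= 1.
      by rewrite ger0_norm; lra.
    have t2 : `|q%:R ^+ 2 * (al - a%:R / q%:R) * (i%:R / q%:R)| <= 1.
      rewrite normrM -[leRHS]mulr1; apply: ler_pM => //.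
        rewrite normrM ger0_norm ?sqr_ge0 // mulrC -ler_pdivlMr ?exprn_gt0 //.
        by rewrite mul1r.
      rewrite ger0_norm ?divr_ge0 // // ler_pdivrMr // mul1r ler_nat ltnW //.
    lra.
  have := dist_int_residue ((a * i + c) %/ q)%N%:Z bq he.
  have -> : (b%:R + q%:R * ((a * i + c) %/ q)%N%:Z%:~R) / q%:R + e =
      al * (m0 + i)%:R :> R.
    rewrite -pmulrn -natrM -natrD addnC mulnC -divn_eq /e addrC subrK //.
  move=> hd.
  have hd2 : (minn b (q - b))%:R / (2 * q%:R) <= dist_int (al * (m0 + i)%:R).
    apply: le_trans hd; rewrite ler_pdivrMr ?mulr_gt0 //.
    have -> : ((minn b (q - b))%:R - 2) / q%:R * (2 * q%:R) = 2 * ((minn b (q - b))%:R - 2) :> R.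
      by field; rewrite gt_eqF.
    lra.
  have mp : 0 < (minn b (q - b))%:R / (2 * q%:R) :> R.
    by rewrite divr_gt0 ?mulr_gt0 //; lra.
  apply: le_trans (trunc_inv_le_inv n (lt_le_trans mp hd2)) _.
  apply: (@le_trans _ _ (2 * q%:R * (minn b (q - b))%:R^-1)).
    have -> : 2 * q%:R * (minn b (q - b))%:R^-1 = ((minn b (q - b))%:R / (2 * q%:R))^-1 :> R.
      by rewrite invf_div.
    by rewrite lef_pV2 // posrE (lt_le_trans mp).
  rewrite /G; apply: (@le_trans _ _ (2 * q%:R * (b%:R^-1 + (q - b)%:R^-1))).
    by rewrite ler_wpM2l ?mulr_ge0 // inv_minn_le.
  by rewrite lerDr addr_ge0 // mulr_ge0.
rewrite (sum_residues c G q0 cop) /G !big_split /= -!mulr_sumr big_split /=.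
rewrite sum_inv_revord.
have s1 : \sum_(b < q) (b < 4)%:R <= 4 :> R.
  rewrite -natr_sum ler_nat.
  rewrite (eq_bigr (fun b : 'I_q => if (b < 4)%N then 1%N else 0%N)); last first.
    by move=> b _; case: (b < 4)%N.
  rewrite -big_mkcond sum1dep_card -[leqRHS](card_ord 4).
  pose F (b : 'I_q) : 'I_4 := inord b.
  rewrite -(card_in_imset (f := F)) ?max_card // => x y; rewrite !inE => hx hy.
  by move/(congr1 val); rewrite /= !inordK // => /val_inj.
have s2 : \sum_(b < q) (q - b < 4)%:R <= 4 :> R.
  apply: le_trans s1; rewrite (reindex_inj rev_ord_inj) /=; apply: ler_sum => b _.
  rewrite subKn // ler_nat; case: ltnP => // h; rewrite (ltn_trans (ltnSn b)) //.
have := sum_inv_ord q; have n0 : 0 <= n%:R :> R := ler0n _ _.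
have := ler_wpM2l n0 s1; have := ler_wpM2l n0 s2 => u1 u2 u3.
have := ler_wpM2l (ltW qR) u3; rewrite mulrDr => u4.
lra.
Qed.

End Residues.

(** * Weyl sums at a rational approximation *)

Section WeylBounds.
Variable R : realType.
Implicit Types (n q a m d : nat) (al be th : R).

Lemma dist_intD (x : R) (m : int) : dist_int (x + m%:~R) = dist_int x.
Proof.
apply/eqP; rewrite eq_le; apply/andP; split.
  have [k ->] := dist_intE x; have := dist_int_le (x + m%:~R) (k + m).
  by rewrite intrD opprD addrACA subrr addr0.
have [k ->] := dist_intE (x + m%:~R); have := dist_int_le x (k - m).
by rewrite intrD mulrNz opprB addrA addrAC.
Qed.

Lemma blocks_natr_le q Z : ((Z %/ q).+1%:R : R) <= Z%:R / q%:R + 1.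
Proof.
case: q => [|q]; first by rewrite divn0 invr0 mulr0 add0r.
rewrite -natr1 lerD2r ler_pdivlMr ?ltr0n // -natrM ler_nat.
exact: leq_trunc_div.
Qed.

(** The number approximated is [6 al], because that is the slope left after the differencing. *)
Lemma weyl_minor n q a D th al : (0 < q)%N -> coprime a q -> 0 <= al ->
  (forall m, (0 < m < n ^ 2)%N -> (ndiv m <= D)%N) ->
  `|6 * al - a%:R / q%:R| <= (q%:R ^+ 2)^-1 ->
  cmod (weyl_sum n th al) ^+ 4 <= 10 * n%:R ^+ 3 + 16 * n%:R *
    (D%:R * ((n%:R ^+ 2 / q%:R + 1) * (8 * n%:R + 4 * q%:R * harmonic_sum R q))).
Proof.
move=> q0 cop al0 hD hal; apply: le_trans (weyl_inequality _ _ _) _.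
rewrite lerD2l ler_wpM2l ?mulr_ge0 //.
pose phi m := trunc_inv n (dist_int (6 * al * m%:R)).
have phi0 m : 0 <= phi m by exact: trunc_inv_ge0.
apply: le_trans (sum_mul_le_ndiv phi0 hD) _; rewrite ler_wpM2l //.
apply: le_trans (sum_blocks (n ^ 2) q0 phi0) _.
have B0 : 0 <= 8 * n%:R + 4 * q%:R * harmonic_sum R q.
  by rewrite addr_ge0 ?mulr_ge0 ?harmonic_sum_ge0.
apply: (@le_trans _ _ (\sum_(t < (n ^ 2 %/ q).+1) (8 * n%:R + 4 * q%:R * harmonic_sum R q))).
  by apply: ler_sum => t _; apply: block_minor (cop) _ hal => //; rewrite mulr_ge0.
rewrite sumr_const card_ord -[_ *+ _.+1]mulr_natl ler_wpM2r //.
by apply: le_trans (blocks_natr_le _ _) _; rewrite natrX.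
Qed.

(** The approximation is so good that a nonzero residue keeps at least half of its distance, so no
    term of size [n] appears; the multiples of [q] are treated apart. *)
Lemma sum_nonmultiples n q a Z al : (0 < q)%N -> coprime a q -> 0 <= al ->
  (forall m, (m < Z)%N -> `|al - a%:R / q%:R| * m%:R <= (2 * q%:R)^-1) ->
  \sum_(m < Z | (0 < m)%N) (if (q %| m)%N then 0 else trunc_inv n (dist_int (al * m%:R)))
    <= (Z%:R / q%:R + 1) * (4 * q%:R * harmonic_sum R q).
Proof.
move=> q0 cop al0 hal; have qR : 0 < q%:R :> R by rewrite ltr0n.
pose G (b : nat) : R := 2 * q%:R * (b%:R^-1 + (q - b)%:R^-1).
have G0 b : 0 <= G b by rewrite !mulr_ge0 ?addr_ge0 ?invr_ge0.
apply: (@le_trans _ _ (\sum_(m < Z | (0 < m)%N) G ((a * m) %% q)%N)).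
  apply: ler_sum => m _; case: ifP => [_|/negbT qm] //.
  set b := ((a * m) %% q)%N; have bq : (b < q)%N := ltn_pmod _ q0.
  have b0 : (0 < b)%N.
    rewrite lt0n; apply: contra qm => /eqP b0.
    have : (q %| a * m)%N by apply/eqP.
    by rewrite Gauss_dvdr // coprime_sym.
  have hm : (1 <= minn b (q - b))%N by rewrite leq_min b0 subn_gt0.
  have hmR : 1 <= (minn b (q - b))%:R :> R by rewrite ler1n.
  pose e := al * m%:R - (a * m)%:R / q%:R.
  have he : `|e| <= 2^-1 / q%:R.
    have -> : e = (al - a%:R / q%:R) * m%:R by rewrite /e natrM; ring.
    rewrite normrM [`|m%:R|]ger0_norm // -invfM; exact: hal.
  have := dist_int_residue ((a * m) %/ q)%N%:Z bq he.
  have -> : (b%:R + q%:R * ((a * m) %/ q)%N%:Z%:~R) / q%:R + e = al * m%:R :> R.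
    by rewrite -pmulrn -natrM -natrD addnC mulnC -divn_eq /e addrC subrK.
  move=> hd.
  have hd2 : (minn b (q - b))%:R / (2 * q%:R) <= dist_int (al * m%:R).
    apply: le_trans hd; rewrite ler_pdivrMr ?mulr_gt0 //.
    have -> : ((minn b (q - b))%:R - 2^-1) / q%:R * (2 * q%:R) =
        2 * ((minn b (q - b))%:R - 2^-1) :> R.
      by field; rewrite gt_eqF.
    lra.
  have mp : 0 < (minn b (q - b))%:R / (2 * q%:R) :> R.
    by rewrite divr_gt0 ?mulr_gt0 //; lra.
  apply: le_trans (trunc_inv_le_inv n (lt_le_trans mp hd2)) _.
  apply: (@le_trans _ _ (2 * q%:R * (minn b (q - b))%:R^-1)).
    have -> : 2 * q%:R * (minn b (q - b))%:R^-1 = ((minn b (q - b))%:R / (2 * q%:R))^-1 :> R.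
      by rewrite invf_div.
    by rewrite lef_pV2 // posrE (lt_le_trans mp).
  by rewrite /G ler_wpM2l ?mulr_ge0 // inv_minn_le.
apply: le_trans (@sum_blocks _ q Z (fun m => G ((a * m) %% q)%N) q0 (fun m => G0 _)) _.
have H0 : 0 <= 4 * q%:R * harmonic_sum R q by rewrite !mulr_ge0 ?harmonic_sum_ge0.
apply: (@le_trans _ _ (\sum_(t < (Z %/ q).+1) (4 * q%:R * harmonic_sum R q))).
  apply: ler_sum => t _.
  rewrite (eq_bigr (fun i : 'I_q => G ((a * i + 0) %% q)%N)); last first.
    by move=> i _; rewrite addn0 mulnDr mulnA modnMDl.
  rewrite (sum_residues 0 G q0 cop) /G -mulr_sumr big_split /= sum_inv_revord.
  have -> : 4 * q%:R * harmonic_sum R q =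
      2 * q%:R * (harmonic_sum R q + harmonic_sum R q) by ring.
  by rewrite ler_wpM2l ?mulr_ge0 // lerD2r sum_inv_ord.
by rewrite sumr_const card_ord -[_ *+ _.+1]mulr_natl ler_wpM2r // blocks_natr_le.
Qed.

Local Notation rho := (@kroot R 4).

Lemma krootM K (x y : R) : 0 <= x -> 0 <= y -> kroot K (x * y) = kroot K x * kroot K y.
Proof. by move=> x0 y0; rewrite /kroot powRM. Qed.

Lemma sum_multiples d n (F : nat -> R) : (0 < d)%N ->
  \sum_(k < n.+1 | (0 < k)%N && (d %| k)%N) F k = \sum_(l < n %/ d) F (d * l.+1)%N.
Proof.
move=> d0; elim: n => [|n IH].
  by rewrite div0n big_ord0 big_mkcond big_ord_recl big_ord0 /= addr0.
rewrite big_mkcond big_ord_recr /= -big_mkcond /= IH divnS //.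
case: ifP => [dn|_]; last by rewrite add0n addr0.
rewrite add1n big_ord_recr /=; congr (_ + F _).
rewrite -[LHS](divnK dn) divnS // dn add1n mulnC //.
Qed.

Lemma sum_kroot_multiples d n : (0 < d)%N ->
  \sum_(k < n | (0 < k)%N && (d %| k)%N) rho k%:R / k%:R <= 4 * rho n%:R / d%:R.
Proof.
move=> d0; have dR : 0 < d%:R :> R by rewrite ltr0n.
case: n => [|n]; first by rewrite big_ord0 !mulr_ge0 ?invr_ge0 ?kroot_ge0.
rewrite (sum_multiples n (fun k => rho k%:R / k%:R)) //.
rewrite (eq_bigr (fun l : 'I_(n %/ d) => (rho d%:R / d%:R) * (rho l.+1%:R / l.+1%:R))); last first.
  by move=> l _; rewrite natrM krootM // invfM mulrACA.
rewrite -mulr_sumr.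
apply: (@le_trans _ _ (rho d%:R / d%:R * (4 * rho (n %/ d)%:R))).
  by rewrite ler_wpM2l ?divr_ge0 ?kroot_ge0 // sum_kroot_div.
have -> : rho d%:R / d%:R * (4 * rho (n %/ d)%:R) = 4 * (rho (n %/ d * d)%:R) / d%:R.
  by rewrite natrM krootM //; ring.
rewrite ler_wpM2r ?invr_ge0 // ler_wpM2l // le_kroot // ler_nat.
exact: leq_trans (leq_trunc_div _ _) (leqnSn _).
Qed.

Lemma dvdn_mul_gcd q h k : (0 < q)%N -> (q %| h * k)%N = (q %/ gcdn q h %| k)%N.
Proof.
move=> q0; have g0 : (0 < gcdn q h)%N by rewrite gcdn_gt0 q0.
have cop : coprime (q %/ gcdn q h) (h %/ gcdn q h).
  rewrite /coprime -(eqn_pmul2r g0) muln_gcdl !divnK ?dvdn_gcdl ?dvdn_gcdr //.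
  by rewrite mul1n.
have -> : (q %| h * k)%N = (q %/ gcdn q h * gcdn q h %| h %/ gcdn q h * k * gcdn q h)%N.
  by rewrite divnK ?dvdn_gcdl // mulnAC divnK ?dvdn_gcdr.
by rewrite dvdn_pmul2r // Gauss_dvdr.
Qed.

(** For fixed [h] the condition on [k] is divisibility by [q / gcd(q, h)], which yields a factor
    [gcd(q, h) / q]. The gcd is then bounded by the sum over all divisors of [q] that divide [h],
    and each divisor of [q] ends up with the same contribution. *)
Lemma sum_kroot_dvd_mul q n : (0 < q)%N ->
  \sum_(h < n | (0 < h)%N) \sum_(k < n | (0 < k)%N && (q %| h * k)%N)
     (rho h%:R / h%:R) * (rho k%:R / k%:R) <= 16 * rho n%:R ^+ 2 * ((ndiv q)%:R / q%:R).
Proof.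
move=> q0; have qR : 0 < q%:R :> R by rewrite ltr0n.
have r0 m : 0 <= rho m%:R / m%:R :> R by rewrite divr_ge0 ?kroot_ge0.
apply: (@le_trans _ _ (\sum_(h < n | (0 < h)%N)
   (rho h%:R / h%:R) * (4 * rho n%:R / q%:R * (gcdn q h)%:R))).
  apply: ler_sum => h h0; rewrite -mulr_sumr ler_wpM2l //.
  under eq_bigl => k do rewrite dvdn_mul_gcd //.
  have g0 : (0 < q %/ gcdn q h)%N by rewrite divn_gt0 ?gcdn_gt0 ?q0 // dvdn_leq ?dvdn_gcdl.
  apply: le_trans (sum_kroot_multiples n g0) _.
  rewrite -[X in _ / X%:R * _](divnK (dvdn_gcdl q h)) natrM.
  have gR : 0 < (gcdn q h)%:R :> R by rewrite ltr0n gcdn_gt0 q0.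
  have g1R : 0 < (q %/ gcdn q h)%:R :> R by rewrite ltr0n.
  by rewrite invfM -!mulrA mulVf ?gt_eqF // mulr1.
apply: (@le_trans _ _ (\sum_(h < n | (0 < h)%N) \sum_(d <- divisors q)
    if (d %| h)%N then (4 * rho n%:R / q%:R * d%:R) * (rho h%:R / h%:R) else 0)).
  apply: ler_sum => h h0.
  have gd : gcdn q h \in divisors q by rewrite -dvdn_divisors // dvdn_gcdl.
  rewrite (bigD1_seq _ gd (divisors_uniq q)) /= dvdn_gcdr mulrC lerDl.
  by apply: sumr_ge0 => d _; case: ifP => // _; rewrite !mulr_ge0 ?invr_ge0 ?kroot_ge0.
rewrite exchange_big /=.
have -> : 16 * rho n%:R ^+ 2 * ((ndiv q)%:R / q%:R) =
   \sum_(d <- divisors q) (16 * rho n%:R ^+ 2 / q%:R).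
  rewrite big_const_seq count_predT iter_addr addr0 /ndiv.
  by rewrite -[_ *+ size _]mulr_natl; ring.
rewrite big_seq [leRHS]big_seq; apply: ler_sum => d; rewrite -dvdn_divisors // => dq.
have d0 : (0 < d)%N := dvdn_gt0 q0 dq; have dR : 0 < d%:R :> R by rewrite ltr0n.
rewrite -big_mkcondr /= -mulr_sumr.
apply: (@le_trans _ _ ((4 * rho n%:R / q%:R * d%:R) * (4 * rho n%:R / d%:R))).
  by rewrite ler_wpM2l ?sum_kroot_multiples // !mulr_ge0 ?invr_ge0 ?kroot_ge0.
rewrite le_eqVlt; apply/orP; left; apply/eqP; field.
by rewrite !gt_eqF.
Qed.

(** Weakening [min(1, 1/x)] to a power -3/4 separates the variables: the decay in [be] comes out as
    a factor, and [h], [k] keep weights [h^(-3/4)], [k^(-3/4)] that can be summed over multiples. An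
    exponent below 1 avoids a logarithm, and over seven sums it still gives the decay 7 * 3/16 =
    21/16 > 5/4. *)
Lemma trunc_inv_kroot n h k be : (0 < h < n)%N -> (0 < k < n)%N -> 0 <= be ->
  trunc_inv n (be * (h * k)%:R) <= 2 * n%:R * rho (n%:R ^+ 2) ^+ 3 /
    rho (1 + n%:R ^+ 3 * be) ^+ 3 * ((rho h%:R / h%:R) * (rho k%:R / k%:R)).
Proof.
move=> /andP[h0 hn] /andP[k0 kn] be0.
have n0 : (0 < n)%N by apply: leq_ltn_trans hn.
have nR : 0 < n%:R :> R by rewrite ltr0n.
have hR : 0 < h%:R :> R by rewrite ltr0n.
have kR : 0 < k%:R :> R by rewrite ltr0n.
set J := 1 + n%:R ^+ 3 * be.
have J1 : 1 <= J by rewrite lerDl mulr_ge0 // exprn_ge0.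
have J0 : 0 < J by lra.
pose w : R := (h * k)%:R / n%:R ^+ 2.
have w0 : 0 < w by rewrite divr_gt0 ?exprn_gt0 // ltr0n muln_gt0 h0.
have w1 : w <= 1.
  rewrite ler_pdivrMr ?exprn_gt0 // mul1r -natrX ler_nat expnS expn1.
  by apply: leq_mul; apply: ltnW.
have e1 : n%:R * (be * (h * k)%:R) = (J - 1) * w.
  by rewrite /J /w; field; rewrite gt_eqF.
have rv (m : nat) : (0 < m)%N -> rho m%:R / m%:R = (rho m%:R ^+ 3)^-1.
  move=> m0; rewrite -[X in _ / X](@krootK _ 4) // exprS invfM mulrA divff ?mul1r //.
  by rewrite gt_eqF // kroot_gt0 // ltr0n.
rewrite !rv // -invfM -exprMn -krootM // -(natrM R h k).
have -> : 2 * n%:R * rho (n%:R ^+ 2) ^+ 3 / rho J ^+ 3 / rho (h * k)%:R ^+ 3 =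
   2 * n%:R / rho (J * w) ^+ 3.
  have hkE : (h * k)%:R = w * n%:R ^+ 2 by rewrite /w; field; rewrite gt_eqF.
  rewrite hkE (krootM _ (ltW w0) (sqr_ge0 n%:R)) (krootM _ (ltW J0) (ltW w0)).
  have p1 := kroot_gt0 4 w0; have p2 := kroot_gt0 4 J0.
  have p3 : 0 < rho (n%:R ^+ 2) by rewrite kroot_gt0 // exprn_gt0.
  by field; rewrite !gt_eqF.
rewrite /trunc_inv e1.
rewrite ler_pdivrMr ?lt_max ?ltr01 // mulrAC ler_pdivlMr; last first.
  by rewrite exprn_gt0 // kroot_gt0 // (mulr_gt0 J0 w0).
rewrite [2 * _]mulrC -[leRHS]mulrA ler_wpM2l //.
set z := J * w.
have z0 : 0 < z by rewrite mulr_gt0.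
have hz : z <= 2 * Num.max 1 ((J - 1) * w).
  have [h1|h1] := leP 2 J.
    have : z <= 2 * ((J - 1) * w) by rewrite /z mulrA ler_wpM2r //; lra.
    by move=> u; apply: le_trans u _; rewrite ler_pM2l // le_max lexx orbT.
  apply: (@le_trans _ _ 2).
    by rewrite /z -[leRHS]mulr1; apply: ler_pM => //; lra.
  by rewrite ler_peMr // le_max lexx.
have hm : 1 <= Num.max 1 ((J - 1) * w) by rewrite le_max lexx.
have [z1|z1] := leP z 1.
  have : rho z ^+ 3 <= 1.
    by apply: exprn_ile1; rewrite ?kroot_ge0 // kroot_le_exp // ?expr1n // ltW.
  lra.
apply: le_trans hz; rewrite -[leRHS](@krootK _ 4) // ?(ltW z0) //.
by rewrite [leRHS]exprS ler_peMl ?exprn_ge0 ?kroot_ge0 // kroot_ge1 // ltW.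
Qed.

(** The products [h k] divisible by [q] see only the error of the approximation and produce the
    peak; the others are spread out modulo 1 and are bounded through the divisor function. *)
Lemma weyl_major n q a D th al : (0 < q)%N -> coprime a q -> 0 <= al ->
  (forall m, (0 < m < n ^ 2)%N -> (ndiv m <= D)%N) ->
  `|6 * al - a%:R / q%:R| * n%:R ^+ 2 <= (2 * q%:R)^-1 ->
  cmod (weyl_sum n th al) ^+ 4 <= 10 * n%:R ^+ 3 + 16 * n%:R *
    (32 * n%:R ^+ 3 * ((ndiv q)%:R / q%:R) /
        rho (1 + n%:R ^+ 3 * `|6 * al - a%:R / q%:R|) ^+ 3 +
     D%:R * ((n%:R ^+ 2 / q%:R + 1) * (4 * q%:R * harmonic_sum R q))).
Proof.
move=> q0 cop al0 hD hal; apply: le_trans (weyl_inequality _ _ _) _.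
rewrite lerD2l ler_wpM2l ?mulr_ge0 //.
have qR : 0 < q%:R :> R by rewrite ltr0n.
set be := `|6 * al - a%:R / q%:R| in hal *; have be0 : 0 <= be by exact: normr_ge0.
have hbe m : (m < n ^ 2)%N -> be * m%:R <= (2 * q%:R)^-1.
  move=> mn; apply: le_trans hal; rewrite ler_wpM2l // -natrX ler_nat ltnW //.
pose phi1 m : R := if (q %| m)%N then 0 else trunc_inv n (dist_int (6 * al * m%:R)).
pose phi2 m : R := if (q %| m)%N then trunc_inv n (be * m%:R) else 0.
have phi10 m : 0 <= phi1 m by rewrite /phi1; case: ifP => // _; exact: trunc_inv_ge0.
have hsplit (h k : 'I_n) : trunc_inv n (dist_int (6 * al * (h * k)%:R)) =
    phi2 (h * k)%N + phi1 (h * k)%N.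
  rewrite /phi1 /phi2; case: ifP => [qd|_]; last by rewrite add0r.
  have mn : (h * k < n ^ 2)%N by rewrite expnS expn1; apply: ltn_mul.
  rewrite addr0; congr trunc_inv.
  have := hbe _ mn; move: (h * k)%N qd {mn} => m qd hm.
  have hq2 : (2 * q%:R)^-1 <= 2^-1 :> R.
    by rewrite lef_pV2 ?posrE ?mulr_gt0 // ler_peMr // ler1n.
  have -> : be * m%:R = `|(6 * al - a%:R / q%:R) * m%:R|.
    by rewrite normrM [`|m%:R|]ger0_norm.
  rewrite -dist_int_id; last by rewrite normrM [`|m%:R|]ger0_norm // (le_trans hm).
  have -> : 6 * al * m%:R = (6 * al - a%:R / q%:R) * m%:R + (a * (m %/ q))%N%:R.
    have mE : m%:R = (m %/ q)%:R * q%:R :> R by rewrite -natrM divnK.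
    by rewrite natrM mE; field; rewrite gt_eqF.
  exact: (dist_intD _ (a * (m %/ q))%N%:Z).
under eq_bigr => h _ do under eq_bigr => k _ do rewrite hsplit.
under eq_bigr => h _ do rewrite big_split /=.
rewrite big_split /=; apply: lerD; last first.
  apply: le_trans (sum_mul_le_ndiv phi10 hD) _; rewrite ler_wpM2l //.
  apply: le_trans (sum_nonmultiples n q0 cop _ _) _; rewrite ?mulr_ge0 //.
  by rewrite natrX.
set J := 1 + n%:R ^+ 3 * be.
have J1 : 1 <= J by rewrite lerDl mulr_ge0 // exprn_ge0.
pose W := 2 * n%:R * rho (n%:R ^+ 2) ^+ 3 / rho J ^+ 3.
have W0 : 0 <= W by rewrite !mulr_ge0 ?invr_ge0 ?exprn_ge0 ?kroot_ge0.
apply: (@le_trans _ _ (W * \sum_(h < n | (0 < h)%N) \sum_(k < n | (0 < k)%N && (q %| h * k)%N)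
     (rho h%:R / h%:R) * (rho k%:R / k%:R))).
  rewrite mulr_sumr; apply: ler_sum => h h0; rewrite -big_mkcondr /= mulr_sumr.
  apply: ler_sum => k /andP[k0 _]; apply: trunc_inv_kroot => //.
    by rewrite h0 ltn_ord.
  by rewrite k0 ltn_ord.
apply: (@le_trans _ _ (W * (16 * rho n%:R ^+ 2 * ((ndiv q)%:R / q%:R)))).
  by rewrite ler_wpM2l // sum_kroot_dvd_mul.
have e : rho (n%:R ^+ 2) ^+ 3 * rho n%:R ^+ 2 = n%:R ^+ 2.
  rewrite expr2 krootM // -[in RHS](@krootK R 4 n%:R) //; ring.
have -> : W * (16 * rho n%:R ^+ 2 * ((ndiv q)%:R / q%:R)) =
  32 * n%:R * (rho (n%:R ^+ 2) ^+ 3 * rho n%:R ^+ 2) * ((ndiv q)%:R / q%:R) / rho J ^+ 3.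
  by rewrite /W; ring.
by rewrite e le_eqVlt; apply/orP; left; apply/eqP; ring.
Qed.

End WeylBounds.

(** * Three points near a short arc of a conic *)

Section ThreePoints.
Variable R : realType.

(** Multiplying the wedge [vj xi - vi xj] by [vj xi + vi xj] gives a difference of squares, in which
    the conic leaves [c (vj^2 - vi^2)] up to a small error; the second factor has order [P Y]. *)
Lemma conic_wedge_bounds (P Y h c r ei ej xi xj vi vj : R) :
  0 < P -> 0 < Y -> 0 < h -> 0 < c ->
  6 * Y / h <= c ->
  P <= xi <= 3 * P -> P <= xj <= 3 * P -> Y <= vi <= 3 * Y -> Y <= vj <= 3 * Y ->
  1 <= vj - vi ->
  `|ei| <= (3 * h)^-1 -> `|ej| <= (3 * h)^-1 ->
  xi ^+ 2 = r * vi ^+ 2 + c + ei -> xj ^+ 2 = r * vj ^+ 2 + c + ej ->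
  c * (vj - vi) <= 18 * P * (vj * xi - vi * xj) /\
  P * (vj * xi - vi * xj) <= 4 * c * (vj - vi).
Proof.
move=> P0 Y0 h0 c0 hc /andP[xi1 xi2] /andP[xj1 xj2] /andP[vi1 vi2] /andP[vj1 vj2] d1 hei hej Ei Ej.
set w := vj * xi - vi * xj; pose s := vj * xi + vi * xj; set d := vj - vi in d1 *.
have hw : w * s = c * (d * (vj + vi)) + (vj ^+ 2 * ei - vi ^+ 2 * ej).
  have -> : w * s = vj ^+ 2 * xi ^+ 2 - vi ^+ 2 * xj ^+ 2 by rewrite /w /s; ring.
  by rewrite Ei Ej /d; ring.
have herr : `|vj ^+ 2 * ei - vi ^+ 2 * ej| <= c * Y.
  have nM (x y : R) : `|x ^+ 2 * y| = x ^+ 2 * `|y| by rewrite normrM ger0_norm ?sqr_ge0.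
  apply: le_trans (ler_normB _ _) _; rewrite !nM.
  have q1 : vj ^+ 2 <= 9 * Y ^+ 2 by nra.
  have q2 : vi ^+ 2 <= 9 * Y ^+ 2 by nra.
  have hi0 : 0 < (3 * h)^-1 by rewrite invr_gt0; lra.
  have u1 : vj ^+ 2 * `|ei| <= 9 * Y ^+ 2 * (3 * h)^-1 by apply: ler_pM; rewrite ?sqr_ge0.
  have u2 : vi ^+ 2 * `|ej| <= 9 * Y ^+ 2 * (3 * h)^-1 by apply: ler_pM; rewrite ?sqr_ge0.
  have u3 : 9 * Y ^+ 2 * (3 * h)^-1 + 9 * Y ^+ 2 * (3 * h)^-1 = (6 * Y / h) * Y.
    by field; rewrite gt_eqF.
  have := ler_wpM2r (ltW Y0) hc; lra.
move: herr; rewrite ler_norml => /andP[g1 g2].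
have cY : 0 < c * Y by rewrite mulr_gt0.
have cYd : c * Y <= c * Y * d by rewrite ler_peMr // ltW.
have cd : 0 < c * d by rewrite mulr_gt0 //; lra.
have l1 : c * d * (2 * Y) <= c * (d * (vj + vi)).
  by rewrite [leRHS]mulrA ler_wpM2l ?(ltW cd) //; lra.
have l2 : c * (d * (vj + vi)) <= c * d * (6 * Y).
  by rewrite mulrA ler_wpM2l ?(ltW cd) //; lra.
have ws1 : c * Y * d <= w * s by rewrite hw; nra.
have ws2 : w * s <= 7 * (c * Y * d) by rewrite hw; nra.
have PY : 0 < P * Y by rewrite mulr_gt0.
have s1 : 2 * (P * Y) <= s.
  have a1 : Y * P <= vj * xi by apply: ler_pM => //; lra.
  have a2 : Y * P <= vi * xj by apply: ler_pM => //; lra.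
  rewrite /s; lra.
have s2 : s <= 18 * (P * Y).
  have a1 : vj * xi <= (3 * Y) * (3 * P) by apply: ler_pM; lra.
  have a2 : vi * xj <= (3 * Y) * (3 * P) by apply: ler_pM; lra.
  rewrite /s; lra.
have w0 : 0 < w.
  rewrite -(pmulr_lgt0 w (x := s)); first by apply: lt_le_trans ws1; rewrite mulr_gt0 //; lra.
  by apply: lt_le_trans s1; lra.
have v1 : w * s <= w * (18 * (P * Y)) by rewrite ler_wpM2l // ltW.
have v2 : w * (2 * (P * Y)) <= w * s by rewrite ler_wpM2l // ltW.
split; rewrite -(ler_pM2r Y0); lra.
Qed.

(** Differences of cubes, centred at [X + h/2] and [V + k/2], put the points in a strip around the
    hyperbola [x^2 = (k/h) v^2 + c]. Its convexity makes the determinant positive and the bound [L]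
    on the length of the arc keeps it below 1, which is impossible for points with integral
    differences. *)
Lemma conic_three_points (P Y L h k x1 x2 x3 v1 v2 v3 : R) :
  1 <= P -> 1 <= Y -> 1 <= h -> 0 < k ->
  2 * h ^+ 3 <= k ^+ 3 -> 150 * Y <= k ^+ 3 -> 1728 * h * P ^+ 2 < k ^+ 4 ->
  L ^+ 3 * k ^+ 4 <= h ^+ 2 * P ^+ 3 -> 4 * L <= h * P ->
  P <= x1 <= 3 * P -> P <= x2 <= 3 * P -> P <= x3 <= 3 * P ->
  Y <= v1 <= 3 * Y -> Y <= v2 <= 3 * Y -> Y <= v3 <= 3 * Y ->
  1 <= v2 - v1 -> 1 <= v3 - v2 -> v3 - v1 <= L ->
  `|3 * h * x1 ^+ 2 + h ^+ 3 / 4 - (3 * k * v1 ^+ 2 + k ^+ 3 / 4)| < 1 ->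
  `|3 * h * x2 ^+ 2 + h ^+ 3 / 4 - (3 * k * v2 ^+ 2 + k ^+ 3 / 4)| < 1 ->
  `|3 * h * x3 ^+ 2 + h ^+ 3 / 4 - (3 * k * v3 ^+ 2 + k ^+ 3 / 4)| < 1 ->
  0 < (x3 - x2) * (v2 - v1) - (x2 - x1) * (v3 - v2) < 1.
Proof.
move=> P1 Y1 h1 k0 c1 c2 c3 c4 c5 hx1 hx2 hx3 hv1 hv2 hv3 ha hb hab D1 D2 D3.
have h0 : 0 < h := lt_le_trans ltr01 h1.
have P0 : 0 < P := lt_le_trans ltr01 P1.
have Y0 : 0 < Y := lt_le_trans ltr01 Y1.
have [a0 b0] : 0 < v2 - v1 /\ 0 < v3 - v2.
  by split; apply: lt_le_trans ltr01 _.
have hab1 : 1 <= v3 - v1 by clear -ha hb; lra.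
pose r := k / h; pose c := (k ^+ 3 - h ^+ 3) / (12 * h).
pose e x v := (3 * h * x ^+ 2 + h ^+ 3 / 4 - (3 * k * v ^+ 2 + k ^+ 3 / 4)) / (3 * h).
have he x v : `|3 * h * x ^+ 2 + h ^+ 3 / 4 - (3 * k * v ^+ 2 + k ^+ 3 / 4)| < 1 ->
    `|e x v| <= (3 * h)^-1.
  move=> hD; rewrite /e normrM [`|(3 * h)^-1|]ger0_norm ?invr_ge0 ?mulr_ge0 ?(ltW h0) //.
  by rewrite ler_piMl ?invr_ge0 ?(ltW hD) ?mulr_ge0 ?(ltW h0).
have eqn x v : x ^+ 2 = r * v ^+ 2 + c + e x v.
  by rewrite /r /c /e; field; rewrite gt_eqF.
have r0 : 0 < r by rewrite divr_gt0.
have hc1 : k ^+ 3 / (24 * h) <= c.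
  rewrite /c ler_pdivrMr; last by rewrite mulr_gt0.
  have -> : (k ^+ 3 - h ^+ 3) / (12 * h) * (24 * h) = 2 * (k ^+ 3 - h ^+ 3).
    by field; rewrite gt_eqF.
  by clear -c1; lra.
have h30 : 0 < h ^+ 3 by rewrite exprn_gt0.
have hc2 : c <= k ^+ 3 / (12 * h).
  by rewrite ler_wpM2r ?invr_ge0 ?mulr_ge0 ?(ltW h0) // gerBl ltW.
have k30 : 0 < k ^+ 3 by rewrite exprn_gt0.
have c0 : 0 < c by apply: lt_le_trans hc1; rewrite divr_gt0 // mulr_gt0.
have hcY : 6 * Y / h <= c.
  apply: le_trans hc1; rewrite ler_pdivlMr; last by rewrite mulr_gt0.
  have -> : 6 * Y / h * (24 * h) = 144 * Y by field; rewrite gt_eqF.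
  by clear -c2 Y0; lra.
have hrc1 : k ^+ 4 / (24 * h ^+ 2) <= r * c.
  have -> : k ^+ 4 / (24 * h ^+ 2) = r * (k ^+ 3 / (24 * h)).
    by rewrite /r; field; rewrite gt_eqF.
  by rewrite ler_wpM2l // ltW.
have hrc2 : r * c <= k ^+ 4 / (12 * h ^+ 2).
  have -> : k ^+ 4 / (12 * h ^+ 2) = r * (k ^+ 3 / (12 * h)).
    by rewrite /r; field; rewrite gt_eqF.
  by rewrite ler_wpM2l // ltW.
have [E1 E2 E3] := And3 (he _ _ D1) (he _ _ D2) (he _ _ D3).
have [w13a w13b] := @conic_wedge_bounds P Y h c r _ _ x1 x3 v1 v3 P0 Y0 h0 c0 hcY hx1 hx3 hv1 hv3
  hab1 E1 E3 (eqn _ _) (eqn _ _).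
have [w12a w12b] := @conic_wedge_bounds P Y h c r _ _ x1 x2 v1 v2 P0 Y0 h0 c0 hcY hx1 hx2 hv1 hv2
  ha E1 E2 (eqn _ _) (eqn _ _).
have [w23a w23b] := @conic_wedge_bounds P Y h c r _ _ x2 x3 v2 v3 P0 Y0 h0 c0 hcY hx2 hx3 hv2 hv3
  hb E2 E3 (eqn _ _) (eqn _ _).
move: (eqn x1 v1) (eqn x2 v2) (eqn x3 v3).
set e1 := e x1 v1 in E1 *; set e2 := e x2 v2 in E2 *; set e3 := e x3 v3 in E3 *.
move=> q1 q2 q3 {eqn he D1 D2 D3}.
set a := v2 - v1 in ha a0 w12a w12b *; set b := v3 - v2 in hb b0 w23a w23b *.
have abE : v3 - v1 = a + b by rewrite /a /b; ring.
rewrite abE in hab hab1 w13a w13b.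
pose Nn := (v3 * x1 - v1 * x3) + (v2 * x1 - v1 * x2) + (v3 * x2 - v2 * x3).
have ca0 : 0 < c * a by rewrite mulr_gt0.
have cb0 : 0 < c * b by rewrite mulr_gt0.
have N1 : c * (a + b) <= 18 * P * Nn by rewrite /Nn; clear -w13a w12a w23a ca0 cb0; lra.
have N2 : P * Nn <= 8 * c * (a + b) by rewrite /Nn; clear -w13b w12b w23b; lra.
have Np : 0 < Nn.
  have P18 : 0 < 18 * P by rewrite mulr_gt0.
  by rewrite -(pmulr_rgt0 Nn P18); apply: lt_le_trans N1; rewrite mulr_gt0 // addr_gt0.
set De := (x3 - x2) * a - (x2 - x1) * b.
pose T := (x2 + x3) * (x1 + x2).
pose Er := a * (e3 - e2) * (x1 + x2) - b * (e2 - e1) * (x2 + x3).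
(* Multiplying by both sums of abscissae turns the increments of [x] into differences of squares,
   where the conic equation applies; what survives is the curvature term, in which [Nn] is the sum
   of the three wedges. *)
have TE : De * T = a * b * r * Nn + Er.
  have t1 : (x3 - x2) * (x2 + x3) = r * b * (v2 + v3) + (e3 - e2).
    have -> : (x3 - x2) * (x2 + x3) = x3 ^+ 2 - x2 ^+ 2 by ring.
    by rewrite q3 q2 /b; ring.
  have t2 : (x2 - x1) * (x1 + x2) = r * a * (v1 + v2) + (e2 - e1).
    have -> : (x2 - x1) * (x1 + x2) = x2 ^+ 2 - x1 ^+ 2 by ring.
    by rewrite q2 q1 /a; ring.
  have -> : De * T = a * ((x3 - x2) * (x2 + x3)) * (x1 + x2) - b * ((x2 - x1) * (x1 + x2)) * (x2 + x3).
    by rewrite /De /T; ring.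
  by rewrite t1 t2 /Er /Nn; ring.
have T1 : 4 * P ^+ 2 <= T.
  have -> : 4 * P ^+ 2 = (2 * P) * (2 * P) by ring.
  by apply: ler_pM; clear -P0 hx1 hx2 hx3; lra.
have hErr : `|Er| <= 4 * P / h * (a + b).
  have dd (x y z : R) : `|x| <= (3 * h)^-1 -> `|y| <= (3 * h)^-1 -> 0 <= z <= 6 * P ->
      `|(x - y) * z| <= 4 * P / h.
    move=> hx hy /andP[z0 z6]; rewrite normrM [`|z|]ger0_norm //.
    have -> : 4 * P / h = (2 / (3 * h)) * (6 * P) by field; rewrite gt_eqF.
    apply: ler_pM => //; apply: le_trans (ler_normB _ _) _.
    by rewrite mulr_natl mulr2n; apply: lerD.
  apply: le_trans (ler_normB _ _) _; rewrite [leRHS]mulrDr.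
  apply: lerD.
    rewrite -mulrA normrM (ger0_norm (ltW a0)) mulrC ler_wpM2r ?(ltW a0) //.
    by apply: dd => //; apply/andP; split; clear -P0 hx1 hx2 hx3; lra.
  rewrite -mulrA normrM (ger0_norm (ltW b0)) mulrC ler_wpM2r ?(ltW b0) //.
  by apply: dd => //; apply/andP; split; clear -P0 hx1 hx2 hx3; lra.
have ab1 : 1 <= a * b by rewrite -[leLHS]mulr1; apply: ler_pM.
(* [c3] makes the curvature term exceed the error, so the determinant is positive; [c4] and [c5]
   bound each of the two by [P^2], against [T >= 4 P^2]. *)
have low : 4 * P / h * (a + b) < a * b * r * Nn.
  apply: (@lt_le_trans _ _ (r * Nn)); last first.
    by rewrite -mulrA ler_peMl // mulr_ge0 // ltW.
  rewrite -(ltr_pM2l (x := 18 * P)); last by rewrite mulr_gt0.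
  have := ler_wpM2l (ltW r0) N1; move=> u.
  apply: (@lt_le_trans _ _ (r * (c * (a + b)))); last by apply: le_trans u _; rewrite mulrCA.
  rewrite mulrA [ltLHS]mulrA ltr_pM2r; last by rewrite addr_gt0.
  apply: lt_le_trans hrc1; rewrite ltr_pdivlMr; last by rewrite mulr_gt0 ?exprn_gt0.
  have -> : 18 * P * (4 * P / h) * (24 * h ^+ 2) = 1728 * h * P ^+ 2 by field; rewrite gt_eqF.
  exact: c3.
have up : a * b * r * Nn <= P ^+ 2.
  rewrite -(ler_pM2l P0).
  have L0 : 0 < L by clear -hab hab1; lra.
  have u1 : r * (P * Nn) <= r * (8 * c * L).
    rewrite ler_wpM2l ?(ltW r0) //; apply: le_trans N2 _.
    by rewrite ler_wpM2l // mulr_ge0 // ltW.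
  have u2 : a * b <= L * L by apply: ler_pM; clear -hab a0 b0; lra.
  have rN0 : 0 <= r * (P * Nn) by rewrite ltW // mulr_gt0 // mulr_gt0.
  apply: (@le_trans _ _ ((L * L) * (r * (8 * c * L)))).
    have -> : P * (a * b * r * Nn) = (a * b) * (r * (P * Nn)) by ring.
    by apply: ler_pM => //; rewrite mulr_ge0 // ltW.
  have -> : (L * L) * (r * (8 * c * L)) = 8 * L ^+ 3 * (r * c) by ring.
  apply: (@le_trans _ _ (8 * L ^+ 3 * (k ^+ 4 / (12 * h ^+ 2)))).
    by rewrite ler_wpM2l // mulr_ge0 // exprn_ge0 // ltW.
  have -> : 8 * L ^+ 3 * (k ^+ 4 / (12 * h ^+ 2)) = (L ^+ 3 * k ^+ 4) * (2 / 3 / h ^+ 2).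
    by field; rewrite gt_eqF.
  apply: (@le_trans _ _ ((h ^+ 2 * P ^+ 3) * (2 / 3 / h ^+ 2))).
    by rewrite ler_wpM2r // divr_ge0 // ?exprn_ge0 ?divr_ge0 ?(ltW h0).
  have -> : (h ^+ 2 * P ^+ 3) * (2 / 3 / h ^+ 2) = 2 / 3 * (P * P ^+ 2).
    by field; rewrite gt_eqF.
  have : 0 < P * P ^+ 2 by rewrite mulr_gt0 ?exprn_gt0.
  by move: (P * P ^+ 2) => z; clear; lra.
have upE : 4 * P / h * (a + b) <= P ^+ 2.
  apply: (@le_trans _ _ (4 * P / h * L)).
    by rewrite ler_wpM2l // divr_ge0 ?mulr_ge0 ?(ltW h0) ?(ltW P0).
  have -> : 4 * P / h * L = P / h * (4 * L) by ring.
  apply: (@le_trans _ _ (P / h * (h * P))).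
    by rewrite ler_wpM2l // divr_ge0 ?mulr_ge0 ?(ltW h0) ?(ltW P0).
  have -> // : P / h * (h * P) = P ^+ 2 by field; rewrite gt_eqF.
have P20 : 0 < P ^+ 2 by rewrite exprn_gt0.
move: hErr; rewrite ler_norml => /andP[g1 g2].
have T0 : 0 < T by clear -T1 P20; lra.
move: (a * b * r * Nn) (4 * P / h * (a + b)) TE low up upE g1 g2 => U W TE low up upE g1 g2.
have [X1 X2] : 0 < De * T /\ De * T < 1 * T.
  by rewrite TE mul1r; clear -T1 P20 low up upE g1 g2; split; lra.
by apply/andP; split; [rewrite -(pmulr_lgt0 De T0) | rewrite -(ltr_pM2r T0)].
Qed.

End ThreePoints.

(** * Counting near coincidences between sums of two cubes *)

Lemma card_sparse (n B : nat) (A : pred 'I_n) : (0 < B)%N ->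
  (forall y1 y2 y3 : 'I_n, A y1 -> A y2 -> A y3 ->
    (y1 < y2)%N -> (y2 < y3)%N -> (y3 < y1 + B)%N -> False) ->
  (#|A| <= 2 * (n %/ B).+1)%N.
Proof.
move=> B0 hA.
have lt (y : 'I_n) : (y %/ B < (n %/ B).+1)%N by rewrite ltnS leq_div2r // ltnW.
rewrite -sum1_card (partition_big (fun y => Ordinal (lt y)) predT) //=.
apply: (@leq_trans (\sum_(j < (n %/ B).+1) 2)); last first.
  by rewrite sum_nat_const card_ord mulnC.
(* Three elements of one block would lie in a window of length [B]. *)
apply: leq_sum => j _; rewrite sum1dep_card leqNgt; apply/negP => /card_gt2P.
case=> x [y [z [[hx hy hz] [xy yz zx]]]].
have close (a b : 'I_n) : a \in [set x in A | Ordinal (lt x) == j] ->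
    b \in [set x in A | Ordinal (lt x) == j] -> (b < a + B)%N.
  rewrite !inE => /andP[_ /eqP ha] /andP[_ /eqP hb].
  have : (a %/ B = b %/ B)%N by move: (congr1 val ha) (congr1 val hb) => /= -> ->.
  move=> e; rewrite (divn_eq a B) (divn_eq b B) e -addnA ltn_add2l.
  exact: leq_trans (ltn_pmod _ B0) (leq_addl _ _).
have inA (a : 'I_n) : a \in [set x in A | Ordinal (lt x) == j] -> A a.
  by rewrite !inE => /andP[].
have key a b c : a \in [set x in A | Ordinal (lt x) == j] ->
    b \in [set x in A | Ordinal (lt x) == j] -> c \in [set x in A | Ordinal (lt x) == j] ->
    (a < b)%N -> (b < c)%N -> False.
  by move=> ha hb hc ab bc; apply: (hA a b c) => //; [exact: inA | exact: inA | exact: inA | exact: close].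
have ne (a b : 'I_n) : a != b -> (a < b)%N || (b < a)%N by rewrite -neq_ltn.
case/orP: (ne _ _ xy) => h1; case/orP: (ne _ _ yz) => h2; case/orP: (ne _ _ zx) => h3.
- exact: (key x y z).
- exact: (key x y z).
- exact: (key z x y).
- exact: (key x z y).
- exact: (key y z x).
- exact: (key y x z).
- exact: (key z y x).
- exact: (key z y x).
Qed.

(* A pair of sums of two cubes at distance less than 1 has the form
   (X + h)^3 + V^3 and X^3 + (V + k)^3. *)
Definition near_diff (R : realType) (P Y : nat) (th ph : R) (h k x y : nat) : bool :=
  [&& (0 < h)%N, (0 < k)%N, (x + h < P)%N, (y + k < Y)%N &
    `|(((x + h)%:R + th) ^+ 3 - (x%:R + th) ^+ 3) -
      (((y + k)%:R + ph) ^+ 3 - (y%:R + ph) ^+ 3)| < 1].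

(** The two differences of cubes have orders [h P^2] and [k Y^2], and [P / Y = s]. *)
Lemma near_diff_sizes (R : realType) (s : nat) (th ph : R) h k x y : (0 < s)%N ->
  (s ^ 5)%:R < th <= (s ^ 5)%:R + 1 -> (s ^ 4)%:R < ph <= (s ^ 4)%:R + 1 ->
  near_diff (s ^ 5) (s ^ 4) th ph h k x y ->
  h%:R * s%:R ^+ 2 <= 5 * k%:R :> R /\ k%:R <= 5 * h%:R * s%:R ^+ 2 :> R.
Proof.
move=> s0 hth hph; set P := (s ^ 5)%N in hth *; set Y := (s ^ 4)%N in hph *; pose S : R := s%:R.
have PE : P%:R = S ^+ 5 by rewrite natrX.
have YE : Y%:R = S ^+ 4 by rewrite natrX.
have S1 : 1 <= S by rewrite ler1n.
have S0 : 0 < S := lt_le_trans ltr01 S1.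
rewrite -/S; clearbody P Y S.
case/and5P => h0 k0 xh yk hD.
have h1 : 1 <= h%:R :> R by rewrite ler1n.
have k1 : 1 <= k%:R :> R by rewrite ler1n.
have P1 : 1 <= P%:R :> R by rewrite PE exprn_ege1.
have Y1 : 1 <= Y%:R :> R by rewrite YE exprn_ege1.
have xh' : x%:R + h%:R + 1 <= P%:R :> R by rewrite -natrD natr1 ler_nat.
have yk' : y%:R + k%:R + 1 <= Y%:R :> R by rewrite -natrD natr1 ler_nat.
have x0 : 0 <= x%:R :> R := ler0n _ _; have y0 : 0 <= y%:R :> R := ler0n _ _.
move: hD; rewrite !natrD => hD.
case/andP: hth => t1 t2; case/andP: hph => p1 p2.
set X := x%:R + th; set V := y%:R + ph.
have eX : (x%:R + h%:R + th) ^+ 3 - X ^+ 3 = h%:R * (3 * X ^+ 2 + 3 * X * h%:R + h%:R ^+ 2).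
  by rewrite /X; ring.
have eV : (y%:R + k%:R + ph) ^+ 3 - V ^+ 3 = k%:R * (3 * V ^+ 2 + 3 * V * k%:R + k%:R ^+ 2).
  by rewrite /V; ring.
have bounds (p A d : R) : 1 <= p -> 1 <= d -> p <= A -> A + d <= 2 * p ->
    3 * (d * p ^+ 2) <= d * (3 * A ^+ 2 + 3 * A * d + d ^+ 2) <= 12 * (d * p ^+ 2).
  move=> q1 q2 q3 q4.
  have -> : 3 * (d * p ^+ 2) = d * (3 * p ^+ 2) by ring.
  have -> : 12 * (d * p ^+ 2) = d * (12 * p ^+ 2) by ring.
  have d0 : 0 <= d by clear -q2; lra.
  by apply/andP; split; rewrite ler_wpM2l //; clear eX eV hD; nra.
have bX : 3 * (h%:R * P%:R ^+ 2) <= (x%:R + h%:R + th) ^+ 3 - X ^+ 3 <= 12 * (h%:R * P%:R ^+ 2).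
  rewrite eX; apply: bounds => //; rewrite /X; clear -t1 t2 xh' x0 h1; lra.
have bV : 3 * (k%:R * Y%:R ^+ 2) <= (y%:R + k%:R + ph) ^+ 3 - V ^+ 3 <= 12 * (k%:R * Y%:R ^+ 2).
  rewrite eV; apply: bounds => //; rewrite /V; clear -p1 p2 yk' y0 k1; lra.
move: hD; rewrite ltr_norml -/X -/V => /andP[d1 d2].
have g1 : 1 <= h%:R * P%:R ^+ 2 :> R by rewrite -[leLHS]mulr1; apply: ler_pM => //; exact: exprn_ege1.
have g2 : 1 <= k%:R * Y%:R ^+ 2 :> R by rewrite -[leLHS]mulr1; apply: ler_pM => //; exact: exprn_ege1.
have S8 : 0 < S ^+ 8 by rewrite exprn_gt0.
have r1 : h%:R * P%:R ^+ 2 = (h%:R * S ^+ 2) * S ^+ 8 by rewrite PE; ring.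
have r2 : k%:R * Y%:R ^+ 2 = k%:R * S ^+ 8 by rewrite YE -exprM.
split.
  rewrite -(ler_pM2r S8) -r1 -mulrA -r2; clear -bX bV d1 d2 g1 g2; lra.
rewrite -(ler_pM2r S8) -r2.
have -> : 5 * h%:R * S ^+ 2 * S ^+ 8 = 5 * (h%:R * P%:R ^+ 2) by rewrite r1; ring.
clear -bX bV d1 d2 g1 g2; lra.
Qed.

Lemma near_diff_three (R : realType) (s : nat) (th ph : R) h k x1 x2 x3 y1 y2 y3 :
  (2000 ^ 2 <= s)%N ->
  (s ^ 5)%:R < th <= (s ^ 5)%:R + 1 -> (s ^ 4)%:R < ph <= (s ^ 4)%:R + 1 ->
  (s < h)%N -> near_diff (s ^ 5) (s ^ 4) th ph h k x1 y1 ->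
  near_diff (s ^ 5) (s ^ 4) th ph h k x2 y2 -> near_diff (s ^ 5) (s ^ 4) th ph h k x3 y3 ->
  (y1 < y2)%N -> (y2 < y3)%N -> (25 * (y3 - y1) <= s)%N -> False.
Proof.
move=> s_large hth hph sh n1 n2 n3 y12 y23 y13.
have s0 : (0 < s)%N by apply: leq_trans s_large; rewrite expn_gt0.
have := near_diff_sizes s0 hth hph n1.
set P := (s ^ 5)%N in hth n1 n2 n3 *; set Y := (s ^ 4)%N in hph n1 n2 n3 *.
pose S : R := s%:R; rewrite -/S => -[z1 z2].
have PE : P%:R = S ^+ 5 by rewrite natrX.
have YE : Y%:R = S ^+ 4 by rewrite natrX.
have S_large : 2000 ^+ 2 <= S by rewrite -natrX ler_nat.
have S2000 : 2000 <= S by apply: le_trans S_large; rewrite expr2 ler_peMr ?ler1n.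
have S1 : 1 <= S by rewrite ler1n.
have S0 : 0 < S := lt_le_trans ltr01 S1.
have hs : S <= h%:R by rewrite ler_nat ltnW.
have y13R : 25 * (y3%:R - y1%:R) <= S :> R.
  by rewrite -natrB ?(ltnW (ltn_trans y12 y23)) // -natrM ler_nat.
clearbody P Y S; clear y13 sh s_large s0.
have [h0 k0] : (0 < h)%N /\ (0 < k)%N by case/and5P: n1.
have h1 : 1 <= h%:R :> R by rewrite ler1n.
have k1 : 1 <= k%:R :> R by rewrite ler1n.
have kY : k%:R <= S ^+ 4.
  by rewrite -YE ler_nat; case/and5P: n1 => _ _ _ yk _; apply: leq_trans (ltnW yk); rewrite leq_addl.
have S2 : 0 < S ^+ 2 by rewrite exprn_gt0.
have hS2 : h%:R <= 5 * S ^+ 2.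
  rewrite -(ler_pM2r S2) -mulrA -exprD; apply: le_trans z1 _.
  by rewrite ler_pM2l.
(* The bounds [k <= 5 h s^2] and [h <= 5 s^2] give [L^3 k^4 <= h^2 P^3] for this [L] with nothing to
   spare. *)
pose L : R := S / 25.
have k0R : 0 < k%:R :> R by apply: lt_le_trans k1.
have h0R : 0 < h%:R :> R by apply: lt_le_trans h1.
have c1 : 2 * h%:R ^+ 3 <= k%:R ^+ 3 :> R.
  have u : 2 * h%:R <= k%:R :> R.
    have : 10 * h%:R <= h%:R * S ^+ 2.
      rewrite [10 * _]mulrC ler_wpM2l //; apply: (@le_trans _ _ S).
        by clear -S2000; lra.
      by rewrite expr2 ler_peMr // ltW.
    by clear -z1; lra.
  have : (2 * h%:R) ^+ 3 <= k%:R ^+ 3 :> R by rewrite lerXn2r ?nnegrE ?mulr_ge0.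
  rewrite exprMn; have : 0 < h%:R ^+ 3 :> R by rewrite exprn_gt0.
  by clear; lra.
have ks : S ^+ 3 <= 5 * k%:R.
  by apply: le_trans z1; rewrite exprS ler_pM2r.
have c2 : 150 * S ^+ 4 <= k%:R ^+ 3 :> R.
  have : (S ^+ 3) ^+ 3 <= (5 * k%:R) ^+ 3.
    by rewrite lerXn2r ?nnegrE ?mulr_ge0 ?exprn_ge0 // ltW.
  have -> : (S ^+ 3) ^+ 3 = S ^+ 4 * S ^+ 5 by rewrite -exprM -exprD.
  rewrite exprMn => u.
  have u2 : S ^+ 4 * (150 * 125) <= S ^+ 4 * S ^+ 5.
    rewrite ler_pM2l ?exprn_gt0 //; apply: (@le_trans _ _ S).
      apply: le_trans S_large; rewrite expr2; apply: ler_pM => //; rewrite ler_nat //.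
    by rewrite exprS ler_peMr ?(ltW S0) // exprn_ege1.
  move: (S ^+ 4) (S ^+ 4 * S ^+ 5) (k%:R ^+ 3) u u2 => A B C; clear; lra.
(* Here [h > s] enters: [k^4 >= h^4 s^8 / 625], and [h^3 >= s^3] leaves one factor [s], which beats
   [1728 * 625 < 2000^2]. *)
have c3 : 1728 * h%:R * (S ^+ 5) ^+ 2 < k%:R ^+ 4 :> R.
  have : (h%:R * S ^+ 2) ^+ 4 <= (5 * k%:R) ^+ 4.
    by rewrite lerXn2r ?nnegrE ?mulr_ge0 ?exprn_ge0 // ltW.
  have -> : (h%:R * S ^+ 2) ^+ 4 = h%:R ^+ 3 * (h%:R * S ^+ 8) by ring.
  rewrite exprMn => u.
  have u2 : S ^+ 3 * (h%:R * S ^+ 8) <= h%:R ^+ 3 * (h%:R * S ^+ 8).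
    rewrite ler_wpM2r ?mulr_ge0 ?exprn_ge0 ?(ltW S0) //.
    by rewrite lerXn2r ?nnegrE ?(ltW S0) ?(ltW h0R).
  have e1 : S ^+ 3 * (h%:R * S ^+ 8) = (h%:R * (S ^+ 5) ^+ 2) * S by rewrite -exprM; ring.
  have e2 : 0 < h%:R * (S ^+ 5) ^+ 2 by rewrite mulr_gt0 ?exprn_gt0.
  have u3 : (h%:R * (S ^+ 5) ^+ 2) * (2000 ^+ 2) <= (h%:R * (S ^+ 5) ^+ 2) * S by rewrite ler_pM2l.
  rewrite -mulrA; move: u u2; rewrite e1.
  move: e2 u3; rewrite [2000 ^+ 2]expr2.
  move: (h%:R ^+ 3 * (h%:R * S ^+ 8)) (h%:R * (S ^+ 5) ^+ 2 * S) => C B.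
  by move: (h%:R * (S ^+ 5) ^+ 2) (k%:R ^+ 4) => A D; clear; lra.
have L0 : 0 < L by rewrite divr_gt0.
have c4 : L ^+ 3 * k%:R ^+ 4 <= h%:R ^+ 2 * (S ^+ 5) ^+ 3.
  have u1 : k%:R ^+ 4 <= (5 * h%:R * S ^+ 2) ^+ 4 :> R.
    by rewrite lerXn2r ?nnegrE ?mulr_ge0 ?exprn_ge0 // ltW.
  have u2 : h%:R ^+ 2 <= (5 * S ^+ 2) ^+ 2 :> R.
    by rewrite lerXn2r ?nnegrE ?mulr_ge0 ?exprn_ge0 // ltW.
  apply: (@le_trans _ _ (L ^+ 3 * (5 * h%:R * S ^+ 2) ^+ 4)).
    by rewrite ler_wpM2l // exprn_ge0 // ltW.
  have -> : L ^+ 3 * (5 * h%:R * S ^+ 2) ^+ 4 = (h%:R ^+ 2 * S ^+ 11 / 25) * h%:R ^+ 2.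
    by rewrite /L; field.
  apply: (@le_trans _ _ ((h%:R ^+ 2 * S ^+ 11 / 25) * (5 * S ^+ 2) ^+ 2)).
    by rewrite ler_wpM2l // divr_ge0 // mulr_ge0 ?exprn_ge0 ?(ltW S0) ?(ltW h0R).
  by rewrite le_eqVlt; apply/orP; left; apply/eqP; field.
have SP : S <= S ^+ 5 by rewrite exprS ler_peMr ?(ltW S0) // exprn_ege1.
have c5 : 4 * L <= h%:R * S ^+ 5.
  apply: (@le_trans _ _ (S ^+ 5)); first by rewrite /L; clear -SP S0; lra.
  by rewrite ler_peMl // exprn_ge0 // ltW.
case/andP: hth => t1 t2; case/andP: hph => p1 p2.
have rangeX x y : near_diff P Y th ph h k x y -> S ^+ 5 <= x%:R + th + h%:R / 2 <= 3 * S ^+ 5.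
  case/and5P => _ _ xh _ _; have x0 : 0 <= x%:R :> R := ler0n _ _.
  have xh' : x%:R + h%:R + 1 <= P%:R :> R by rewrite -natrD natr1 ler_nat.
  have t1' := t1; have t2' := t2; rewrite -PE in SP *.
  by apply/andP; clear -xh' x0 h1 t1' t2' S1 SP; split; lra.
have rangeV x y : near_diff P Y th ph h k x y -> S ^+ 4 <= y%:R + ph + k%:R / 2 <= 3 * S ^+ 4.
  case/and5P => _ _ _ yk _; have y0 : 0 <= y%:R :> R := ler0n _ _.
  have yk' : y%:R + k%:R + 1 <= Y%:R :> R by rewrite -natrD natr1 ler_nat.
  have t1' := p1; have t2' := p2; rewrite -YE.
  by apply/andP; clear -yk' y0 k1 t1' t2'; split; lra.
have conic x y : near_diff P Y th ph h k x y -> `|3 * h%:R * (x%:R + th + h%:R / 2) ^+ 2 + h%:R ^+ 3 / 4 -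
    (3 * k%:R * (y%:R + ph + k%:R / 2) ^+ 2 + k%:R ^+ 3 / 4)| < 1.
  case/and5P => _ _ _ _; rewrite !natrD.
  by congr (`|_| < _); field.
have P1 : 1 <= S ^+ 5 by rewrite exprn_ege1.
have Y1 : 1 <= S ^+ 4 by rewrite exprn_ege1.
have d12 : 1 <= (y2%:R + ph + k%:R / 2) - (y1%:R + ph + k%:R / 2).
  have : y1%:R + 1 <= y2%:R :> R by rewrite natr1 ler_nat.
  by clear; lra.
have d23 : 1 <= (y3%:R + ph + k%:R / 2) - (y2%:R + ph + k%:R / 2).
  have : y2%:R + 1 <= y3%:R :> R by rewrite natr1 ler_nat.
  by clear; lra.
have d13 : (y3%:R + ph + k%:R / 2) - (y1%:R + ph + k%:R / 2) <= L.
  by rewrite /L; clear -y13R; lra.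
have := @conic_three_points R (S ^+ 5) (S ^+ 4) L h%:R k%:R _ _ _ _ _ _ P1 Y1 h1 k0R c1 c2 c3 c4 c5
  (rangeX _ _ n1) (rangeX _ _ n2) (rangeX _ _ n3) (rangeV _ _ n1) (rangeV _ _ n2) (rangeV _ _ n3)
  d12 d23 d13 (conic _ _ n1) (conic _ _ n2) (conic _ _ n3).
(* The real shifts cancel in the differences, so the determinant is an integer; none lies strictly
   between 0 and 1. *)
have -> : (x3%:R + th + h%:R / 2 - (x2%:R + th + h%:R / 2)) *
    (y2%:R + ph + k%:R / 2 - (y1%:R + ph + k%:R / 2)) -
    (x2%:R + th + h%:R / 2 - (x1%:R + th + h%:R / 2)) *
    (y3%:R + ph + k%:R / 2 - (y2%:R + ph + k%:R / 2)) =
   ((x3%:Z - x2%:Z) * (y2%:Z - y1%:Z) - (x2%:Z - x1%:Z) * (y3%:Z - y2%:Z))%:~R :> R.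
  by rewrite !(intrD, mulrNz, intrM) -!pmulrn; ring.
rewrite ltr0z -[1]/(1%:~R) ltr_int.
move: ((x3%:Z - x2%:Z) * (y2%:Z - y1%:Z) - (x2%:Z - x1%:Z) * (y3%:Z - y2%:Z)) => z.
by clear; lia.
Qed.

(** Each step in [x] raises the difference of the long cubes by at least 3, while both values lie
    within 1 of the same number. *)
Lemma near_diff_unique (R : realType) (P Y : nat) (th ph : R) h k x x' y : (0 < P)%N ->
  P%:R < th -> near_diff P Y th ph h k x y -> near_diff P Y th ph h k x' y -> x = x'.
Proof.
move=> P0 hth; wlog : x x' / (x < x')%N.
  move=> H n1 n2; case: (ltngtP x x') => // xx; first exact: H.
  by apply/esym; exact: H.
move=> xx /and5P[h0 _ _ _ d1] /and5P[_ _ _ _ d2]; exfalso.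
have P1 : 1 <= P%:R :> R by rewrite ler1n.
have h1 : 1 <= h%:R :> R by rewrite ler1n.
have x1 : x%:R + 1 <= x'%:R :> R by rewrite natr1 ler_nat.
have x0 : 0 <= x%:R :> R := ler0n _ _.
move: d1 d2; rewrite !natrD; move: (_ ^+ 3 - (y%:R + ph) ^+ 3) => B.
have -> : (x%:R + h%:R + th) ^+ 3 - (x%:R + th) ^+ 3 =
   h%:R * (3 * (x%:R + th) * (x%:R + th + h%:R) + h%:R ^+ 2) by ring.
have -> : (x'%:R + h%:R + th) ^+ 3 - (x'%:R + th) ^+ 3 =
   h%:R * (3 * (x'%:R + th) * (x'%:R + th + h%:R) + h%:R ^+ 2) by ring.
set A := 3 * (x%:R + th) * (x%:R + th + h%:R); set A' := 3 * (x'%:R + th) * (x'%:R + th + h%:R).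
have hA : A + 3 <= A'.
  have -> : A' = 3 * ((x%:R + th) + (x'%:R - x%:R)) * ((x%:R + th + h%:R) + (x'%:R - x%:R)).
    by rewrite /A'; ring.
  rewrite /A; have : 1 <= x%:R + th by clear -x0 P1 hth; lra.
  have : 1 <= x'%:R - x%:R :> R by clear -x1; lra.
  by move: (x%:R + th) (x'%:R - x%:R) => a b; clear -h1; nra.
have := ler_pM ler01 _ h1 hA.
rewrite !ltr_norml => g /andP[a1 a2] /andP[b1 b2].
have hh : h%:R * (A + h%:R ^+ 2) + 3 <= h%:R * (A' + h%:R ^+ 2).
  rewrite -subr_ge0; have -> : h%:R * (A' + h%:R ^+ 2) - (h%:R * (A + h%:R ^+ 2) + 3) =
     h%:R * (A' - A - 3) + 3 * (h%:R - 1) by ring.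
  by apply: addr_ge0; apply: mulr_ge0 => //; [clear -hA; lra | clear -h1; lra].
by clear -hh a1 a2 b1 b2; lra.
Qed.

Lemma cube_gap (R : realType) (a b : R) : 1 <= a -> 1 <= b -> 1 <= (a + b) ^+ 3 - a ^+ 3.
Proof.
move=> ha hb; have -> : (a + b) ^+ 3 - a ^+ 3 = b * (b ^+ 2 + 3 * a * (a + b)) by ring.
have u1 : 1 <= b ^+ 2 by rewrite exprn_ege1.
have u2 : 0 <= 3 * a * (a + b) by rewrite !mulr_ge0 //; clear -ha hb; lra.
by rewrite -[leLHS]mulr1; apply: ler_pM => //; clear -u1 u2; lra.
Qed.

Section EnergyCount.
Variables (R : realType) (s : nat) (th ph : R).
Local Notation P := (s ^ 5)%N.
Local Notation Y := (s ^ 4)%N.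
Local Notation pairs := ('I_P * 'I_Y)%type.

Definition cube_pair (p : pairs) : R := (p.1%:R + th) ^+ 3 + (p.2%:R + ph) ^+ 3.

Definition near_set : {set pairs * pairs} :=
  [set z | `|cube_pair z.1 - cube_pair z.2| < 1].

(** No three admissible [y] lie in a window of length [s %/ 25], by [near_diff_three]. *)
Lemma card_curve h k : (2000 ^ 2 <= s)%N ->
  P%:R < th <= P%:R + 1 -> Y%:R < ph <= Y%:R + 1 -> (s < h)%N ->
  (#|[pred y : 'I_Y | [exists x : 'I_P, near_diff P Y th ph h k x y]]| <= 200 * s ^ 3)%N.
Proof.
move=> s_large hth hph sh.
have s25 : (25 <= s)%N.
  by apply: leq_trans s_large; rewrite (@leq_trans (25 ^ 2)) // leq_exp2r.
have B0 : (0 < s %/ 25)%N by rewrite divn_gt0.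
apply: leq_trans (card_sparse B0 _) _.
  move=> y1 y2 y3 /existsP[x1 n1] /existsP[x2 n2] /existsP[x3 n3] y12 y23 y13.
  apply: (near_diff_three s_large hth hph sh n1 n2 n3 y12 y23).
  apply: leq_trans (leq_trunc_div s 25); rewrite mulnC leq_mul2r /= leq_subLR ltnW //.
(* Rounding [s / 25] down loses less than a factor 2. *)
have h2 : (s < 2 * (25 * (s %/ 25)))%N.
  rewrite {1}(divn_eq s 25) mulnC [X in (_ < X)%N]mul2n -addnn ltn_add2l.
  by apply: leq_trans (ltn_pmod s (isT : 0 < 25)%N) _; rewrite leq_pmulr.
have : (s ^ 4 %/ (s %/ 25) < 50 * s ^ 3)%N.
  rewrite ltn_divLR // expnSr.
  have -> : (50 * s ^ 3 * (s %/ 25) = s ^ 3 * (2 * (25 * (s %/ 25))))%N by ring.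
  by rewrite ltn_mul2l h2 expn_gt0 (leq_trans _ s25).
move=> h3; apply: (@leq_trans (2 * (50 * s ^ 3))); first by rewrite leq_mul2l.
by rewrite mulnA leq_mul2r orbT.
Qed.

Lemma sum_indicator_le n m : (\sum_(h < n) (h < m) <= m)%N.
Proof.
rewrite -(big_mkord xpredT (fun h => nat_of_bool (h < m)%N)).
elim: n => [|n IH]; first by rewrite big_geq.
have [nm|mn] := ltnP n m; last first.
  by rewrite big_nat_recr //= ltnNge mn addn0.
apply: leq_trans nm.
apply: (@leq_trans (\sum_(0 <= i < n.+1) 1)); first by apply: leq_sum => i _; case: (_ < _)%N.
by rewrite sum_nat_const_nat muln1 subn0.
Qed.

(** Moving the long variable up changes its cube by at least 1, so near equality forces the short
    variable to move down. *)
Lemma near_diff_of_near (p p' : pairs) : (0 < s)%N -> P%:R < th -> Y%:R < ph ->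
  `|cube_pair p - cube_pair p'| < 1 -> (p.1 < p'.1)%N ->
  near_diff P Y th ph (p'.1 - p.1) (p.2 - p'.2) p.1 p'.2 /\ (p'.2 < p.2)%N.
Proof.
move=> s0 hth hph; case: p => x y; case: p' => x' y'; rewrite /cube_pair /= => hn xx.
have P1 : 1 <= P%:R :> R by rewrite ler1n expn_gt0 s0.
have x1 : x%:R + 1 <= x'%:R :> R by rewrite natr1 ler_nat.
have x0 : 0 <= x%:R :> R := ler0n _ _; have y0 : 0 <= y%:R :> R := ler0n _ _.
have Y0 : 0 <= Y%:R :> R := ler0n _ _.
have hX : 1 <= (x'%:R + th) ^+ 3 - (x%:R + th) ^+ 3.
  have : 1 <= x%:R + th by clear -P1 hth x0; lra.
  have -> : x'%:R + th = (x%:R + th) + (x'%:R - x%:R) by ring.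
  have : 1 <= x'%:R - x%:R :> R by clear -x1; lra.
  by move=> hb ha; exact: cube_gap.
have yy : (y' < y)%N.
  rewrite ltnNge; apply/negP => yy'.
  have hyy : y%:R <= y'%:R :> R by rewrite ler_nat.
  have : (y%:R + ph) ^+ 3 <= (y'%:R + ph) ^+ 3.
    by rewrite lerXn2r ?nnegrE //; clear -hyy y0 hph Y0; lra.
  by move: hn; rewrite ltr_norml; clear -hX; lra.
split => //; apply/and5P; split.
- by rewrite subn_gt0.
- by rewrite subn_gt0.
- by rewrite addnC (subnK (ltnW xx)) ltn_ord.
- by rewrite addnC (subnK (ltnW yy)) ltn_ord.
rewrite (addnC x) (subnK (ltnW xx)) (addnC y') (subnK (ltnW yy)).
move: hn; rewrite -normrN; congr (`|_| < _); ring.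
Qed.

Lemma card_near_lt : (2000 ^ 2 <= s)%N ->
  P%:R < th <= P%:R + 1 -> Y%:R < ph <= Y%:R + 1 ->
  (#|[set z in near_set | (z.1.1 < z.2.1)%N]| <= (2 + 200 * 6) * s ^ 9)%N.
Proof.
move=> s_large hth hph.
have s0 : (0 < s)%N by apply: leq_trans s_large; rewrite expn_gt0.
have [t1 p1] : P%:R < th /\ Y%:R < ph by case/andP: hth; case/andP: hph.
have lts (n : nat) (a b : 'I_n) : (a - b < n)%N by exact: leq_ltn_trans (leq_subr _ _) (ltn_ord a).
(* A near pair is recovered from [h], [k] and the smaller short variable, since the long one is then
   unique. *)
pose f (z : pairs * pairs) : 'I_P * 'I_Y * 'I_Y :=
  (Ordinal (lts _ z.2.1 z.1.1), Ordinal (lts _ z.1.2 z.2.2), z.2.2).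
have keyz z : z \in [set z in near_set | (z.1.1 < z.2.1)%N] ->
   near_diff P Y th ph (z.2.1 - z.1.1) (z.1.2 - z.2.2) z.1.1 z.2.2 /\
   (z.1.1 < z.2.1)%N /\ (z.2.2 < z.1.2)%N.
  rewrite !inE => /andP[zn zl].
  by have [] := near_diff_of_near s0 t1 p1 zn zl.
rewrite -(card_in_imset (f := f)); last first.
  move=> z w /keyz[nz [zl zl']] /keyz[nw [wl wl']] [e1 e2 e3].
  move: z w nz zl zl' nw wl wl' e1 e2 e3 => [[x1 y1] [x2 y2]] [[x3 y3] [x4 y4]] /=.
  move=> nz zl zl' nw wl wl' e1 e2 e3.
  rewrite -e1 -e2 -e3 in nw.
  have e4 : x1 = x3.
    apply: val_inj; apply: near_diff_unique nz nw => //.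
    by rewrite expn_gt0 s0.
  have e5 : x2 = x4.
    apply: val_inj; move/(congr1 (addn^~ x1)): e1; rewrite subnK 1?ltnW //.
    by rewrite e4 subnK 1?ltnW.
  have e6 : y1 = y3.
    apply: val_inj; move/(congr1 (addn^~ y2)): e2; rewrite subnK 1?ltnW //.
    by rewrite e3 subnK 1?ltnW.
  by rewrite e3 e4 e5 e6.
pose T := [pred w : 'I_P * 'I_Y * 'I_Y |
  [exists x : 'I_P, near_diff P Y th ph w.1.1 w.1.2 x w.2]].
apply: (@leq_trans #|T|).
  apply: subset_leq_card; apply/fintype.subsetP => w /imsetP[z /keyz[nz _] ->].
  by rewrite inE /=; apply/existsP; exists z.1.1.
have -> : #|T| = (\sum_(h < P) \sum_(k < Y)
    #|[pred y : 'I_Y | [exists x : 'I_P, near_diff P Y th ph h k x y]]|)%N.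
  rewrite pair_big /= -sum1_card.
  rewrite (eq_bigr (fun p : 'I_P * 'I_Y => (\sum_(y < Y | [exists x : 'I_P, near_diff P Y th ph p.1 p.2 x y]) 1)%N)); last first.
    by move=> p _; rewrite sum1dep_card; apply: eq_card => y; rewrite !inE.
  by rewrite pair_big_dep /=; apply: eq_bigl => w; rewrite inE.
apply: (@leq_trans (\sum_(h < P) ((h < s.+1) * s ^ 8 + (h < (5 * s ^ 2).+1) * (200 * s ^ 7)))%N).
  apply: leq_sum => h _.
  have [hs|hs] := ltnP h s.+1.
    rewrite mul1n; apply: leq_trans (leq_addr _ _).
    apply: (@leq_trans (\sum_(k < Y) Y)).
      by apply: leq_sum => k _; rewrite -[X in (_ <= X)%N](card_ord Y) max_card.
    by rewrite sum_nat_const card_ord -expnD.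
  have [hs2|hs2] := ltnP h (5 * s ^ 2).+1.
    rewrite mul1n mul0n add0n.
    apply: (@leq_trans (\sum_(k < Y) (200 * s ^ 3))).
      by apply: leq_sum => k _; apply: card_curve.
    by rewrite sum_nat_const card_ord mulnCA -expnD.
  rewrite mul0n add0n mul0n leqn0 sum_nat_eq0; apply/forallP => k; apply/implyP => _.
  apply/eqP; rewrite eq_card0 // => y; rewrite !inE; apply/negbTE/negP => /existsP[x nx].
  have [u1 _] := near_diff_sizes s0 hth hph nx.
  have kY : (k <= s ^ 4)%N by rewrite ltnW.
  move: u1; rewrite -natrX -!natrM ler_nat => u1.
  have : (h * s ^ 2 <= 5 * s ^ 2 * s ^ 2)%N.
    by apply: leq_trans u1 _; rewrite -mulnA -expnD leq_mul2l.
  by rewrite leq_pmul2r ?expn_gt0 ?s0 // leqNgt hs2.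
rewrite big_split /= -!big_distrl /=.
apply: (@leq_trans (s.+1 * s ^ 8 + (5 * s ^ 2).+1 * (200 * s ^ 7))).
  by apply: leq_add; rewrite leq_mul2r sum_indicator_le orbT.
have e9 : (s ^ 9 = s * s ^ 8)%N by rewrite expnS.
have e97 : (s ^ 9 = s ^ 2 * s ^ 7)%N by rewrite -expnD.
have l1 : (s.+1 * s ^ 8 <= 2 * s ^ 9)%N.
  by rewrite e9 mulnA leq_mul2r; apply/orP; right; rewrite mul2n -addnn -addn1 leq_add2l.
have l2 : ((5 * s ^ 2).+1 * (200 * s ^ 7) <= 200 * 6 * s ^ 9)%N.
  rewrite e97 mulnCA -mulnA leq_mul2l /= mulnA leq_mul2r; apply/orP; right.
  rewrite -addn1 [(6 * _)%N](mulnDl 5 1) leq_add2l mul1n expn_gt0 s0 //.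
by rewrite mulnDl leq_add.
Qed.

Lemma card_near : (2000 ^ 2 <= s)%N ->
  P%:R < th <= P%:R + 1 -> Y%:R < ph <= Y%:R + 1 ->
  (#|near_set| <= (1 + 2 * (2 + 200 * 6)) * s ^ 9)%N.
Proof.
move=> s_large hth hph.
have s0 : (0 < s)%N by apply: leq_trans s_large; rewrite expn_gt0.
pose L := [set z in near_set | (z.1.1 < z.2.1)%N].
pose swp (z : pairs * pairs) := (z.2, z.1).
have swpK : injective swp by move=> [a b] [c d] [-> ->].
pose D : {set pairs * pairs} := [set (p, p) | p in [set: pairs]].
(* Equal long variables force equal short ones, so a near pair that is not ordered either way is
   diagonal. *)
have sub : near_set \subset D :|: (L :|: swp @: L).
  apply/fintype.subsetP => z; rewrite inE => zn.
  have zs : z = swp (swp z) by case: (z).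
  case: (ltngtP z.1.1 z.2.1) => xx.
  - by rewrite !inE zn xx /= orbT.
  - have zL : swp z \in L by rewrite !inE /= distrC zn.
    by rewrite finset.in_setU finset.in_setU [X in X \in swp @: L]zs (imset_f _ zL) !orbT.
  have [yy|yy] := eqVneq (z.1.2 : nat) z.2.2.
    rewrite finset.in_setU; apply/orP; left; apply/imsetP; exists z.1; first by rewrite inE.
    move: z xx yy {zn zs} => [[a b] [c d]] /= xx yy.
    by rewrite (val_inj xx) (val_inj yy).
  exfalso; move: zn; rewrite /cube_pair xx.
  have Y0 : 1 <= Y%:R :> R by rewrite ler1n expn_gt0 s0.
  case/andP: hph => p1 _.
  have gap (a b : nat) : (a < b)%N -> 1 <= (b%:R + ph) ^+ 3 - (a%:R + ph) ^+ 3.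
    move=> ab; have x1 : a%:R + 1 <= b%:R :> R by rewrite natr1 ler_nat.
    have a0 : 0 <= a%:R :> R := ler0n _ _.
    have : 1 <= a%:R + ph by clear -Y0 p1 a0; lra.
    have -> : b%:R + ph = (a%:R + ph) + (b%:R - a%:R) by ring.
    have : 1 <= b%:R - a%:R :> R by clear -x1; lra.
    by move=> hb ha; exact: cube_gap.
  rewrite opprD addrACA subrr add0r ltr_norml.
  by move: yy; rewrite neq_ltn => /orP[] /gap; clear; lra.
apply: leq_trans (subset_leq_card sub) _.
apply: leq_trans (leq_card_setU _ _) _.
have l1 : (#|D| <= s ^ 9)%N.
  by apply: leq_trans (leq_imset_card _ _) _; rewrite cardsT card_prod !card_ord -expnD.
have l2 : (#|L :|: swp @: L| <= 2 * (2 + 200 * 6) * s ^ 9)%N.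
  apply: leq_trans (leq_card_setU _ _) _; rewrite card_imset // addnn -mul2n.
  by rewrite -mulnA leq_mul2l /= card_near_lt.
by rewrite mulnDl mul1n leq_add.
Qed.

End EnergyCount.

(** With [r v] the number of [i] at height [v], this is the Cauchy-Schwarz bound of an
    autocorrelation by its value at 0. *)
Lemma shifted_pairs_le (I : finType) (a : I -> nat) (d : nat) :
  (#|[pred p : I * I | (a p.1 == a p.2 + d)%N]| <= #|[pred p : I * I | a p.1 == a p.2]|)%N.
Proof.
pose r v := #|[pred i | a i == v]|.
pose B := (\max_i a i).+1.
have aB i : (a i < B)%N by rewrite ltnS; exact: leq_bigmax.
have cardE e : #|[pred p : I * I | (a p.1 == a p.2 + e)%N]| = (\sum_(v < B) r v * r (v + e))%N.
  rewrite -sum1_card.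
  rewrite (eq_bigl (fun p : I * I => true && (a p.1 == a p.2 + e)%N)); last by move=> p; rewrite inE.
  rewrite -(pair_big_dep xpredT (fun i j => a i == a j + e)%N (fun _ _ => 1%N)) /=.
  rewrite (exchange_big_dep xpredT) //=.
  rewrite (eq_bigr (fun j => r (a j + e)%N)); last first.
    by move=> j _; rewrite sum1dep_card; apply: eq_card => i; rewrite !inE.
  rewrite (partition_big (fun j => Ordinal (aB j)) xpredT) //=.
  apply: eq_bigr => v _.
  rewrite (eq_bigr (fun _ => r (v + e)%N)); last by move=> j /eqP <-.
  rewrite sum_nat_const; congr (_ * _)%N; apply: eq_card => j; rewrite !inE -val_eqE //.
have -> : #|[pred p : I * I | a p.1 == a p.2]| = (\sum_(v < B) r v * r v)%N.
  have := cardE 0%N.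
  rewrite (eq_card (B := [pred p : I * I | a p.1 == a p.2])); last first.
    by move=> p; rewrite !inE addn0.
  by move=> ->; apply: eq_bigr => v _; rewrite addn0.
rewrite cardE -(leq_pmul2l (isT : 0 < 2)%N).
apply: (@leq_trans (\sum_(v < B) (r v * r v + r (v + d)%N * r (v + d)%N))).
  rewrite big_distrr /=; apply: leq_sum => v _.
  by rewrite !mulnn; exact: (nat_Cauchy _ _).1.
rewrite big_split /= mul2n -addnn leq_add2l.
have r0 w : (B <= w)%N -> r w = 0%N.
  move=> hw; apply: eq_card0 => i; rewrite !inE; apply/negbTE; rewrite neq_ltn.
  by rewrite (leq_trans (aB i)).
rewrite -(big_mkord xpredT (fun v => r (v + d) * r (v + d))%N).
have -> : (\sum_(0 <= v < B) r (v + d) * r (v + d) = \sum_(d <= w < B + d) r w * r w)%N.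
  by rewrite [RHS](_ : _ = \sum_(0 + d <= w < B + d) r w * r w)%N // big_addn addnK.
rewrite -(big_mkord xpredT (fun v => r v * r v)%N).
apply: (@leq_trans (\sum_(0 <= w < B + d) r w * r w)).
  by rewrite [leqRHS](@big_cat_nat _ _ _ d) ?leq_addl //= leq_addl.
rewrite (@big_cat_nat _ _ _ B) ?leq_addr //= [X in (_ + X)%N]big_nat.
rewrite [X in (_ + X)%N]big1 ?addn0 // => w /andP[hw _].
by rewrite (r0 _ hw).
Qed.

(** * Mean squares from counts of near coincidences *)

Section MeanSquare.
Variable R : realType.

Lemma sum_dist_cells (I : finType) (a : I -> nat) (B : nat) (W : nat -> R) :
  (forall d, 0 <= W d) -> (forall i, a i < B)%N ->
  \sum_(p : I * I) W ((a p.1 - a p.2) + (a p.2 - a p.1))%N <=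
    2 * #|[pred p : I * I | a p.1 == a p.2]|%:R * \sum_(d < B) W d.
Proof.
move=> W0 aB.
apply: (@le_trans _ _ (\sum_(p : I * I) \sum_(d < B)
   (W d * (a p.1 == a p.2 + d)%N%:R + W d * (a p.2 == a p.1 + d)%N%:R))).
  apply: ler_sum => p _.
  have h0 (d : 'I_B) : 0 <= W d * (a p.1 == a p.2 + d)%N%:R + W d * (a p.2 == a p.1 + d)%N%:R.
    by rewrite addr_ge0 ?mulr_ge0.
  have [hle|hlt] := leqP (a p.2) (a p.1).
    have hd : (a p.1 - a p.2 < B)%N by apply: leq_ltn_trans (leq_subr _ _) (aB _).
    rewrite (bigD1 (Ordinal hd)) //= subnKC // eqxx mulr1.
    rewrite (_ : (a p.2 - a p.1)%N = 0%N) ?addn0; last by apply/eqP; rewrite subn_eq0.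
    by rewrite -addrA lerDl addr_ge0 ?mulr_ge0 // sumr_ge0.
  have hd : (a p.2 - a p.1 < B)%N by apply: leq_ltn_trans (leq_subr _ _) (aB _).
  rewrite (bigD1 (Ordinal hd)) //= (subnKC (ltnW hlt)) eqxx mulr1.
  rewrite (_ : (a p.1 - a p.2)%N = 0%N) ?add0n; last by apply/eqP; rewrite subn_eq0 ltnW.
  by rewrite addrAC lerDr addr_ge0 ?mulr_ge0 // sumr_ge0.
rewrite exchange_big /= mulr_sumr; apply: ler_sum => d _.
rewrite big_split /= -!mulr_sumr -!natr_sum.
set E := #|_|.
have s1 : (\sum_(p : I * I) (a p.1 == a p.2 + d) <= E)%N.
  apply: leq_trans (shifted_pairs_le a d); rewrite -sum1_card [leqRHS]big_mkcond.
  by apply: leq_sum => p _; rewrite inE; case: (_ == _).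
have s2 : (\sum_(p : I * I) (a p.2 == a p.1 + d) <= E)%N.
  rewrite (reindex_inj (h := fun p : I * I => (p.2, p.1))) /=; last by move=> [? ?] [? ?] [-> ->].
  exact: s1.
have -> : 2 * E%:R * W d = W d * E%:R + W d * E%:R by ring.
by apply: lerD; rewrite ler_wpM2l // ler_nat.
Qed.

(** The pairs in the expanded square are sorted by the integer parts of [u]: those at a given
    distance are at most about as numerous as those with equal integer parts, which are near pairs.
    As [2 u <= N], differences divided by [N] stay below 1/2, so their distance to the nearest
    integer is their absolute value. *)
Lemma mean_square (I : finType) (u : I -> R) (N M : nat) : (0 < N)%N ->
  (forall i, 0 <= u i) -> (forall i, 2 * u i <= N%:R) ->
  \sum_(j < M) cmod (\sum_i cexp (j%:R / N%:R * u i)) ^+ 2 <=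
    2 * #|[pred p : I * I | `|u p.1 - u p.2| < 1]|%:R *
      (2 * M%:R + N%:R * harmonic_sum R N).
Proof.
case: N => [//|n] N0 u0 uN; set N := n.+1 in N0 u0 uN *.
have NR : 0 < N%:R :> R by rewrite ltr0n.
pose a i := Num.trunc (u i).
have a1 i : (a i)%:R <= u i by case/andP: (truncn_itv (u0 i)).
have a2 i : u i < (a i)%:R + 1 by rewrite natr1; case/andP: (truncn_itv (u0 i)).
have aN i : (a i < N.+1)%N.
  rewrite ltnS -(ler_nat R); apply: le_trans (a1 i) _; have := u0 i; have := uN i; clear; lra.
(* Cells at distance 0 or 1 may hold values as close as one likes and take the trivial bound [M]; at
   distance [d >= 2] the values differ by at least [d - 1]. *)
pose W d : R := if (d < 2)%N then M%:R else N%:R / d.-1%:R.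
have W0 d : 0 <= W d by rewrite /W; case: ifP => _ //; rewrite divr_ge0.
apply: (@le_trans _ _ (\sum_(p : I * I) W ((a p.1 - a p.2) + (a p.2 - a p.1))%N)).
  have e1 (j : 'I_M) : cmod (\sum_i cexp (j%:R / N%:R * u i)) ^+ 2 =
      \sum_(p : I * I) Re (cexp (((u p.1 - u p.2) / N%:R) * j%:R + 0)).
    have -> : cmod (\sum_i cexp (j%:R / N%:R * u i)) ^+ 2 =
        Re ((\sum_i cexp (j%:R / N%:R * u i)) * (\sum_i cexp (j%:R / N%:R * u i))^*%C).
      by rewrite cmod_conj_sqr.
    rewrite rmorph_sum /= big_distrl /= Re_sum -(pair_big xpredT xpredT
      (fun i k => Re (cexp (((u i - u k) / N%:R) * j%:R + 0)))) /=.
    apply: eq_bigr => i _; rewrite big_distrr /= Re_sum; apply: eq_bigr => k _.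
    have -> : (u i - u k) / N%:R * j%:R + 0 = j%:R / N%:R * u i - j%:R / N%:R * u k by ring.
    by rewrite mulrBr cosB /= mulrN opprK.
  rewrite (eq_bigr _ (fun j _ => e1 j)) exchange_big; apply: ler_sum => p _.
  rewrite -Re_sum; apply: le_trans (Re_le_cmod _) _.
  apply: le_trans (geometric_cexp_le _ _ _) _.
  rewrite /W; case: ifP => [_|/negbT]; first exact: trunc_inv_le_n.
  rewrite -leqNgt => hd; set D := (_ + _)%N in hd *.
  have D1 : 0 < D.-1%:R :> R by rewrite ltr0n; case: (D) hd => [|[]].
  have DE : D.-1%:R = D%:R - 1 :> R by rewrite -[D in RHS](prednK (ltnW hd)) -natr1 addrK.
  have hu : D.-1%:R <= `|u p.1 - u p.2|.
    have := a1 p.1; have := a2 p.1; have := a1 p.2; have := a2 p.2.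
    rewrite DE /D; have [hle|hlt] := leqP (a p.2) (a p.1).
      rewrite (_ : (a p.2 - a p.1)%N = 0%N) ?addn0; last by apply/eqP; rewrite subn_eq0.
      rewrite natrB // => q1 q2 q3 q4; apply: le_trans (ler_norm _); clear -q1 q2 q3 q4; lra.
    rewrite (_ : (a p.1 - a p.2)%N = 0%N) ?add0n; last by apply/eqP; rewrite subn_eq0 ltnW.
    rewrite natrB 1?ltnW // => q1 q2 q3 q4; rewrite distrC; apply: le_trans (ler_norm _).
    by clear -q1 q2 q3 q4; lra.
  have hdist : dist_int ((u p.1 - u p.2) / N%:R) = `|u p.1 - u p.2| / N%:R.
    rewrite dist_int_id normrM [`|N%:R^-1|]ger0_norm ?invr_ge0 //.
    rewrite ler_pdivrMr //; have := uN p.1; have := uN p.2; have := u0 p.1; have := u0 p.2.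
    by rewrite ler_norml; clear; lra.
  rewrite hdist; have hpos : 0 < `|u p.1 - u p.2| / N%:R by rewrite divr_gt0 // (lt_le_trans D1).
  apply: le_trans (trunc_inv_le_inv _ hpos) _; rewrite invf_div.
  by rewrite ler_wpM2l // lef_pV2 ?posrE // (lt_le_trans D1).
apply: le_trans (sum_dist_cells W0 aN) _.
apply: ler_pM.
- by rewrite mulr_ge0.
- by apply: sumr_ge0.
- rewrite ler_wpM2l // ler_nat; apply: subset_leq_card; apply/fintype.subsetP => p.
  rewrite !inE => /eqP e; have := a1 p.1; have := a2 p.1; have := a1 p.2; have := a2 p.2.
  by rewrite e ltr_norml; clear; lra.
rewrite big_ord_recl /= {1}/W /=.
rewrite big_ord_recl /= {1}/W /= addrA mulr_natl mulr2n lerD2l.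
rewrite /harmonic_sum big_ord_recr /= mulrDr mulr_sumr.
rewrite (eq_bigr (fun i : 'I_n => n.+1%:R * i.+1%:R^-1)); last by move=> i _; rewrite /W.
by rewrite lerDl mulr_ge0 // invr_ge0.
Qed.

End MeanSquare.

(** * The Weyl sum with the irrational shift *)

Section IrrationalShift.
Variable R : realType.

Lemma sum_shift_cmod (F : nat -> R[i]) (n t : nat) : (forall x, cmod (F x) <= 1) ->
  cmod (\sum_(x < n) F x - \sum_(x < n) F (x + t)%N) <= 2 * t%:R.
Proof.
move=> F1.
have bd (a b : nat) : cmod (\sum_(a <= x < b) F x) <= (b - a)%:R.
  apply: le_trans (cmod_sum _ _ _) _.
  apply: (@le_trans _ _ (\sum_(a <= x < b) 1)); first by apply: ler_sum.
  by rewrite big_const_nat iter_addr addr0.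
have e1 : \sum_(0 <= x < n + t) F x = \sum_(x < n) F x + \sum_(n <= x < n + t) F x.
  by rewrite (@big_cat_nat _ _ _ n) ?leq_addr //= big_mkord.
have e2 : \sum_(0 <= x < n + t) F x = \sum_(0 <= x < t) F x + \sum_(x < n) F (x + t)%N.
  rewrite (@big_cat_nat _ _ _ t) ?leq_addl //=; congr (_ + _).
  by rewrite -{1}[t]add0n big_addn addnK big_mkord.
have -> : \sum_(x < n) F x - \sum_(x < n) F (x + t)%N =
   \sum_(0 <= x < t) F x - \sum_(n <= x < n + t) F x.
  by apply/eqP; rewrite subr_eq addrAC eq_sym subr_eq -e2 e1.
apply: le_trans (cmodB _ _) _.
have := bd 0%N t; have := bd n (n + t)%N; rewrite subn0 addnC addnK; clear; lra.
Qed.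

Lemma cmod_sqr_double_sum (n K : nat) (F : nat -> nat -> R) :
  \sum_(x < n) cmod (\sum_(k < K) cexp (F x k)) ^+ 2 <=
   \sum_(p : 'I_K * 'I_K) cmod (\sum_(x < n) cexp (F x p.1 - F x p.2)).
Proof.
have e1 (x : 'I_n) : cmod (\sum_(k < K) cexp (F x k)) ^+ 2 =
    \sum_(p : 'I_K * 'I_K) Re (cexp (F x p.1 - F x p.2)).
  have -> : cmod (\sum_(k < K) cexp (F x k)) ^+ 2 =
      Re ((\sum_(k < K) cexp (F x k)) * (\sum_(k < K) cexp (F x k))^*%C).
    by rewrite cmod_conj_sqr.
  rewrite rmorph_sum /= big_distrl /= Re_sum -(pair_big xpredT xpredT
    (fun i k : 'I_K => Re (cexp (F x i - F x k)))) /=.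
  apply: eq_bigr => i _; rewrite big_distrr /= Re_sum; apply: eq_bigr => k _.
  by rewrite mulrBr cosB /= mulrN opprK.
rewrite (eq_bigr _ (fun x _ => e1 x)) exchange_big; apply: ler_sum => p _.
by rewrite -Re_sum; exact: Re_le_cmod.
Qed.

(** Averaging over the shifts [k Q] changes the sum by boundary terms only. The averaged sum is
    controlled through its square, so it is kept as an unknown [Z] and no square root is taken. *)
Lemma van_der_corput (n K Q : nat) (g : nat -> R) (B : R) : 0 <= B ->
  (forall k k' : 'I_K, k != k' ->
     cmod (\sum_(x < n) cexp (g (x + k * Q)%N - g (x + k' * Q)%N)) <= B) ->
  exists Z : R, [/\ 0 <= Z, Z ^+ 2 <= n%:R * (n%:R * K%:R + K%:R ^+ 2 * B) &
    K%:R * cmod (\sum_(x < n) cexp (g x)) <= Z + 2 * K%:R ^+ 2 * Q%:R].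
Proof.
move=> B0 hB.
pose S := \sum_(x < n) cexp (g x).
exists (cmod (\sum_(x < n) \sum_(k < K) cexp (g (x + k * Q)%N))); split.
- exact: cmod_ge0.
- apply: (@le_trans _ _ (n%:R * \sum_(x < n) cmod (\sum_(k < K) cexp (g (x + k * Q)%N)) ^+ 2)).
    apply: le_trans (sqr_sum_le n (fun x => cmod (\sum_(k < K) cexp (g (x + k * Q)%N)))).
    rewrite lerXn2r ?nnegrE ?cmod_ge0 //; last exact: cmod_sum.
    by apply: sumr_ge0 => x _; exact: cmod_ge0.
  rewrite ler_wpM2l //.
  apply: le_trans (cmod_sqr_double_sum n K (fun x k => g (x + k * Q)%N)) _.
  apply: (@le_trans _ _ (\sum_(p : 'I_K * 'I_K) (n%:R * (p.1 == p.2)%:R + B))).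
    apply: ler_sum => p _; have [e|ne] := eqVneq p.1 p.2; last by rewrite mulr0 add0r hB.
    rewrite e mulr1 (eq_bigr (fun _ => 1)); last by move=> x _; rewrite subrr cexp0.
    apply: le_trans (cmod_sum _ _ _) _; rewrite (eq_bigr (fun _ => 1)) => [|x _]; last exact: cmod1.
    by rewrite sumr_const card_ord lerDl.
  rewrite big_split /= -mulr_sumr sumr_const card_prod card_ord.
  apply: lerD; last by rewrite -[B *+ _]mulr_natl natrM expr2.
  rewrite ler_wpM2l // -(pair_big xpredT xpredT (fun i k : 'I_K => (i == k)%:R)) /=.
  rewrite (eq_bigr (fun _ => 1)) ?sumr_const ?card_ord // => i _.
  by rewrite (bigD1 i) //= eqxx big1 ?addr0 // => j /negbTE; rewrite eq_sym => ->.
have -> : K%:R * cmod S = cmod (\sum_(k < K) S).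
  by rewrite sumr_const card_ord -[S *+ K]mulr_natl cmodM -[K%:R in RHS](rmorph_nat (real_complex R)) cmod_real ger0_norm.
have -> : \sum_(k < K) S = \sum_(x < n) \sum_(k < K) cexp (g (x + k * Q)%N) +
    \sum_(k < K) (S - \sum_(x < n) cexp (g (x + k * Q)%N)).
  have ex : \sum_(k < K) \sum_(x < n) cexp (g (x + k * Q)%N) =
     \sum_(x < n) \sum_(k < K) cexp (g (x + k * Q)%N) by exact: exchange_big.
  by rewrite sumrB ex addrC subrK.
apply: le_trans (cmodD _ _) _; rewrite lerD2l; apply: le_trans (cmod_sum _ _ _) _.
apply: (@le_trans _ _ (\sum_(k < K) (2 * K%:R * Q%:R))).
  apply: ler_sum => k _.
  apply: le_trans (sum_shift_cmod n (k * Q) (F := fun x => cexp (g x)) _) _.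
    by move=> x; rewrite cmod_cexp.
  by rewrite natrM mulrA ler_wpM2r // ler_wpM2l // ler_nat ltnW.
rewrite sumr_const card_ord -[_ *+ K]mulr_natl le_eqVlt; apply/orP; left; apply/eqP; ring.
Qed.

Lemma irrational_dist (mu : R) (c : int) : irrational mu -> c != 0 -> 0 < dist_int (c%:~R * mu).
Proof.
move=> irr c0; rewrite lt_neqAle dist_int_ge0 andbT; apply/negP => /eqP h0.
have [m mE] := dist_intE (c%:~R * mu); move: mE; rewrite -h0 => /esym/eqP.
rewrite normr_eq0 subr_eq0 => /eqP e; apply: irr.
exists (m%:~R / c%:~R) => //; rewrite fmorph_div /= !ratr_int -e.
by rewrite mulrAC divff ?mul1r // intr_eq0.
Qed.

(** At [al = a / (6 q)] with the step [Q = 6 q], differencing leaves [3 a (k - k') (x + m - mu)^2]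
    plus a linear term with an integral coefficient. Modulo 1 the square of [x] disappears and the
    slope [-6 a (k - k') mu] remains, which is not an integer since [mu] is irrational and
    [a > 0]. *)
Lemma weyl_irrational (mu D eps : R) (a q : nat) : irrational mu -> (0 < a)%N -> (0 < q)%N ->
  0 <= D -> 0 < eps ->
  exists n0 : nat, forall n (m : int) (al : R), (n0 <= n)%N ->
    0 <= m%:~R - mu <= n%:R + 1 -> `|6 * al - a%:R / q%:R| * n%:R ^+ 3 <= D ->
    cmod (weyl_sum n (m%:~R - mu) al) <= eps * n%:R.
Proof.
move=> irr a0 q0 D0 eps0.
(* [8 <= eps^2 K] is what [2 n^2 K <= (eps K n / 2)^2] requires at the end. *)
pose K := (Num.trunc (8 / eps ^+ 2)).+1.
have KK : 8 <= eps ^+ 2 * K%:R.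
  rewrite mulrC -ler_pdivrMr ?exprn_gt0 //; apply/ltW.
  by rewrite /K truncnS_gt.
have K0 : 0 < K%:R :> R by rewrite ltr0n.
have [Q QE] : exists Q, Q = (6 * q)%N by exists (6 * q)%N.
have QR : 0 < Q%:R :> R by rewrite ltr0n QE muln_gt0.
pose la (k k' : 'I_K) : R := (- (6 * a%:Z * (k%:Z - k'%:Z)))%:~R * mu.
(* The sum of all reciprocals serves as their maximum; on the diagonal [0^-1] is 0. *)
pose B1 : R := \sum_(p : 'I_K * 'I_K) (dist_int (la p.1 p.2))^-1.
have B10 : 0 <= B1 by apply: sumr_ge0 => p _; rewrite invr_ge0 dist_int_ge0.
pose B := B1 + 384 * D * K%:R * Q%:R.
have B0 : 0 <= B by rewrite addr_ge0 // !mulr_ge0 // ltW.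
pose n0 := (Num.trunc (B * K%:R + 4 * K%:R * Q%:R / eps + K%:R * Q%:R)).+1.
exists n0 => n m al n0n /andP[th0 th1] hal.
have hn : B * K%:R + 4 * K%:R * Q%:R / eps + K%:R * Q%:R <= n%:R.
  apply/ltW; apply: (@lt_le_trans _ _ n0%:R); last by rewrite ler_nat.
  exact: truncnS_gt.
have t1 : 0 <= B * K%:R by rewrite mulr_ge0 // ltW.
have t2 : 0 <= 4 * K%:R * Q%:R / eps by rewrite !mulr_ge0 ?invr_ge0 // ltW.
have t3 : 0 < K%:R * Q%:R :> R by rewrite mulr_gt0.
have nR : 0 < n%:R :> R by clear -hn t1 t2 t3; lra.
have n1 : 1 <= n%:R :> R by rewrite ler1n -(ltr0n R).
set th := m%:~R - mu in th0 th1 *.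
pose g x : R := al * (x%:R + th) ^+ 3.
have hoff (k k' : 'I_K) : k != k' ->
     cmod (\sum_(x < n) cexp (g (x + k * Q)%N - g (x + k' * Q)%N)) <= B.
  move=> kk.
  pose b := al - a%:R / Q%:R.
  have bE : `|b| * n%:R ^+ 3 <= D.
    have -> : b = (6 * al - a%:R / q%:R) / 6.
      by rewrite /b QE natrM; field; rewrite gt_eqF ?ltr0n.
    rewrite normrM [`|6^-1|]ger0_norm ?invr_ge0 // mulrAC.
    by rewrite ler_pdivrMr //; clear -hal D0; lra.
  pose pol (x : nat) : R := ((x + k * Q)%:R + th) ^+ 3 - ((x + k' * Q)%:R + th) ^+ 3.
  pose c1 : R := - (6 * a%:R * (k%:R - k'%:R)) * mu * m%:~R + 3 * a%:R * (k%:R - k'%:R) * mu ^+ 2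
     - 3 * a%:R * (k%:R ^+ 2 - k'%:R ^+ 2) * Q%:R * mu + a%:R * (k%:R ^+ 3 - k'%:R ^+ 3) * Q%:R ^+ 2.
  have decomp (x : nat) : cexp (g (x + k * Q)%N - g (x + k' * Q)%N) =
      cexp (la k k' * x%:R + c1) * cexp (b * pol x).
    (* The integral part of the phase at [a / Q], which periodicity removes. *)
    pose Iz : int := 3 * a%:Z * (k%:Z - k'%:Z) * (x%:Z + m) ^+ 2 +
      3 * a%:Z * (k%:Z ^+ 2 - k'%:Z ^+ 2) * Q%:Z * (x%:Z + m).
    rewrite -cexpD -[RHS](cexpDint _ Iz); congr cexp.
    rewrite /g /la /c1 /b /pol /Iz !(natrD, natrM, intrD, intrM, mulrNz, rmorphXn) /= -!pmulrn.
    rewrite /th; field; rewrite gt_eqF //.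
  rewrite (eq_bigr _ (fun (x : 'I_n) _ => decomp x)).
  (* As [|b| n^3 <= D] and [pol x] has order [n^2], replacing [e(b pol x)] by 1 costs [O(1/n)] in
     each term, hence a constant in all. *)
  have -> : \sum_(x < n) cexp (la k k' * x%:R + c1) * cexp (b * pol x) =
      \sum_(x < n) cexp (la k k' * x%:R + c1) -
      \sum_(x < n) cexp (la k k' * x%:R + c1) * (1 - cexp (b * pol x)).
    rewrite -sumrB; apply: eq_bigr => x _.
    by move: (cexp (la k k' * _ + _)) (cexp (b * _)) => A B'; ring.
  apply: le_trans (cmodB _ _) _; apply: lerD.
    apply: le_trans (geometric_cexp_le _ _ _) _.
    have lap : 0 < dist_int (la k k').
      apply: irrational_dist => //; rewrite oppr_eq0 !mulf_neq0 //.
        by rewrite -lt0n.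
      by rewrite subr_eq0.
    apply: le_trans (trunc_inv_le_inv _ lap) _.
    rewrite /B1 (bigD1 (k, k')) //= lerDl; apply: sumr_ge0 => p _.
    by rewrite invr_ge0 dist_int_ge0.
  apply: le_trans (cmod_sum _ _ _) _.
  apply: (@le_trans _ _ (\sum_(x < n) (384 * D * K%:R * Q%:R / n%:R))); last first.
    rewrite sumr_const card_ord -[_ *+ n]mulr_natl.
    by rewrite mulrCA mulfV ?mulr1 // gt_eqF.
  apply: ler_sum => x _; rewrite cmodM cmod_cexp mul1r.
  apply: le_trans (cmod_1Bcexp_le _) _; rewrite normrM.
  have hpol : `|pol x| <= 48 * (K%:R * Q%:R) * n%:R ^+ 2.
    rewrite /pol; set u := _%:R + th; set v := _%:R + th.
    have -> : u ^+ 3 - v ^+ 3 = (u - v) * (u ^+ 2 + u * v + v ^+ 2) by ring.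
    have ub (l : 'I_K) : 0 <= (x + l * Q)%:R + th <= 4 * n%:R.
      have lQ : (l * Q)%:R <= K%:R * Q%:R :> R by rewrite natrM ler_wpM2r // ler_nat ltnW.
      have xn : x%:R <= n%:R :> R by rewrite ler_nat ltnW.
      have x0 : 0 <= x%:R :> R := ler0n _ _.
      have l0 : 0 <= (l * Q)%:R :> R := ler0n _ _.
      by rewrite natrD; apply/andP; clear -lQ xn x0 l0 th0 th1 hn t1 t2 t3 n1; split; lra.
    case/andP: (ub k) => u0 u4; case/andP: (ub k') => v0 v4.
    rewrite normrM.
    have d1 : `|u - v| <= K%:R * Q%:R.
      have -> : u - v = (k%:R - k'%:R) * Q%:R by rewrite /u /v !(natrD, natrM); ring.
      rewrite normrM [`|Q%:R|]ger0_norm // ler_wpM2r //.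
      have k1 : k%:R <= K%:R :> R by rewrite ler_nat ltnW.
      have k2 : k'%:R <= K%:R :> R by rewrite ler_nat ltnW.
      have k3 : 0 <= k%:R :> R := ler0n _ _.
      have k4 : 0 <= k'%:R :> R := ler0n _ _.
      by rewrite ler_norml; apply/andP; clear -k1 k2 k3 k4; split; lra.
    have d2 : `|u ^+ 2 + u * v + v ^+ 2| <= 48 * n%:R ^+ 2.
      have e16 : 16 * n%:R ^+ 2 = (4 * n%:R) * (4 * n%:R) :> R by ring.
      have s1 : u ^+ 2 <= 16 * n%:R ^+ 2 by rewrite e16 expr2; apply: ler_pM.
      have s2 : v ^+ 2 <= 16 * n%:R ^+ 2 by rewrite e16 expr2; apply: ler_pM.
      have s3 : u * v <= 16 * n%:R ^+ 2 by rewrite e16; apply: ler_pM.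
      have s4 : 0 <= u * v by rewrite mulr_ge0.
      rewrite ger0_norm ?addr_ge0 ?sqr_ge0 //; clear -s1 s2 s3; lra.
    have -> : 48 * (K%:R * Q%:R) * n%:R ^+ 2 = (K%:R * Q%:R) * (48 * n%:R ^+ 2) :> R by ring.
    by apply: ler_pM.
  rewrite ler_pdivlMr //.
  apply: (@le_trans _ _ (8 * (`|b| * (48 * (K%:R * Q%:R) * n%:R ^+ 2)) * n%:R)).
    by rewrite ler_wpM2r // ler_pM2l // ler_wpM2l.
  have -> : 8 * (`|b| * (48 * (K%:R * Q%:R) * n%:R ^+ 2)) * n%:R =
     (384 * (K%:R * Q%:R)) * (`|b| * n%:R ^+ 3) by ring.
  have -> : 384 * D * K%:R * Q%:R = (384 * (K%:R * Q%:R)) * D by ring.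
  by rewrite ler_wpM2l // mulr_ge0 // ltW.
have [Z [Z0 Z2 hZ]] := van_der_corput B0 hoff.
have Zle : Z <= eps * K%:R * n%:R / 2.
  have e0 : 0 <= eps * K%:R * n%:R / 2 by rewrite !mulr_ge0 ?invr_ge0 // ltW.
  rewrite -(ler_pXn2r (n := 2)) ?nnegrE //; apply: le_trans Z2 _.
  have u1 : K%:R ^+ 2 * B <= n%:R * K%:R.
    have -> : K%:R ^+ 2 * B = (B * K%:R) * K%:R by ring.
    by rewrite ler_wpM2r ?(ltW K0) //; clear -hn t2 t3; lra.
  apply: (@le_trans _ _ (n%:R * (n%:R * K%:R + n%:R * K%:R))).
    by rewrite ler_wpM2l // lerD2l.
  have -> : (eps * K%:R * n%:R / 2) ^+ 2 = (n%:R ^+ 2 * K%:R / 4) * (eps ^+ 2 * K%:R) by field.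
  have -> : n%:R * (n%:R * K%:R + n%:R * K%:R) = (n%:R ^+ 2 * K%:R / 4) * 8 :> R by field.
  by rewrite ler_wpM2l // !mulr_ge0 ?invr_ge0 ?sqr_ge0 // ltW.
have h2 : 2 * K%:R ^+ 2 * Q%:R <= eps * K%:R * n%:R / 2.
  have u : 4 * K%:R * Q%:R <= eps * n%:R.
    by rewrite [leRHS]mulrC -ler_pdivrMr //; clear -hn t1 t3; lra.
  have -> : 2 * K%:R ^+ 2 * Q%:R = (K%:R / 2) * (4 * K%:R * Q%:R) :> R by field.
  have -> : eps * K%:R * n%:R / 2 = (K%:R / 2) * (eps * n%:R) by field.
  by rewrite ler_wpM2l // divr_ge0.
rewrite -(ler_pM2l K0); apply: le_trans hZ _.
have -> : K%:R * (eps * n%:R) = eps * K%:R * n%:R by ring.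
by clear -Zle h2; lra.
Qed.

End IrrationalShift.

Lemma sum_square_diagonals (V : nmodType) (n : nat) (F : nat -> nat -> V) :
  \sum_(l < n) \sum_(k < n) F l k = \sum_(l < n) F l l +
    \sum_(1 <= j < n) \sum_(l < n - j) (F l (l + j)%N + F (l + j)%N l).
Proof.
elim: n => [|n IH]; first by rewrite !big_ord0 big_geq // addr0.
have e1 : \sum_(l < n.+1) \sum_(k < n.+1) F l k = \sum_(l < n) \sum_(k < n) F l k +
    (F n n + \sum_(l < n) (F l n + F n l)).
  rewrite big_ord_recr /= big_ord_recr /=.
  rewrite (eq_bigr (fun l : 'I_n => \sum_(k < n) F l k + F l n)); last first.
    by move=> l _; rewrite big_ord_recr.
  rewrite !big_split /= -!addrA; congr (_ + _).
  by rewrite [RHS]addrCA [X in _ + X]addrC.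
have e2 : \sum_(1 <= j < n.+1) \sum_(l < n.+1 - j) (F l (l + j)%N + F (l + j)%N l) =
   \sum_(1 <= j < n) \sum_(l < n - j) (F l (l + j)%N + F (l + j)%N l) +
   \sum_(l < n) (F l n + F n l).
  rewrite (@eq_big_nat _ _ _ _ _ _ (fun j => \sum_(l < n - j) (F l (l + j)%N + F (l + j)%N l)
     + (F (n - j)%N n + F n (n - j)%N))); last first.
    by move=> j /andP[j1 j2]; rewrite subSn // big_ord_recr /= subnK.
  rewrite big_split /=; congr (_ + _).
    case: (n) => [|m]; first by rewrite !big_geq.
    by rewrite big_nat_recr //= subnn big_ord0 addr0.
  rewrite big_add1 /= big_mkord (reindex_inj rev_ord_inj) /=; apply: eq_bigr => i _.
  by rewrite subnSK // subKn // ltnW.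
rewrite e1 e2 IH big_ord_recr /= !addrA; congr (_ + _).
by rewrite -!addrA; congr (_ + _); rewrite addrC.
Qed.

(** * The detecting polynomial and the Fejer kernel *)

Section Detector.
Variable R : realType.
Implicit Types (M N l j : nat) (eta t : R).

(* With z = e(t), multiplying sum_l a_l z^l by cos(2 pi t) - 1 + e amounts to taking a
   second difference of the weights; as a_l = l (M - l) vanishes at both ends, this gives
   sum_l d_l z^l of the same degree.  Then det_c0 and det_c j are the Fourier cosine
   coefficients of |sum_l a_l z^l|^2 (cos(2 pi t) - 1 + e). *)
Definition det_a M l : R := (l * (M - l))%:R.

Definition det_prev M l : R := if l is l'.+1 then det_a M l' else 0.

Definition det_d M (e : R) l : R :=
  (det_prev M l + det_a M l.+1) / 2 - (1 - e) * det_a M l.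

Definition det_c0 M e : R := \sum_(l < M.+1) det_a M l * det_d M e l.

Definition det_c M e j : R :=
  \sum_(l < M.+1 - j) (det_a M l * det_d M e (l + j)%N + det_a M (l + j)%N * det_d M e l).

Lemma det_a0 M l : (M <= l)%N -> det_a M l = 0.
Proof. by move=> h; rewrite /det_a (eqP (_ : M - l == 0)%N) ?muln0 // subn_eq0. Qed.

Lemma det_a_ge0 M l : 0 <= det_a M l. Proof. exact: ler0n. Qed.

Lemma rcD (x y : R) : (x + y)%:C%C = x%:C%C + y%:C%C.
Proof. by rewrite rmorphD. Qed.
Lemma rcB (x y : R) : (x - y)%:C%C = x%:C%C - y%:C%C.
Proof. by rewrite rmorphB. Qed.
Lemma rcM (x y : R) : (x * y)%:C%C = x%:C%C * y%:C%C.
Proof. by rewrite rmorphM. Qed.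

Lemma det_poly M e (z zi : R[i]) : z * zi = 1 -> (0 < M)%N ->
  (z + zi - (2 * (1 - e))%:C%C) * \sum_(l < M.+1) (det_a M l)%:C%C * z ^+ l =
  \sum_(l < M.+1) (2 * det_d M e l)%:C%C * z ^+ l.
Proof.
move=> zzi M0.
have s1 : z * \sum_(l < M.+1) (det_a M l)%:C%C * z ^+ l =
   \sum_(l < M.+1) (det_prev M l)%:C%C * z ^+ l.
  rewrite big_ord_recr /= det_a0 // mul0r addr0 [RHS]big_ord_recl /= mul0r add0r.
  by rewrite mulr_sumr; apply: eq_bigr => l _; rewrite /= exprS mulrCA.
have s2 : zi * \sum_(l < M.+1) (det_a M l)%:C%C * z ^+ l =
   \sum_(l < M.+1) (det_a M l.+1)%:C%C * z ^+ l.
  rewrite big_ord_recl /= /det_a mul0n mul0r add0r.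
  rewrite [RHS]big_ord_recr /= -[((M.+1 * (M - M.+1))%:R : R)]/(det_a M M.+1) det_a0 // mul0r addr0.
  rewrite mulr_sumr; apply: eq_bigr => l _; rewrite exprS mulrCA; congr (_ * _).
  by rewrite mulrA [zi * z]mulrC zzi mul1r.
rewrite mulrBl mulrDl s1 s2 -big_split /= mulr_sumr -sumrB.
apply: eq_bigr => l _; rewrite /det_d; move: (det_prev M l) => A.
have -> : 2 * ((A + det_a M l.+1) / 2 - (1 - e) * det_a M l) =
   A + det_a M l.+1 - 2 * (1 - e) * det_a M l by field.
by rewrite rcB rcD [(2 * (1 - e) * _)%:C%C]rcM; ring.
Qed.

Lemma detector_expand M e th : (0 < M)%N ->
  cmod (\sum_(l < M.+1) (det_a M l)%:C%C * cexp th ^+ l) ^+ 2 *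
    (cos (2 * pi * th) - (1 - e)) =
  det_c0 M e + \sum_(1 <= j < M.+1) det_c M e j * cos (2 * pi * (j%:R * th)).
Proof.
move=> M0; set z := cexp th; set zi := cexp (- th).
have zzi : z * zi = 1 by exact: cexp_mulN.
pose Phi := \sum_(l < M.+1) (det_a M l)%:C%C * z ^+ l; rewrite -/Phi.
have cosE : z + zi = (2 * cos (2 * pi * th))%:C%C.
  rewrite /z /zi cexpN; apply/eqP; rewrite eq_complex /=.
  by apply/andP; split; apply/eqP; ring.
have hP : (2 * (cos (2 * pi * th) - (1 - e)))%:C%C * Phi =
    \sum_(l < M.+1) (2 * det_d M e l)%:C%C * z ^+ l.
  by rewrite -(det_poly e zzi M0) -/Phi cosE mulrBr rcB.
have h2 : (cmod Phi ^+ 2 * (2 * (cos (2 * pi * th) - (1 - e))))%:C%C =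
    (Phi^*)%C * \sum_(l < M.+1) (2 * det_d M e l)%:C%C * z ^+ l.
  by rewrite -hP rcM -cmod_conj_sqr; ring.
pose F (l k : nat) := det_a M l * det_d M e k * cos (2 * pi * ((k%:R - l%:R) * th)).
have h3 : cmod Phi ^+ 2 * (cos (2 * pi * th) - (1 - e)) =
    \sum_(l < M.+1) \sum_(k < M.+1) F l k.
  have := congr1 (fun w => Re w) h2; rewrite /= => h.
  apply: (@mulfI _ 2); first by rewrite pnatr_eq0.
  rewrite mulrCA h rmorph_sum /= big_distrl /= Re_sum mulr_sumr; apply: eq_bigr => l _.
  rewrite big_distrr /= Re_sum mulr_sumr; apply: eq_bigr => k _.
  have -> : ((det_a M l)%:C%C * z ^+ l)^*%C * ((2 * det_d M e k)%:C%C * z ^+ k) =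
     (2 * (det_a M l * det_d M e k))%:C%C * cexp ((k%:R - l%:R) * th).
    have cj (x u : R) : (x%:C%C * cexp u)^*%C = x%:C%C * cexp (- u).
      rewrite cexpN; case: (cexp u) => p q; apply/eqP; rewrite eq_complex /=.
      by apply/andP; split; apply/eqP; ring.
    rewrite -!cexpMn cj mulrACA -cexpD -rcM.
    by congr (_%:C%C * cexp _); ring.
  by rewrite Re_realM /F /=; ring.
rewrite h3 sum_square_diagonals; congr (_ + _).
  by apply: eq_bigr => l _; rewrite /F subrr mul0r mulr0 cos0 mulr1.
apply: eq_big_nat => j _; rewrite /det_c mulr_suml; apply: eq_bigr => l _.
rewrite /F natrD [RHS]mulrDl; congr (_ + _); first by congr (_ * cos _); ring.
by rewrite -[cos (2 * pi * (j%:R * th))]cosN; congr (_ * cos _); ring.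
Qed.

Lemma det_sum_a M : (0 < M)%N -> \sum_(l < M.+1) det_a M l = (M%:R ^+ 3 - M%:R) / 6.
Proof.
move=> M0.
have aE (l : nat) : (l <= M)%N -> det_a M l = l%:R * (M%:R - l%:R).
  by move=> lM; rewrite /det_a natrM natrB.
rewrite (eq_bigr (fun l : 'I_M.+1 => l%:R * (M%:R - l%:R))); last first.
  by move=> l _; rewrite aE // -ltnS.
have gen n : \sum_(l < n.+1) (l%:R * (M%:R - l%:R) : R) =
    M%:R * (n%:R * (n%:R + 1) / 2) - n%:R * (n%:R + 1) * (2 * n%:R + 1) / 6.
  elim: n => [|n IH]; first by rewrite big_ord_recl big_ord0 /= !mul0r; field.
  by rewrite big_ord_recr /= IH -natr1; field.
by rewrite gen; field.
Qed.

Lemma det_a_le M l : (l <= M)%N -> det_a M l <= M%:R ^+ 2.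
Proof.
move=> lM; rewrite /det_a natrM expr2; apply: ler_pM => //; rewrite ler_nat //.
exact: leq_subr.
Qed.

(** [l (M - l)] has constant second difference -2. Hence, away from the two ends, the weights are
    bounded uniformly in [M] when [e] has order [M^(-2)]. *)
Lemma det_d_interior M e l : (0 < l < M)%N -> det_d M e l = e * det_a M l - 1.
Proof.
case: l => [//|l] /= lM; rewrite /det_d /= /det_a !natrM.
rewrite !natrB ?(ltnW lM) //; last by apply: leq_trans lM; rewrite leqW.
by rewrite -!natr1; field.
Qed.

Lemma det_d_first M e : det_d M e 0 = (M - 1)%:R / 2.
Proof. by rewrite /det_d /= /det_a mul0n mulr0 subr0 add0r mul1n. Qed.

Lemma det_d_last M e : (0 < M)%N -> det_d M e M = (M - 1)%:R / 2.
Proof.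
case: M => [//|M] _; rewrite /det_d /= [det_a _ M.+2]det_a0 // [det_a _ M.+1]det_a0 //.
by rewrite mulr0 subr0 addr0 /det_a subSnn muln1 subSS subn0.
Qed.

(** The interior weights are bounded and each end has size about [M / 2], so the total has order
    [M]. *)
Lemma det_d_sum M e (w : R) : (0 < M)%N -> e = 2 * w ^+ 2 / M%:R ^+ 2 ->
  \sum_(l < M.+1) `|det_d M e l| <= M%:R * (2 * w ^+ 2 + 2).
Proof.
move=> M0 eE; have MR : 0 < M%:R :> R by rewrite ltr0n.
have w0 : 0 <= w ^+ 2 := sqr_ge0 _.
have e0 : 0 <= e by rewrite eE divr_ge0 ?sqr_ge0 // mulr_ge0 ?sqr_ge0.
rewrite big_ord_recr /= det_d_last //.
case: M M0 MR eE e0 => [//|M] _ MR eE e0.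
rewrite big_ord_recl /= det_d_first.
have bl (i : 'I_M) : `|det_d M.+1 e (bump 0 i)| <= 2 * w ^+ 2 + 1.
  rewrite det_d_interior; last by rewrite /= ltnS ltn_ord.
  have a0 := det_a_ge0 M.+1 (bump 0 i).
  have a1 : det_a M.+1 (bump 0 i) <= M.+1%:R ^+ 2 by rewrite det_a_le // /bump /= add1n ltnW // ltnS.
  have u : e * det_a M.+1 (bump 0 i) <= 2 * w ^+ 2.
    apply: (@le_trans _ _ (e * M.+1%:R ^+ 2)); first by rewrite ler_wpM2l.
    by rewrite eE divfK // expf_neq0 // gt_eqF.
  have u0 : 0 <= e * det_a M.+1 (bump 0 i) by rewrite mulr_ge0.
  by rewrite ler_norml; apply/andP; split; move: u u0 w0; clear; lra.
have b2 : \sum_(i < M) `|det_d M.+1 e (bump 0 i)| <= M%:R * (2 * w ^+ 2 + 1).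
  apply: (@le_trans _ _ (\sum_(i < M) (2 * w ^+ 2 + 1))); first by apply: ler_sum => i _.
  by rewrite sumr_const card_ord -[_ *+ M]mulr_natl.
have -> : ((M.+1 - 1)%:R : R) = M%:R by rewrite subn1.
rewrite ger0_norm ?divr_ge0 //.
have Mp : 0 <= M%:R :> R := ler0n _ _.
have fin (S v m : R) : 0 <= v -> 0 <= m -> S <= m * (2 * v + 1) ->
    m / 2 + S + m / 2 <= (m + 1) * (2 * v + 2).
  by move=> v0 m0 hS; have := mulr_ge0 m0 v0; move: v0 m0 hS; clear; lra.
by rewrite -[M.+1%:R]natr1; exact: fin.
Qed.

Lemma det_c0E M e : (0 < M)%N ->
  det_c0 M e = e * \sum_(l < M.+1) det_a M l ^+ 2 - \sum_(l < M.+1) det_a M l.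
Proof.
move=> M0; rewrite /det_c0 mulr_sumr -sumrB; apply: eq_bigr => l _.
have [l0|l0] := posnP l; first by rewrite l0 /det_a mul0n !mul0r expr0n mulr0 subr0.
have := ltn_ord l; rewrite ltnS leq_eqVlt => /orP[/eqP ->|lM].
  by rewrite det_a0 // mul0r expr0n mulr0 subr0.
by rewrite det_d_interior ?l0 //; ring.
Qed.

(** Cauchy-Schwarz, [A^2 <= M A2], together with [A >= M^3 / 8] gives [e A2 >= 4 A] as soon as
    [w >= 4]; the mean is then at least [3 A]. *)
Lemma det_c0_ge M e (w : R) : (2 <= M)%N -> e = 2 * w ^+ 2 / M%:R ^+ 2 -> 4 <= w ->
  M%:R ^+ 3 / 4 <= det_c0 M e.
Proof.
move=> M2 eE w4; have M0 : (0 < M)%N by apply: leq_trans M2.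
have MR : 2 <= M%:R :> R by rewrite ler_nat.
have MR0 : 0 < M%:R :> R by rewrite ltr0n.
rewrite det_c0E //; set A := \sum_(l < M.+1) det_a M l; set A2 := \sum_(l < M.+1) _ ^+ 2.
have AE : A = (M%:R ^+ 3 - M%:R) / 6 by exact: det_sum_a.
have hC : A ^+ 2 <= M%:R * A2.
  rewrite /A /A2 !big_ord_recr /= [det_a M M]det_a0 // expr0n !addr0.
  exact: (sqr_sum_le M (det_a M)).
have hA : M%:R ^+ 3 / 8 <= A.
  rewrite AE; move: MR; clear; nra.
have A0 : 0 < A by apply: lt_le_trans hA; rewrite divr_gt0 ?exprn_gt0.
have h1 : 4 * A <= e * A2.
  have e0 : 0 <= e by rewrite eE divr_ge0 ?sqr_ge0 // mulr_ge0 ?sqr_ge0.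
  apply: (@le_trans _ _ (e * (A ^+ 2 / M%:R))); last first.
    by rewrite ler_wpM2l // ler_pdivrMr // mulrC.
  have -> : e * (A ^+ 2 / M%:R) = (2 * w ^+ 2 * A / M%:R ^+ 3) * A.
    by rewrite eE; field; rewrite gt_eqF.
  rewrite ler_pM2r // ler_pdivlMr ?exprn_gt0 //.
  have w16 : 16 <= w ^+ 2 by move: w4; clear; nra.
  apply: (@le_trans _ _ (2 * 16 * A)); first by move: hA; clear; lra.
  by rewrite ler_wpM2r ?(ltW A0) // ler_pM2l.
move: h1 hA A0; clear; lra.
Qed.

Lemma det_c_le M e (w : R) j : (0 < M)%N -> e = 2 * w ^+ 2 / M%:R ^+ 2 ->
  `|det_c M e j| <= M%:R ^+ 3 * (4 * w ^+ 2 + 4).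
Proof.
move=> M0 eE; have := det_d_sum M0 eE; set D := \sum_(l < M.+1) _ => hD.
rewrite /det_c big_split /=.
have M2 : 0 <= M%:R ^+ 2 :> R := sqr_ge0 _.
have b1 : `|\sum_(i < M.+1 - j) det_a M i * det_d M e (i + j)| <= M%:R ^+ 2 * D.
  apply: le_trans (ler_norm_sum _ _ _) _.
  apply: (@le_trans _ _ (\sum_(i < M.+1 - j) M%:R ^+ 2 * `|det_d M e (i + j)|)).
    apply: ler_sum => i _; rewrite normrM (ger0_norm (det_a_ge0 _ _)) ler_wpM2r //.
    by apply: det_a_le; rewrite -ltnS; apply: leq_trans (ltn_ord i) (leq_subr _ _).
  rewrite -mulr_sumr ler_wpM2l // /D.
  have [jM|jM] := leqP j M.+1; last first.
    by rewrite (eqP (_ : M.+1 - j == 0)%N) ?subn_eq0 ?(ltnW jM) // big_ord0 sumr_ge0.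
  rewrite -(big_mkord xpredT (fun l => `|det_d M e l|)) (@big_cat_nat _ _ _ j) //=.
  have -> : \sum_(j <= i < M.+1) `|det_d M e i| = \sum_(i < M.+1 - j) `|det_d M e (i + j)|.
    by rewrite [LHS](_ : _ = \sum_((0 + j)%N <= i < M.+1) `|det_d M e i|) // big_addn big_mkord.
  by rewrite lerDr; apply: sumr_ge0.
have b2 : `|\sum_(i < M.+1 - j) det_a M (i + j) * det_d M e i| <= M%:R ^+ 2 * D.
  apply: le_trans (ler_norm_sum _ _ _) _.
  apply: (@le_trans _ _ (\sum_(i < M.+1 - j) M%:R ^+ 2 * `|det_d M e i|)).
    apply: ler_sum => i _; rewrite normrM (ger0_norm (det_a_ge0 _ _)) ler_wpM2r //.
    by apply: det_a_le; rewrite -ltnS addnC -ltn_subRL ltn_ord.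
  rewrite -mulr_sumr ler_wpM2l // /D.
  rewrite (big_ord_widen M.+1 (fun l => `|det_d M e l|)) ?leq_subr //.
  by rewrite [leLHS]big_mkcond; apply: ler_sum => i _; case: ifP.
apply: le_trans (ler_normD _ _) _; apply: le_trans (lerD b1 b2) _.
have := ler_wpM2l M2 hD.
have -> : M%:R ^+ 3 * (4 * w ^+ 2 + 4) = 2 * (M%:R ^+ 2 * (M%:R * (2 * w ^+ 2 + 2))) by ring.
by clear; lra.
Qed.

Lemma det_a_shiftr M l j : (l <= M)%N -> `|det_a M (l + j) - det_a M l| <= j%:R * M%:R.
Proof.
move=> lM; have lM' : l%:R <= M%:R :> R by rewrite ler_nat.
have l0 : 0 <= l%:R :> R := ler0n _ _; have j0 : 0 <= j%:R :> R := ler0n _ _.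
have [ljM|ljM] := leqP (l + j) M.
  have h : l%:R + j%:R <= M%:R :> R by rewrite -natrD ler_nat.
  rewrite /det_a !natrM !natrB // natrD.
  have -> : (l%:R + j%:R) * (M%:R - (l%:R + j%:R)) - l%:R * (M%:R - l%:R) =
     j%:R * (M%:R - 2 * l%:R - j%:R) :> R by ring.
  rewrite normrM (ger0_norm j0) ler_wpM2l // ler_norml; apply/andP.
  by move: h l0 j0; clear; split; lra.
rewrite det_a0 1?ltnW // sub0r normrN (ger0_norm (det_a_ge0 _ _)) /det_a natrM mulrC.
apply: ler_pM => //; rewrite ler_nat // leq_subLR ltnW //.
Qed.

Lemma det_a_shiftl M l j : (l <= M)%N ->
  `|(if (j <= l)%N then det_a M (l - j) else 0) - det_a M l| <= j%:R * M%:R.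
Proof.
move=> lM; have lM' : l%:R <= M%:R :> R by rewrite ler_nat.
have l0 : 0 <= l%:R :> R := ler0n _ _; have j0 : 0 <= j%:R :> R := ler0n _ _.
case: leqP => jl.
  have h : j%:R <= l%:R :> R by rewrite ler_nat.
  rewrite /det_a !natrM !natrB //; last by apply: leq_trans (leq_subr _ _) lM.
  have -> : (l%:R - j%:R) * (M%:R - (l%:R - j%:R)) - l%:R * (M%:R - l%:R) =
     j%:R * (2 * l%:R - M%:R - j%:R) :> R by ring.
  rewrite normrM (ger0_norm j0) ler_wpM2l // ler_norml; apply/andP.
  by move: h l0 j0 lM'; clear; split; lra.
rewrite sub0r normrN (ger0_norm (det_a_ge0 _ _)) /det_a natrM.
by apply: ler_pM => //; rewrite ler_nat ?leq_subr // ltnW.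
Qed.

(** A shift by [j] changes [det_a] by at most [j M], against values of order [M^2]. Thus the low
    coefficients are nearly twice the constant one, as they are for a Fejer kernel. *)
Lemma det_c_near M e (w : R) j : (0 < M)%N -> (j <= M)%N -> e = 2 * w ^+ 2 / M%:R ^+ 2 ->
  `|det_c M e j - 2 * det_c0 M e| <= j%:R * M%:R ^+ 2 * (4 * w ^+ 2 + 4).
Proof.
move=> M0 jM eE; have := det_d_sum M0 eE; set D := \sum_(l < M.+1) _ => hD.
pose ap l : R := if (j <= l)%N then det_a M (l - j) else 0.
have s1 : \sum_(l < M.+1 - j) det_a M (l + j) * det_d M e l =
    \sum_(l < M.+1) det_a M (l + j) * det_d M e l.
  rewrite (big_ord_widen M.+1 (fun l => det_a M (l + j) * det_d M e l)) ?leq_subr //.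
  rewrite big_mkcond; apply: eq_bigr => l _; case: ifP => // /negbT.
  rewrite -leqNgt leq_subLR addnC => h; rewrite det_a0 ?mul0r //.
  by apply: leq_trans h; rewrite leqnSn.
have s2 : \sum_(l < M.+1 - j) det_a M l * det_d M e (l + j) = \sum_(l < M.+1) ap l * det_d M e l.
  rewrite -(big_mkord xpredT (fun l => ap l * det_d M e l)) (@big_cat_nat _ _ _ j) //=; last first.
    exact: leqW.
  rewrite [X in _ = X + _]big_nat [X in _ = X + _]big1 ?add0r; last first.
    by move=> l /andP[_ lj]; rewrite /ap leqNgt lj mul0r.
  rewrite [RHS](_ : _ = \sum_(0 + j <= l < M.+1) ap l * det_d M e l) // big_addn big_mkord.
  by apply: eq_bigr => l _; rewrite /ap leq_addl addnK.
have -> : det_c M e j - 2 * det_c0 M e =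
    \sum_(l < M.+1) ((ap l - det_a M l) + (det_a M (l + j) - det_a M l)) * det_d M e l.
  rewrite /det_c big_split /= s1 s2 /det_c0 -big_split /= mulr_sumr -sumrB.
  by apply: eq_bigr => l _; ring.
apply: le_trans (ler_norm_sum _ _ _) _.
apply: (@le_trans _ _ (\sum_(l < M.+1) (2 * (j%:R * M%:R)) * `|det_d M e l|)).
  apply: ler_sum => l _; rewrite normrM ler_wpM2r //.
  apply: le_trans (ler_normD _ _) _; rewrite mulr_natl mulr2n.
  by apply: lerD; [apply: det_a_shiftl | apply: det_a_shiftr]; rewrite -ltnS.
rewrite -mulr_sumr -/D.
have j0 : 0 <= 2 * (j%:R * M%:R) :> R by rewrite !mulr_ge0.
apply: le_trans (ler_wpM2l j0 hD) _; rewrite le_eqVlt; apply/orP; left; apply/eqP; ring.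
Qed.

(** If every [|t x|] were at least [eta], each summand would be nonpositive:
    [1 - cos (2 pi t / N) >= 2 (t / N)^2] for [|t| <= N / 2], and this is at least the [e] of the
    statement. *)
Lemma detector (X : finType) (t : X -> R) (N M : nat) eta : (0 < M)%N -> (0 < N)%N ->
  (forall x, `|t x| <= N%:R / 2) -> 0 < eta ->
  0 < det_c0 M (2 * eta ^+ 2 / N%:R ^+ 2) * #|X|%:R +
    \sum_(1 <= j < M.+1) det_c M (2 * eta ^+ 2 / N%:R ^+ 2) j *
      \sum_(x : X) cos (2 * pi * (j%:R * (t x / N%:R))) ->
  exists x, `|t x| < eta.
Proof.
move=> M0 N0 tN eta0; set e := 2 * eta ^+ 2 / N%:R ^+ 2 => hpos.
have NR : 0 < N%:R :> R by rewrite ltr0n.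
apply: contrapT => hno.
have {}hno x : eta <= `|t x| by rewrite leNgt; apply/negP => h; apply: hno; exists x.
suff : det_c0 M e * #|X|%:R + \sum_(1 <= j < M.+1) det_c M e j *
      \sum_(x : X) cos (2 * pi * (j%:R * (t x / N%:R))) <= 0 by rewrite leNgt hpos.
have -> : det_c0 M e * #|X|%:R + \sum_(1 <= j < M.+1) det_c M e j *
      \sum_(x : X) cos (2 * pi * (j%:R * (t x / N%:R))) =
   \sum_(x : X) (det_c0 M e + \sum_(1 <= j < M.+1) det_c M e j *
      cos (2 * pi * (j%:R * (t x / N%:R)))).
  rewrite big_split /= sumr_const mulr_natr; congr (_ + _).
  by rewrite exchange_big /=; apply: eq_bigr => j _; rewrite mulr_sumr.
apply: sumr_le0 => x _; rewrite -detector_expand //.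
rewrite mulr_ge0_le0 ?sqr_ge0 //.
have : 2 * `|t x / N%:R| <= cmod (1 - cexp (t x / N%:R)).
  apply: cmod_1Bcexp_ge; rewrite normrM [`|N%:R^-1|]ger0_norm ?invr_ge0 //.
  by rewrite ler_pdivrMr // mulrC tN.
move=> h1.
have h2 : (2 * `|t x / N%:R|) ^+ 2 <= 2 - 2 * cos (2 * pi * (t x / N%:R)).
  by rewrite -cmod_1Bcexp_sqr lerXn2r ?nnegrE ?cmod_ge0 // mulr_ge0.
have h3 : e <= 2 * `|t x / N%:R| ^+ 2.
  rewrite normrM [`|N%:R^-1|]ger0_norm ?invr_ge0 // exprMn exprVn mulrA.
  rewrite ler_wpM2r ?invr_ge0 ?sqr_ge0 // ler_pM2l //.
  by rewrite lerXn2r ?nnegrE // ltW.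
move: h2 h3; rewrite exprMn; move: (`|_| ^+ 2) => u; clear; lra.
Qed.

Lemma fejer_expand (J : nat) (th : R) : (0 < J)%N ->
  cmod (\sum_(j < J) cexp (j%:R * th)) ^+ 2 =
    J%:R + 2 * \sum_(1 <= j < J) (J - j)%:R * cos (2 * pi * (j%:R * th)).
Proof.
move=> J0; rewrite (cmod_sqr_cexp_sum J (fun j => j%:R * th)); congr (_ + 2 * _).
apply: eq_big_nat => j _.
rewrite (eq_bigr (fun _ => cexp (j%:R * th))); last first.
  by move=> x _; congr cexp; rewrite natrD; ring.
by rewrite Re_sum sumr_const card_ord -[_ *+ (J - j)]mulr_natl.
Qed.

End Detector.

(** * Sums of cubes over a box and the lower bound for the Fejer sum *)

Section CubeSums.
Variable R : realType.
Implicit Types (P Y J N : nat) (al tau : R).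

(** The seventh long variable is kept apart from the six others because the count below solves for
    it once the rest is chosen. *)
Definition cube_box P Y := (({ffun 'I_6 -> 'I_P} * 'I_P) * ('I_Y * 'I_Y))%type.

Definition cube_sum P Y (th : 'I_6 -> R) (t7 p1 p2 : R) (x : cube_box P Y) : R :=
  \sum_(i < 6) ((x.1.1 i)%:R + th i) ^+ 3 + ((x.1.2)%:R + t7) ^+ 3 +
  ((x.2.1%:R + p1) ^+ 3 + (x.2.2%:R + p2) ^+ 3).

Lemma cexp_cube_sum P Y th t7 p1 p2 al :
  \sum_(x : cube_box P Y) cexp (al * cube_sum th t7 p1 p2 x) =
  ((\prod_(i < 6) weyl_sum P (th i) al) * weyl_sum P t7 al) *
  (weyl_sum Y p1 al * weyl_sum Y p2 al).
Proof.
rewrite /weyl_sum bigA_distr_bigA /= big_distrl /=.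
under [X in _ = X * _]eq_bigr do rewrite big_distrr /=.
rewrite pair_big /=; set A := (X in _ = X * _); rewrite big_distrlr /= pair_big /= {}/A big_distrl /=.
under [RHS]eq_bigr do rewrite big_distrr /=.
rewrite pair_big /=.
apply: eq_bigr => -[[f x] [y y']] _ /=; rewrite /cube_sum /= !mulrDr !cexpD mulr_sumr cexp_sum.
by [].
Qed.

Lemma discrete_crossing (Q : nat -> bool) n : Q 0%N -> ~~ Q n ->
  exists2 k, (k < n)%N & Q k && ~~ Q k.+1.
Proof.
move=> Q0 Qn; have [] := ex_minnP (ex_intro (fun n => ~~ Q n) n Qn).
case=> [|m]; first by rewrite Q0.
move=> Qm hm; exists m; first exact: hm.
rewrite Qm andbT; apply: contraT => /hm; by rewrite ltnn.
Qed.

(** So close to an integer nothing cancels: each term has real part at least 1/2. *)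
Lemma cmod_cexp_sum_ge J (u : R) : 16 * J%:R * `|u| <= 1 ->
  J%:R ^+ 2 / 4 <= cmod (\sum_(j < J) cexp (j%:R * u)) ^+ 2.
Proof.
move=> hu.
have h1 : J%:R / 2 <= cmod (\sum_(j < J) cexp (j%:R * u)).
  apply: le_trans (Re_le_cmod _); rewrite Re_sum.
  have -> : J%:R / 2 = \sum_(j < J) (2^-1 : R) by rewrite sumr_const card_ord mulr_natl.
  apply: ler_sum => j _.
  have : cmod (1 - cexp (j%:R * u)) <= 2^-1.
    apply: le_trans (cmod_1Bcexp_le _) _; rewrite normrM [`|j%:R|]ger0_norm //.
    have : j%:R * `|u| <= J%:R * `|u| by rewrite ler_wpM2r // ler_nat ltnW.
    by move: hu; rewrite -mulrA; move: (J%:R * _) (j%:R * _) => a b; clear; lra.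
  have := Re_cmod (1 - cexp (j%:R * u)); rewrite /= ler_norml.
  by move: (cos _) => c; clear; lra.
have -> : J%:R ^+ 2 / 4 = (J%:R / 2) ^+ 2 :> R by field.
by rewrite lerXn2r ?nnegrE ?cmod_ge0 // divr_ge0.
Qed.

(** [k] is the last point whose cube is at most [s]. Going down from there, each step moves the cube
    by at most [12 P^2], so the first [P / J] points stay within [12 P^3 / J] of [s]. *)
Lemma near_cube_count P J (t7 s : R) : (1000 <= P)%N -> (10 <= J)%N -> (J <= P)%N ->
  P%:R < t7 <= P%:R + 1 ->
  3 / 2 * P%:R ^+ 3 <= s -> s <= 15 / 2 * P%:R ^+ 3 ->
  exists2 k : nat, (P %/ J <= k.+1 <= P)%N &
    forall i, (i < P %/ J)%N -> J%:R * `|((k - i)%:R + t7) ^+ 3 - s| <= 12 * P%:R ^+ 3.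
Proof.
move=> P1000 J10 JP /andP[t1 t2] s1 s2.
have PR : 1000 <= P%:R :> R by rewrite ler_nat.
have P3 : 0 < P%:R ^+ 3 :> R by rewrite exprn_gt0 //; lra.
pose Q k := (k%:R + t7) ^+ 3 <= s.
have Q0 : Q 0%N.
  rewrite /Q add0r; apply: le_trans s1.
  apply: (@le_trans _ _ ((11 / 10 * P%:R) ^+ 3)).
    by rewrite lerXn2r ?nnegrE //; move: PR t1 t2; clear; lra.
  by rewrite exprMn; move: P3; move: (P%:R ^+ 3) => z; clear; lra.
have QP : ~~ Q (P - 1)%N.
  rewrite /Q -ltNge; apply: le_lt_trans s2 _.
  apply: (@lt_le_trans _ _ ((199 / 100 * P%:R) ^+ 3)).
    by rewrite exprMn; move: P3; move: (P%:R ^+ 3) => z; clear; lra.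
  rewrite lerXn2r ?nnegrE ?natrB ?(leq_trans _ P1000) //; move: PR t1 t2; clear; lra.
have [k kP /andP[Qk nQk]] := discrete_crossing Q0 QP.
have kP' : k%:R + 2 <= P%:R :> R.
  have : (k.+2 <= P)%N by move: kP; rewrite ltn_subRL add1n.
  by rewrite -(ler_nat R) -addn2 natrD.
rewrite /Q -ltNge in nQk; rewrite /Q in Qk.
(* [1.14^3 < 3/2], so the crossing lies about [0.14 P] above the start, which leaves room below it
   for [P / J <= P / 10] points. *)
have klow : 114 / 100 * P%:R <= k%:R + 1 + t7.
  rewrite natr1 leNgt; apply/negP => h.
  have : (k.+1%:R + t7) ^+ 3 <= (114 / 100 * P%:R) ^+ 3.
    by rewrite lerXn2r ?nnegrE ?(ltW h) // ?addr_ge0 // ?mulr_ge0 //; move: PR t1; clear; lra.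
  by rewrite exprMn; move: P3 s1 nQk; move: (P%:R ^+ 3) => z; clear; lra.
set m := (P %/ J)%N.
have J0 : 0 < J%:R :> R by rewrite ltr0n (leq_trans _ J10).
have mJ : m%:R * J%:R <= P%:R :> R by rewrite -natrM ler_nat leq_trunc_div.
have m10 : 10 * m%:R <= P%:R :> R.
  apply: le_trans mJ; rewrite mulrC ler_wpM2l // ler_nat //.
have km : (m <= k.+1)%N.
  rewrite -(ler_nat R) -natr1; have h : 114 / 100 * P%:R - (P%:R + 1) <= k%:R + 1 :> R by move: klow t2; clear; lra.
  by move: h m10 PR; clear; lra.
exists k; first by rewrite km; move: kP; clear; lia.
move=> i im.
have ik : (i <= k)%N by rewrite -ltnS (leq_trans im).
have iJ : J%:R * (i%:R + 1) <= P%:R :> R.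
  by apply: le_trans mJ; rewrite mulrC ler_wpM2r // natr1 ler_nat.
rewrite natrB //; set a : R := k%:R - i%:R + t7.
set b : R := k%:R + 1 + t7.
have a0 : 0 <= a.
  by move: t1 PR; have : i%:R <= k%:R :> R by [rewrite ler_nat]; rewrite /a; clear; lra.
have ab : a <= b by rewrite /a /b; have : 0 <= i%:R :> R by []; clear; lra.
have b2 : b <= 2 * P%:R by move: kP' t2; rewrite /b; clear; lra.
have sb : s <= b ^+ 3 by move: nQk; rewrite -natr1 => /ltW.
have sa : a ^+ 3 <= s.
  apply: le_trans Qk; rewrite lerXn2r ?nnegrE //.
    by move: t1 PR; have : 0 <= k%:R :> R by []; clear; lra.
  by rewrite /a; have : 0 <= i%:R :> R by []; clear; lra.
have bd : b ^+ 3 - a ^+ 3 <= (i%:R + 1) * (12 * P%:R ^+ 2).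
  have -> : b ^+ 3 - a ^+ 3 = (i%:R + 1) * (b ^+ 2 + b * a + a ^+ 2) by rewrite /a /b; ring.
  have b0 : 0 <= b by rewrite (le_trans a0).
  rewrite ler_wpM2l ?addr_ge0 //.
  have h1 : b * b <= (2 * P%:R) * (2 * P%:R) by rewrite ler_pM.
  have h2 : b * a <= (2 * P%:R) * (2 * P%:R) by rewrite ler_pM // (le_trans ab).
  have h3 : a * a <= (2 * P%:R) * (2 * P%:R) by rewrite ler_pM // (le_trans ab).
  have -> : 12 * P%:R ^+ 2 = 2 * P%:R * (2 * P%:R) + 2 * P%:R * (2 * P%:R) + 2 * P%:R * (2 * P%:R) :> R by ring.
  by rewrite !expr2 !lerD.
have -> : 12 * P%:R ^+ 3 = P%:R * (12 * P%:R ^+ 2) :> R by ring.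
apply: (@le_trans _ _ (J%:R * ((i%:R + 1) * (12 * P%:R ^+ 2)))).
  rewrite ler_wpM2l //; rewrite ler_norml; apply/andP; split; move: sa sb bd; clear; lra.
by rewrite mulrA ler_wpM2r // ?mulr_ge0 ?exprn_ge0.
Qed.

(** Six shifted variables between about [1.4 P] and [1.5 P] have cubes between [2.59 P^3] and
    [3.375 P^3], and the two short cubes add at most [P^3 / 4]. With [tau] between [22 P^3] and
    [23 P^3] the seventh cube has to lie between [1.5 P^3] and [7.5 P^3], well inside its range from
    [P^3] to [8 P^3]. *)
Lemma cube_sum_count P Y J th t7 p1 p2 tau : (1000 <= P)%N -> (10 <= J)%N -> (J <= P)%N ->
  (forall i, P%:R < th i <= P%:R + 1) -> P%:R < t7 <= P%:R + 1 ->
  Y%:R < p1 <= Y%:R + 1 -> Y%:R < p2 <= Y%:R + 1 ->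
  64 * Y%:R ^+ 3 <= P%:R ^+ 3 :> R ->
  22 * P%:R ^+ 3 <= tau <= 23 * P%:R ^+ 3 ->
  8^-1 * 20^-1 ^+ 6 * (J%:R * (P%:R ^+ 7 * Y%:R ^+ 2)) <=
  \sum_(x : cube_box P Y) cmod (\sum_(j < J) cexp (j%:R *
      ((cube_sum th t7 p1 p2 x - tau) / (1000 * P%:R ^+ 3)))) ^+ 2.
Proof.
move=> P1000 J10 JP hth ht7 hp1 hp2 hY /andP[tau1 tau2].
have PR : 1000 <= P%:R :> R by rewrite ler_nat.
have P3 : 0 < P%:R ^+ 3 :> R by rewrite exprn_gt0 //; lra.
set p := (P %/ 10)%N; set m := (P %/ J)%N.
have pceil : (P < p.+1 * 10)%N by exact: ltn_ceil.
have p1P : P%:R <= 20 * p%:R :> R.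
  have p0 : (0 < p)%N by rewrite divn_gt0 // (leq_trans _ P1000).
  rewrite -natrM ler_nat; move: p0 pceil; clear; lia.
have m1P : P%:R <= 2 * (m%:R * J%:R) :> R.
  rewrite -natrM -(natrM R 2) ler_nat.
  have : (0 < m)%N by rewrite divn_gt0 // (leq_trans _ J10).
  have := ltn_ceil P (leq_trans (isT : 0 < 10)%N J10); rewrite -/m mulSn; move: J10; clear; nia.
have pP : (10 * p <= P)%N by rewrite mulnC leq_trunc_div.
have pb (h : 'I_p) : (4 * p + h < P)%N by have := ltn_ord h; move: pP; clear; lia.
pose fx (h : {ffun 'I_6 -> 'I_p}) : {ffun 'I_6 -> 'I_P} := [ffun i => Ordinal (pb (h i))].
pose rest (h : {ffun 'I_6 -> 'I_p}) (y : 'I_Y * 'I_Y) : R :=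
  tau - \sum_(i < 6) ((fx h i)%:R + th i) ^+ 3 - ((y.1%:R + p1) ^+ 3 + (y.2%:R + p2) ^+ 3).
have ycube (y : 'I_Y) (ph : R) : Y%:R < ph <= Y%:R + 1 -> 0 <= (y%:R + ph) ^+ 3 <= 8 * Y%:R ^+ 3.
  move=> /andP[h1 h2].
  have y1 : y%:R + 1 <= Y%:R :> R by rewrite natr1 ler_nat.
  have Y0 : 0 <= Y%:R :> R by [].
  have y0 : 0 <= y%:R + ph by rewrite addr_ge0 // ltW // (le_lt_trans Y0).
  rewrite exprn_ge0 //=.
  have -> : 8 * Y%:R ^+ 3 = (2 * Y%:R) ^+ 3 :> R by ring.
  by rewrite lerXn2r ?nnegrE ?mulr_ge0 //; move: y1 h2; clear; lra.
have xcube (h : 'I_p) (ph : R) : P%:R < ph <= P%:R + 1 ->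
    259 / 100 * P%:R ^+ 3 <= (((4 * p + h)%N)%:R + ph) ^+ 3 <= 27 / 8 * P%:R ^+ 3.
  move=> /andP[h1 h2].
  have q1 : (4 * p + h)%:R + 1 <= P%:R / 2 :> R.
    rewrite ler_pdivlMr // natr1 -natrM ler_nat; have := ltn_ord h; move: pP; clear; lia.
  have q2 : 4 * P%:R <= 10 * ((4 * p + h)%:R + 4) :> R.
    have -> : (4 * p + h)%:R + 4 = (4 * p + h + 4)%:R :> R by rewrite -natrD.
    by rewrite -!natrM ler_nat; move: pceil; clear; lia.
  have P0 : 0 <= P%:R :> R by [].
  have q0 : 0 <= (4 * p + h)%:R :> R by [].
  apply/andP; split.
    apply: (@le_trans _ _ ((1374 / 1000 * P%:R) ^+ 3)).
      by rewrite exprMn; move: P3; move: (P%:R ^+ 3) => z; clear; lra.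
    by rewrite lerXn2r ?nnegrE //; move: q0 q1 q2 h1 P0 PR; clear; lra.
  apply: (@le_trans _ _ ((3 / 2 * P%:R) ^+ 3)).
    by rewrite lerXn2r ?nnegrE //; move: q0 q1 q2 h1 h2 P0 PR; clear; lra.
  by rewrite exprMn; move: P3; move: (P%:R ^+ 3) => z; clear; lra.
have hrest h y : 3 / 2 * P%:R ^+ 3 <= rest h y <= 15 / 2 * P%:R ^+ 3.
  rewrite /rest.
  have /andP[a1 a2] := ycube y.1 _ hp1; have /andP[b1 b2] := ycube y.2 _ hp2.
  have c1 : \sum_(i < 6) (259 / 100 * P%:R ^+ 3) <= \sum_(i < 6) ((fx h i)%:R + th i) ^+ 3.
    apply: ler_sum => i _; rewrite ffunE /=; by have /andP[] := xcube (h i) _ (hth i).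
  have c2 : \sum_(i < 6) ((fx h i)%:R + th i) ^+ 3 <= \sum_(i < 6) (27 / 8 * P%:R ^+ 3).
    apply: ler_sum => i _; rewrite ffunE /=; by have /andP[] := xcube (h i) _ (hth i).
  have e6 (z : R) : \sum_(i < 6) z = 6 * z by rewrite sumr_const card_ord mulr_natl.
  move: c1 c2; rewrite !e6.
  move: (\sum_(i < 6) _) a1 a2 b1 b2 tau1 tau2 hY P3.
  move: ((y.1%:R + p1) ^+ 3) ((y.2%:R + p2) ^+ 3) (P%:R ^+ 3) (Y%:R ^+ 3) => a b c d e.
  by clear => *; apply/andP; split; lra.
have /choice [kk hkk] : forall hy : {ffun 'I_6 -> 'I_p} * ('I_Y * 'I_Y), exists k : nat,
    (m <= k.+1 <= P)%N /\ forall i, (i < m)%N ->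
    J%:R * `|((k - i)%:R + t7) ^+ 3 - rest hy.1 hy.2| <= 12 * P%:R ^+ 3.
  move=> [h y]; have /andP[r1 r2] := hrest h y.
  by have [k k1 k2] := near_cube_count P1000 J10 JP ht7 r1 r2; exists k.
pose T := (({ffun 'I_6 -> 'I_p} * 'I_m) * ('I_Y * 'I_Y))%type.
have kb (z : T) : (kk (z.1.1, z.2) - z.1.2 < P)%N.
  have [/andP[_ k1] _] := hkk (z.1.1, z.2); exact: leq_ltn_trans (leq_subr _ _) k1.
pose g (z : T) : cube_box P Y := ((fx z.1.1, Ordinal (kb z)), z.2).
have g_inj : injective g.
  move=> [[h i] y] [[h' i'] y'] [] /= e1 e2 ey; rewrite -ey in e2 *.
  have eh : h = h'.
    apply/ffunP => j; apply/val_inj.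
    have := congr1 (fun f : {ffun 'I_6 -> 'I_P} => val (f j)) e1; rewrite /= !ffunE /=.
    by move/addnI.
  rewrite -eh in e2 *; have [/andP[k1 _] _] := hkk (h, y).
  have /= li := ltn_ord i; have /= li' := ltn_ord i'.
  congr (_, _, _); apply/val_inj => /=.
  move: e2 k1 li li'; rewrite /=; move: (kk _) => k; clear; lia.
apply: (@le_trans _ _ (\sum_(x in g @: [set: T]) cmod (\sum_(j < J) cexp (j%:R *
      ((cube_sum th t7 p1 p2 x - tau) / (1000 * P%:R ^+ 3)))) ^+ 2)); last first.
  rewrite [X in _ <= X](bigID (mem (g @: [set: T]))) /= lerDl sumr_ge0 // => *.
  by rewrite exprn_ge0 // cmod_ge0.
rewrite big_imset /=; last by move=> *; apply: g_inj.
apply: (@le_trans _ _ (\sum_(z in [set: T]) (J%:R ^+ 2 / 4))); last first.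
  apply: ler_sum => -[[h i] y] _; apply: cmod_cexp_sum_ge.
  have [_ /(_ i (ltn_ord i))] := hkk (h, y).
  have -> : cube_sum th t7 p1 p2 (g (h, i, y)) - tau =
     ((kk (h, y) - i)%:R + t7) ^+ 3 - rest h y.
    by rewrite /cube_sum /rest /=; ring.
  have N0 : 0 < 1000 * P%:R ^+ 3 :> R by apply: mulr_gt0 P3.
  rewrite normrM normfV (gtr0_norm N0) => hh.
  rewrite mulrA (ler_pdivrMr _ _ N0) mul1r -mulrA.
  by move: hh P3; move: (J%:R * _) (P%:R ^+ 3) => a b; clear; lra.
(* [p >= P / 20] and [m J >= P / 2] convert the number of points, times [J^2 / 4], into the stated
   constant. *)
rewrite sumr_const cardsT !card_prod card_ffun !card_ord -[X in _ <= X]mulr_natl natrM (natrM R (p ^ 6)) natrX (natrM R Y).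
have -> : p%:R ^+ 6 * m%:R * (Y%:R * Y%:R) * (J%:R ^+ 2 / 4) =
  8^-1 * 20^-1 ^+ 6 * (J%:R * (((20 * p%:R) ^+ 6 * (2 * (m%:R * J%:R))) * Y%:R ^+ 2)) :> R by field.
rewrite ler_wpM2l ?mulr_ge0 ?exprn_ge0 ?invr_ge0 // ler_wpM2l // ler_wpM2r ?exprn_ge0 //.
rewrite [_ ^+ 7]exprSr ler_pM ?exprn_ge0 //.
by rewrite lerXn2r ?nnegrE ?mulr_ge0.
Qed.

End CubeSums.

(** * Dirichlet approximation and Weyl bounds in powers of r *)

Lemma dirichlet (R : realType) (t : R) (Q : nat) : (0 < Q)%N -> 0 <= t ->
  exists q a : nat, [/\ (0 < q <= Q)%N, coprime a q & `|t - a%:R / q%:R| * q%:R <= Q%:R^-1].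
Proof.
case: Q => // Q _ t0.
pose fr (k : nat) : R := k%:R * t - (Num.truncn (k%:R * t))%:R.
have frb k : 0 <= fr k < 1.
  have : 0 <= k%:R * t by rewrite mulr_ge0.
  by move/Num.Theory.truncn_itv; rewrite /fr -natr1 subr_ge0 ltrBlDl => /andP[-> /=]; rewrite addrC.
pose bin (k : 'I_Q.+2) : 'I_Q.+1 := inord (Num.truncn (Q.+1%:R * fr k)).
have binb (k : 'I_Q.+2) : (bin k)%:R <= Q.+1%:R * fr k < (bin k)%:R + 1.
  have /andP[f0 f1] := frb k.
  have h0 : 0 <= Q.+1%:R * fr k by rewrite mulr_ge0.
  have /andP[h1 h2] := Num.Theory.truncn_itv h0.
  rewrite inordK; first by rewrite h1 natr1.
  rewrite -(ltr_nat R); apply: le_lt_trans h1 _.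
  by rewrite gtr_pMr ?ltr0n.
have : ~~ injectiveb bin.
  apply/negP => /injectiveP /leq_card; by rewrite !card_ord ltnn.
move=> /injectivePn [k1 [k2 ne12 e12]].
wlog lt12 : k1 k2 ne12 e12 / (k1 < k2)%N.
  move=> W; move: (ne12); rewrite -val_eqE neq_ltn => /orP[h|h]; first exact: (W _ _ ne12 e12 h).
  by apply: (W k2 k1) => //; rewrite eq_sym.
set n1 := Num.truncn (k1%:R * t); set n2 := Num.truncn (k2%:R * t).
have le12 : (n1 <= n2)%N.
  apply: Num.Theory.le_truncn; by rewrite ler_wpM2r // ler_nat ltnW.
pose k := (k2 - k1)%N; pose n := (n2 - n1)%N.
have k0 : (0 < k)%N by rewrite subn_gt0.
have close : `|k%:R * t - n%:R| <= Q.+1%:R^-1.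
  have /andP[a1 a2] := binb k1; have /andP[b1 b2] := binb k2; rewrite -e12 in b1 b2.
  have -> : k%:R * t - n%:R = fr k2 - fr k1.
    by rewrite /fr -/n1 -/n2 !natrB // ?(ltnW lt12) //; ring.
  have Q0 : 0 < Q.+1%:R :> R by rewrite ltr0n.
  rewrite -[X in _ <= X]mul1r ler_pdivlMr // -[X in _ * X](ger0_norm (ltW Q0)) -normrM mulrBl.
  rewrite ler_norml; move: a1 a2 b1 b2; rewrite ![Q.+1%:R * _]mulrC.
  by move: (_ * _) (_ * _) (_%:R) => x y z; clear => *; apply/andP; split; lra.
pose g := gcdn n k.
have g0 : (0 < g)%N by rewrite gcdn_gt0 k0 orbT.
exists (k %/ g)%N, (n %/ g)%N.
have gk : (k %/ g * g = k)%N by rewrite divnK // dvdn_gcdr.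
have gn : (n %/ g * g = n)%N by rewrite divnK // dvdn_gcdl.
have q0 : (0 < k %/ g)%N by rewrite divn_gt0 // dvdn_leq // dvdn_gcdr.
split.
- rewrite q0 /= (leq_trans (leq_div _ _)) // (leq_trans (leq_subr _ _)) // -ltnS; exact: ltn_ord.
- by rewrite /coprime -(eqn_pmul2r g0) muln_gcdl gk gn mul1n.
have qR : 0 < (k %/ g)%:R :> R by rewrite ltr0n.
rewrite -[X in _ * X](gtr0_norm qR) -normrM mulrBl mulfVK ?gt_eqF //.
apply: le_trans close; have gR : 1 <= g%:R :> R by rewrite ler1n.
have -> : k%:R * t - n%:R = (t * (k %/ g)%:R - (n %/ g)%:R) * g%:R.
  by rewrite -{1}gk -{1}gn !natrM; ring.
rewrite normrM ler_peMr // ger0_norm //.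
Qed.

(* The exponents in the parameters leave a spare factor r, which absorbs divisor
   functions and logarithms. *)
Definition divisor_bound (R : realType) (B : nat) := [/\ (0 < B)%N,
  forall r m : nat, (0 < m < r ^ 400)%N -> (ndiv m <= B * r)%N,
  forall r q : nat, (q <= r ^ 404)%N -> harmonic_sum R q <= (B * r)%:R &
  forall q : nat, (0 < q)%N -> (ndiv q)%:R <= B%:R * kroot 40 q%:R :> R].

(** The 400-th power divisor bound turns [m < r^400] into a multiple of [r], and the 404-th root
    does the same for the harmonic sum up to [r^404]. *)
Lemma ex_divisor_bound (R : realType) : exists B, divisor_bound R B.
Proof.
have [C1 [C10 h1]] := ndiv_bound 400; have [C2 [C20 h2]] := ndiv_bound 40.
exists (C1 + C2 + 404)%N; split.
- by rewrite addn_gt0 orbT.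
- move=> r m /andP[m0 mr].
  apply: (@leq_trans (C1 * r)); last by rewrite leq_mul2r -addnA leq_addr orbT.
  rewrite -(@leq_exp2r _ _ 400) //; apply: leq_trans (h1 _ m0) _.
  rewrite expnMn leq_mul ?(ltnW mr) // -{1}[C1]expn1; exact: leq_pexp2l.
- move=> r q qr; apply: le_trans (harmonic_sum_kroot _ _ (isT : (0 < 404)%N)) _.
  rewrite natrM; apply: ler_pM => //; first exact: kroot_ge0.
    by rewrite ler_nat leq_addl.
  apply: kroot_le_exp => //; by rewrite -natrX ler_nat.
- move=> q q0; apply: (@le_trans _ _ (C2%:R * kroot 40 q%:R)); last first.
    by rewrite ler_wpM2r ?kroot_ge0 // ler_nat addnAC leq_addl.
  rewrite -(@ler_pXn2r _ 40) ?nnegrE ?mulr_ge0 ?kroot_ge0 //.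
  rewrite exprMn krootK // -natrX.
  apply: (@le_trans _ _ (C2 * q)%:R); first by rewrite ler_nat h2.
  rewrite natrM ler_wpM2r // -natrX ler_nat -{1}[C2]expn1; exact: leq_pexp2l.
Qed.

Section WeylPowers.
Variables (R : realType) (B : nat) (hB : divisor_bound R B).
Variables (r q a : nat) (al : R).
Hypotheses (r2 : (2 <= r)%N) (q0 : (0 < q)%N) (caq : coprime a q) (al0 : 0 <= al).
Local Notation be := (`|6 * al - a%:R / q%:R|).
Local Notation u := (@GRing.natmul R 1%R r).
Local Notation b := (@GRing.natmul R 1%R B).
Local Notation z := (kroot 40 (@GRing.natmul R 1%R q)).
Hypothesis approx : be * q%:R <= (r ^ 404)%:R^-1.

Let u1 : 1 <= u. Proof. by rewrite ler1n (leq_trans _ r2). Qed.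
Let b1 : 1 <= b. Proof. by rewrite ler1n; case: hB. Qed.
Let qR : 0 < q%:R :> R. Proof. by rewrite ltr0n. Qed.
Let q1 : 1 <= q%:R :> R. Proof. by rewrite ler1n. Qed.

Let powu i j : (i <= j)%N -> u ^+ i <= u ^+ j. Proof. by move=> ij; rewrite ler_weXn2l. Qed.
Let powu0 i : 0 < u ^+ i. Proof. by rewrite exprn_gt0 // (lt_le_trans ltr01). Qed.

Let ndivn i m : (i <= 200)%N -> (0 < m < (r ^ i) ^ 2)%N -> (ndiv m <= B * r)%N.
Proof.
case: hB => _ h _ _ i200 /andP[m0 mr]; apply: h; rewrite m0 (leq_trans mr) //.
by rewrite -expnM leq_pexp2l ?(leq_trans _ r2) // mulnC (leq_mul (leqnn 2) i200).
Qed.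

(** With [n = r^200], the window for [q] keeps both [n^3 / q] and [q] at most [r^404]. One factor
    [r] pays for the harmonic sum and one for the divisor function: 200 + 1 + 405 = 606. *)
Lemma weyl_minor_power th : (r ^ 196 <= q <= r ^ 404)%N ->
  cmod (weyl_sum (r ^ 200) th al) ^+ 4 <= 394 * b ^+ 2 * u ^+ 606.
Proof.
move=> /andP[qlo qhi]; case: (hB) => _ _ hh _.
have hyp : `|6 * al - a%:R / q%:R| <= q%:R ^- 2.
  have qq : q%:R <= (r ^ 404)%:R :> R by rewrite ler_nat.
  rewrite -(ler_pM2r qR) (le_trans approx) // exprSr invfM mulfVK ?gt_eqF // expr1.
  by rewrite lef_pV2 // posrE // (lt_le_trans qR).
apply: le_trans (@weyl_minor _ _ _ _ (B * r) th _ q0 caq al0 (fun m => @ndivn 200 m isT) hyp) _.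
have := hh _ _ qhi; have := harmonic_sum_ge0 R q; move: (harmonic_sum R q) => hs hs0 hs1.
rewrite !natrX !(natrM R B) in hs1 *.
have qu : q%:R <= u ^+ 404 by rewrite -natrX ler_nat.
have uq : u ^+ 196 <= q%:R by rewrite -natrX ler_nat.
set n := u ^+ 200.
have n0 : 0 < n by exact: powu0.
have E1 : (n ^+ 2 / q%:R + 1) * (8 * n + 4 * q%:R * hs) <= 24 * (b * u ^+ 405).
  have -> : (n ^+ 2 / q%:R + 1) * (8 * n + 4 * q%:R * hs) =
    8 * (n ^+ 3 / q%:R) + 4 * (n ^+ 2 * hs) + 8 * n + 4 * (q%:R * hs) by field; rewrite gt_eqF.
  have Z0 := powu0 405.
  have Zb : u ^+ 405 <= b * u ^+ 405 by rewrite ler_peMl // ltW.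
  have e1 : n ^+ 3 / q%:R <= u ^+ 405.
    rewrite ler_pdivrMr // -exprM; apply: (@le_trans _ _ (u ^+ 405 * u ^+ 196)).
      by rewrite -exprD powu.
    by rewrite ler_wpM2l // ltW.
  have e2 : n ^+ 2 * hs <= b * u ^+ 405.
    apply: (@le_trans _ _ (n ^+ 2 * (b * u))); first by rewrite ler_wpM2l // exprn_ge0 // ltW.
    rewrite mulrCA ler_wpM2l // -exprM -exprSr; exact: powu.
  have e3 : n <= u ^+ 405 by exact: powu.
  have e4 : q%:R * hs <= b * u ^+ 405.
    apply: (@le_trans _ _ (u ^+ 404 * (b * u))); first by rewrite ler_pM.
    by rewrite mulrCA ler_wpM2l // -exprSr.
  by move: Zb e1 e2 e3 e4; move: (u ^+ 405) (b * _) (_ / _) (_ * hs) (_ * hs) => *; lra.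
have E2 : 16 * n * (b * u * ((n ^+ 2 / q%:R + 1) * (8 * n + 4 * q%:R * hs))) <= 384 * b ^+ 2 * u ^+ 606.
  apply: (@le_trans _ _ (16 * n * (b * u * (24 * (b * u ^+ 405))))).
    by rewrite ler_wpM2l ?mulr_ge0 ?(ltW n0) // ler_wpM2l // mulr_ge0.
  have -> : 606%N = (200 + 1 + 405)%N by [].
  by rewrite !exprD expr1 -/n le_eqVlt; apply/orP; left; apply/eqP; move: (u ^+ 405) (n) => *; ring.
have E3 : n ^+ 3 <= b ^+ 2 * u ^+ 606.
  rewrite -exprM; apply: (@le_trans _ _ (u ^+ 606)); first exact: powu.
  by rewrite ler_peMl ?exprn_ege1 // ltW.
by move: E2 E3; rewrite -!(mulrA _ (b ^+ 2)); move: (b ^+ 2 * u ^+ 606) (n ^+ 3) (16 * n * _) => *; lra.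
Qed.

(** The range [r^404] of the Dirichlet denominators exceeds [(r^200)^2 = r^400], so the drift
    condition of [weyl_major] holds with room for the factor 2. *)
Let beq i : (i <= 200)%N -> be * (r ^ i)%:R ^+ 2 <= (2 * q%:R)^-1.
Proof.
move=> i200.
have h : be * (r ^ i)%:R ^+ 2 * q%:R <= 2^-1.
  rewrite mulrAC; apply: (@le_trans _ _ ((r ^ 404)%:R^-1 * u ^+ 400)).
    apply: ler_pM => //; [by rewrite mulr_ge0|exact: exprn_ge0|].
    by rewrite natrX -exprM powu // (leq_mul i200 (leqnn 2)).
  have -> : 404%N = (400 + 4)%N by [].
  rewrite natrX exprD invfM -mulrA [_ * u ^+ 400]mulrC mulrA mulVf ?gt_eqF // mul1r.
  rewrite lef_pV2 ?posrE //; apply: (@le_trans _ _ u); first by rewrite ler_nat.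
  by rewrite -{1}[u]expr1 powu.
by rewrite invfM -(ler_pM2r qR) mulfVK ?gt_eqF.
Qed.

Hypothesis qlo : (q <= r ^ 196)%N.
Let qu : q%:R <= u ^+ 196. Proof. by rewrite -natrX ler_nat. Qed.
Let nd0 : 1 <= (ndiv q)%:R :> R.
Proof. by rewrite ler1n lt0n size_eq0; apply/eqP => e; have := divisors_id q0; rewrite e. Qed.
Let z1 : 1 <= z. Proof. exact: kroot_ge1. Qed.
Let zK : z ^+ 40 = q%:R. Proof. by rewrite krootK. Qed.
Let ndz : (ndiv q)%:R / q%:R <= b / z ^+ 39.
Proof.
have z0 : 0 < z by rewrite (lt_le_trans ltr01).
have -> : (ndiv q)%:R / q%:R = (ndiv q)%:R / z / z ^+ 39 by rewrite -mulrA -invfM -exprS zK.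
rewrite ler_wpM2r ?invr_ge0 ?exprn_ge0 ?(ltW z0) //.
by rewrite ler_pdivrMr //; case: hB => _ _ _ h; exact: h.
Qed.
Let hsu : harmonic_sum R q <= b * u.
Proof. 
case: (hB) => _ _ hh _; rewrite -natrM hh // (leq_trans qlo) // leq_pexp2l ?(leq_trans _ r2) //.
Qed.

(** The peak has to swallow the remaining terms. For [q <= r^196] the approximation gives
    [q rho^3 <= r^198], so the peak is at least [n^4 / r^198 = r^602], which matches the error
    exponent 200 + 1 + 401. The constants add up to 650 = 10 + 512 + 128. *)
Lemma weyl_major_top th :
  cmod (weyl_sum (r ^ 200) th al) ^+ 4 <=
  650 * b ^+ 3 * (u ^+ 200) ^+ 4 / (z ^+ 39 * kroot 4 (1 + (u ^+ 200) ^+ 3 * be) ^+ 3).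
Proof.
apply: le_trans (@weyl_major _ _ _ _ (B * r) th _ q0 caq al0 (fun m => @ndivn 200 m isT) (@beq 200 isT)) _.
have := hsu; have := harmonic_sum_ge0 R q; move: (harmonic_sum R q) => hs hs0 hs1.
rewrite !natrX (natrM R B); set n := u ^+ 200; set rho := kroot 4 _; set nd := (ndiv q)%:R / q%:R.
have n0 : 0 < n by exact: powu0.
have J1 : 1 <= 1 + n ^+ 3 * be by rewrite lerDl mulr_ge0 ?exprn_ge0 ?(ltW n0).
have rho1 : 1 <= rho by exact: kroot_ge1.
have rho0 : 0 < rho by rewrite (lt_le_trans ltr01).
have ndq : q%:R^-1 <= nd by rewrite /nd -[X in X <= _]mul1r ler_wpM2r // invr_ge0.
have nd00 : 0 <= nd by rewrite (le_trans _ ndq) // invr_ge0.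
have rhoJ : rho ^+ 3 <= 1 + n ^+ 3 * be.
  have <- : rho ^+ 4 = 1 + n ^+ 3 * be by rewrite krootK // (le_trans ler01).
  by rewrite ler_weXn2l.
have qJ : q%:R * rho ^+ 3 <= u ^+ 198.
  apply: (@le_trans _ _ (q%:R * (1 + n ^+ 3 * be))); first by rewrite ler_wpM2l // ltW.
  rewrite mulrDr mulr1 mulrCA mulrA -mulrA [q%:R * be]mulrC.
  have h : n ^+ 3 * (be * q%:R) <= u ^+ 196.
    apply: (@le_trans _ _ (n ^+ 3 * (r ^ 404)%:R^-1)); first by rewrite ler_wpM2l // exprn_ge0 // ltW.
    rewrite natrX ler_pdivrMr // -exprM -exprD; exact: powu.
  have -> : 198%N = (196 + 1 + 1)%N by []; rewrite !exprD expr1.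
  have uu : 2 <= u by rewrite ler_nat.
  apply: (le_trans (lerD qu h)); rewrite -mulr2n -mulr_natr -mulrA.
  apply: ler_wpM2l; first exact: ltW (powu0 196).
  by rewrite -[X in X <= _]mulr1 ler_pM.
set W := n ^+ 4 * (nd / rho ^+ 3).
have Wlow : u ^+ 602 <= W.
  apply: (@le_trans _ _ (n ^+ 4 * (q%:R * rho ^+ 3)^-1)).
    rewrite ler_pdivlMr ?mulr_gt0 ?exprn_gt0 //.
    apply: (@le_trans _ _ (u ^+ 602 * u ^+ 198)); first by rewrite ler_wpM2l // ltW.
    by rewrite -exprD -exprM.
  by rewrite /W ler_wpM2l ?exprn_ge0 ?(ltW n0) // invfM ler_wpM2r // invr_ge0 exprn_ge0 // ltW.
have E1 : (n ^+ 2 / q%:R + 1) * (4 * q%:R * hs) <= 8 * (b * u ^+ 401).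
  have -> : (n ^+ 2 / q%:R + 1) * (4 * q%:R * hs) = 4 * (n ^+ 2 * hs) + 4 * (q%:R * hs).
    by field; rewrite gt_eqF.
  have e2 : n ^+ 2 * hs <= b * u ^+ 401.
    apply: (@le_trans _ _ (n ^+ 2 * (b * u))); first by rewrite ler_wpM2l // exprn_ge0 // ltW.
    by rewrite mulrCA ler_wpM2l // -exprM -exprSr powu.
  have e4 : q%:R * hs <= b * u ^+ 401.
    apply: (@le_trans _ _ (u ^+ 196 * (b * u))); first by rewrite ler_pM // ltW.
    by rewrite mulrCA ler_wpM2l // -exprSr powu.
  by move: e2 e4; move: (b * _) (_ * hs) (_ * hs) => *; lra.
have E2 : 16 * n * (b * u * ((n ^+ 2 / q%:R + 1) * (4 * q%:R * hs))) <= 128 * (b ^+ 2 * u ^+ 602).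
  apply: (@le_trans _ _ (16 * n * (b * u * (8 * (b * u ^+ 401))))).
    by rewrite ler_wpM2l ?mulr_ge0 ?(ltW n0) // ler_wpM2l // mulr_ge0.
  have -> : 602%N = (200 + 1 + 401)%N by [].
  by rewrite !exprD expr1 -/n le_eqVlt; apply/orP; left; apply/eqP; move: (u ^+ 401) (n) => *; ring.
have E3 : n ^+ 3 <= u ^+ 602 by rewrite -exprM powu.
have W0 : 0 <= W by rewrite (le_trans _ Wlow) // ltW.
have bb : 1 <= b ^+ 2 by rewrite exprn_ege1.
have E4 : b ^+ 2 * u ^+ 602 <= b ^+ 2 * W by rewrite ler_wpM2l // (le_trans ler01).
have E5 : W <= b ^+ 2 * W by rewrite ler_peMl.
apply: (@le_trans _ _ (650 * (b ^+ 2 * W))).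
  have -> : 10 * n ^+ 3 + 16 * n * (32 * n ^+ 3 * nd / rho ^+ 3 + b * u * ((n ^+ 2 / q%:R + 1) * (4 * q%:R * hs))) =
   10 * n ^+ 3 + 512 * W + 16 * n * (b * u * ((n ^+ 2 / q%:R + 1) * (4 * q%:R * hs))).
    rewrite /W; move: (_ * (4 * _ * _)) => y; field; by rewrite gt_eqF.
  move: E2 E3 E4 E5 Wlow W0; move: (u ^+ 602) (b ^+ 2 * W) (b ^+ 2 * u ^+ 602) (n ^+ 3) (16 * n * _) => *; lra.
have -> : 650 * b ^+ 3 * n ^+ 4 / (z ^+ 39 * rho ^+ 3) =
  650 * (b ^+ 2 * (n ^+ 4 * (b / z ^+ 39 / rho ^+ 3))).
  by field; rewrite !gt_eqF // (lt_le_trans ltr01).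
have P0 : 0 <= b ^+ 2 by rewrite (le_trans ler01).
rewrite ler_wpM2l // ler_wpM2l // ler_wpM2l ?exprn_ge0 ?(ltW n0) //.
by rewrite ler_wpM2r // invr_ge0 exprn_ge0 // ltW.
Qed.

(** The error now has size [r^482 = Y^4 / r^158], while [q] may reach [r^196]. The saving is
    therefore weakened to [z^32 = q^(4/5) <= r^158], and no decay in the distance to [a/q] is
    kept. *)
Lemma weyl_major_low th :
  cmod (weyl_sum (r ^ 160) th al) ^+ 4 <= 650 * b ^+ 2 * (u ^+ 160) ^+ 4 / z ^+ 32.
Proof.
apply: le_trans (@weyl_major _ _ _ _ (B * r) th _ q0 caq al0 (fun m => @ndivn 160 m isT) (@beq 160 isT)) _.
have := hsu; have := harmonic_sum_ge0 R q; move: (harmonic_sum R q) => hs hs0 hs1.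
rewrite !natrX (natrM R B); set n := u ^+ 160; set rho := kroot 4 _; set nd := (ndiv q)%:R / q%:R.
have n0 : 0 < n by exact: powu0.
have J1 : 1 <= 1 + n ^+ 3 * be by rewrite lerDl mulr_ge0 ?exprn_ge0 ?(ltW n0).
have rho1 : 1 <= rho by exact: kroot_ge1.
have rho0 : 0 < rho by rewrite (lt_le_trans ltr01).
have z0 : 0 < z by rewrite (lt_le_trans ltr01).
have nd00 : 0 <= nd by rewrite /nd divr_ge0 // ltW.
set W := n ^+ 4 / z ^+ 32.
have W0 : 0 <= W by rewrite /W divr_ge0 // exprn_ge0 // ltW.
have zu : z ^+ 32 <= u ^+ 158.
  rewrite -(@ler_pXn2r _ 40) ?nnegrE ?exprn_ge0 ?(ltW z0) ?(le_trans ler01 u1) //.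
  rewrite exprAC zK; apply: (@le_trans _ _ ((u ^+ 196) ^+ 32)).
    by rewrite lerXn2r ?nnegrE // ?ltW.
  by rewrite -!exprM powu.
have Wlow : u ^+ 482 <= W.
  rewrite ler_pdivlMr ?exprn_gt0 //.
  apply: (@le_trans _ _ (u ^+ 482 * u ^+ 158)); first by rewrite ler_wpM2l // ltW.
  by rewrite -exprD -exprM.
have E1 : (n ^+ 2 / q%:R + 1) * (4 * q%:R * hs) <= 8 * (b * u ^+ 321).
  have -> : (n ^+ 2 / q%:R + 1) * (4 * q%:R * hs) = 4 * (n ^+ 2 * hs) + 4 * (q%:R * hs).
    by field; rewrite gt_eqF.
  have e2 : n ^+ 2 * hs <= b * u ^+ 321.
    apply: (@le_trans _ _ (n ^+ 2 * (b * u))); first by rewrite ler_wpM2l // exprn_ge0 // ltW.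
    by rewrite mulrCA ler_wpM2l // -exprM -exprSr powu.
  have e4 : q%:R * hs <= b * u ^+ 321.
    apply: (@le_trans _ _ (u ^+ 196 * (b * u))); first by rewrite ler_pM // ltW.
    by rewrite mulrCA ler_wpM2l // -exprSr powu.
  by move: e2 e4; move: (b * _) (_ * hs) (_ * hs) => *; lra.
have E2 : 16 * n * (b * u * ((n ^+ 2 / q%:R + 1) * (4 * q%:R * hs))) <= 128 * (b ^+ 2 * u ^+ 482).
  apply: (@le_trans _ _ (16 * n * (b * u * (8 * (b * u ^+ 321))))).
    by rewrite ler_wpM2l ?mulr_ge0 ?(ltW n0) // ler_wpM2l // mulr_ge0.
  have -> : 482%N = (160 + 1 + 321)%N by [].
  by rewrite !exprD expr1 -/n le_eqVlt; apply/orP; left; apply/eqP; move: (u ^+ 321) (n) => *; ring.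
have E3 : n ^+ 3 <= u ^+ 482 by rewrite -exprM powu.
have bb : 1 <= b ^+ 2 by rewrite exprn_ege1.
have bb' : b <= b ^+ 2 by rewrite expr2 ler_peMl.
have E4 : b ^+ 2 * u ^+ 482 <= b ^+ 2 * W by rewrite ler_wpM2l // (le_trans ler01).
have E5 : W <= b ^+ 2 * W by rewrite ler_peMl.
have E6 : n ^+ 4 * (nd / rho ^+ 3) <= b ^+ 2 * W.
  have -> : b ^+ 2 * W = n ^+ 4 * (b ^+ 2 / z ^+ 32) by rewrite /W mulrCA.
  apply: ler_wpM2l; first by rewrite exprn_ge0 // ltW.
  apply: (@le_trans _ _ (b / z ^+ 39)).
    apply: (le_trans _ ndz); rewrite ler_pdivrMr ?exprn_gt0 // ler_peMr // exprn_ege1 //.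
  apply: ler_pM => //; first by rewrite invr_ge0 exprn_ge0 // ltW.
  by rewrite lef_pV2 ?posrE ?exprn_gt0 // ler_weXn2l.
have -> : 650 * b ^+ 2 * n ^+ 4 / z ^+ 32 = 650 * (b ^+ 2 * W) by rewrite /W; ring.
have -> : 10 * n ^+ 3 + 16 * n * (32 * n ^+ 3 * nd / rho ^+ 3 + b * u * ((n ^+ 2 / q%:R + 1) * (4 * q%:R * hs))) =
   10 * n ^+ 3 + 512 * (n ^+ 4 * (nd / rho ^+ 3)) + 16 * n * (b * u * ((n ^+ 2 / q%:R + 1) * (4 * q%:R * hs))).
  move: (_ * (4 * _ * _)) => y; field; by rewrite gt_eqF.
move: E2 E3 E4 E5 E6 Wlow W0; move: (u ^+ 482) (b ^+ 2 * W) (b ^+ 2 * u ^+ 482) (n ^+ 3) (n ^+ 4 * _) (16 * n * _) => *; lra.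
Qed.

End WeylPowers.

(** * Summing the major arc bounds over the arcs *)

Lemma card_window (R : realType) (n L : nat) (x : R) :
  (#|[pred j : 'I_n | ((x <= j%:R) && (j%:R < x + L%:R))%R]| <= L.+1)%N.
Proof.
set A := [pred j : 'I_n | _].
have [j0 Aj0|A0] := pickP A; last by rewrite eq_card0.
pose m := [arg min_(j < j0 | A j) (j : nat)].
have [Am minm] : A m /\ forall j, A j -> (m <= j)%N by rewrite /m; case: arg_minnP.
have bnd j : A j -> (j - m < L.+1)%N.
  move=> Aj; move: (Aj) (Am) => /andP[_ h1] /andP[h2 _].
  rewrite ltnS leq_subLR -(ler_nat R) natrD; move: h1 h2; clear; lra.
pose f (j : 'I_n) : 'I_L.+1 := inord (j - m).
have inj : {in A &, injective f}.
  move=> i j Ai Aj /(congr1 val) /=; rewrite !inordK ?bnd // => e.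
  apply/val_inj => /=; move: e (minm _ Ai) (minm _ Aj); clear; lia.
by have := @leq_card_in _ _ f A inj; rewrite card_ord.
Qed.

(** [3/500] is [6 P^3 / N], the step of [6 P^3 (j / N)]. The condition allows one unit window on
    either side of [c], and each contains at most 169 values of [j]. *)
Lemma card_dist_window (R : realType) (n l : nat) (c : R) :
  (#|[pred j : 'I_n | ((l%:R <= `|3 / 500 * j%:R - c|) && (`|3 / 500 * j%:R - c| < l%:R + 1))%R]| <= 400)%N.
Proof.
set A := [pred j : 'I_n | _].
pose w (x : R) := [pred j : 'I_n | (x <= j%:R) && (j%:R < x + 168%:R)].
have sub : {subset A <= [predU w (500 / 3 * (c + l%:R)) & w (500 / 3 * (c - l%:R) - 167)]}.
  move=> j /andP[h1 h2]; rewrite !inE /w /=.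
  have [h|h] := leP 0 (3 / 500 * j%:R - c).
    rewrite ger0_norm // in h1 h2; apply/orP; left.
    by apply/andP; move: h1 h2; clear; split; lra.
  rewrite ltr0_norm // in h1 h2; apply/orP; right.
  by apply/andP; move: h1 h2; clear; split; lra.
apply: (leq_trans (subset_leq_card (introT (fintype.subsetP) sub))).
apply: (@leq_trans (#|w (500 / 3 * (c + l%:R))| + #|w (500 / 3 * (c - l%:R) - 167)|)).
  by rewrite -cardUI leq_addr.
exact: (@leq_trans (169 + 169) _ 400 (leq_add (card_window _ _ _) (card_window _ _ _)) isT).
Qed.

Lemma fiber_sum_le (R : realType) (I J : finType) (key : I -> J) (S : pred I)
    (g : I -> R) (w : J -> R) (K : J -> nat) :
  (forall j, 0 <= w j) -> (forall i, S i -> g i <= w (key i)) ->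
  (forall j, (#|[pred i | S i & key i == j]| <= K j)%N) ->
  \sum_(i | S i) g i <= \sum_j (K j)%:R * w j.
Proof.
move=> w0 gw cK; rewrite (partition_big key predT) //=.
apply: ler_sum => j _.
apply: (@le_trans _ _ (\sum_(i | S i && (key i == j)) w j)).
  by apply: ler_sum => i /andP[Si /eqP <-]; apply: gw.
rewrite sumr_const -[X in X <= _]mulr_natl ler_wpM2r // ler_nat.
by apply: leq_trans (cK j); rewrite eq_leq.
Qed.

Section SingularTail.
Variables (R : realType) (I : finType) (S : pred I) (q l : I -> nat) (K D : nat).
Hypotheses (q0 : forall i, S i -> (0 < q i)%N) (D0 : (0 < D)%N).
Hypothesis fib : forall q0 l0 : nat,
  (#|[pred i | S i & (q i == q0) && (l i == l0)]| <= K * q0)%N.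

(* For l the integer part of P^3 |beta|, this bounds the product of the nine Weyl sums
   on the major arc at a/q, up to a constant times P^7 Y^2. *)
Definition singular_weight (q l : nat) : R :=
  (q%:R ^+ 2 * kroot 40 q%:R * (l.+1%:R * kroot 4 l.+1%:R))^-1.

Let x (k : nat) : R := (k.+1%:R * kroot 40 k.+1%:R)^-1.
Let y (k : nat) : R := (k.+1%:R * kroot 4 k.+1%:R)^-1.
Let x0 k : 0 <= x k. Proof. by rewrite invr_ge0 mulr_ge0 ?kroot_ge0. Qed.
Let y0 k : 0 <= y k. Proof. by rewrite invr_ge0 mulr_ge0 ?kroot_ge0. Qed.

Let n := (D + \max_i q i + \max_i l i).+1.
Let qn i : ((q i).-1 < n)%N.
Proof.
rewrite ltnS (leq_trans (leq_pred _)) // (leq_trans (@leq_bigmax _ q i)) //.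
by rewrite addnAC leq_addl.
Qed.
Let ln i : (l i < n)%N.
Proof. by rewrite ltnS (leq_trans (@leq_bigmax _ l i)) // leq_addl. Qed.

Let key i : 'I_n * 'I_n := (Ordinal (qn i), Ordinal (ln i)).

Let fibkey k : (#|[pred i | S i & key i == k]| <= K * k.1.+1)%N.
Proof.
apply: leq_trans (fib k.1.+1 k.2); apply: subset_leq_card; apply/fintype.subsetP => i.
rewrite !inE => /andP[Si /eqP <-] /=; rewrite Si /= !eqxx prednK ?eqxx //; exact: q0.
Qed.

Let sum_all (a : nat -> R) (c C : R) (m : nat) : (forall k, 0 <= a k) -> a 0%N <= c ->
  (forall m', (1 <= m')%N -> \sum_(1 <= k < m') a k <= C) -> \sum_(k < m.+1) a k <= c + C.
Proof.
move=> a0 ac h; rewrite -(big_mkord xpredT a) big_ltn // lerD //; exact: h.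
Qed.

Let kroot1 k : kroot k (1 : R) = 1. Proof. by rewrite /kroot powR1. Qed.

Let sumx : \sum_(k < n) x k <= 41.
Proof.
have -> : 41 = 1 + 40 :> R by ring.
apply: sum_all => //; first by rewrite /x kroot1 mulr1 invr1.
move=> m hm; apply: le_trans (@sum_inv_kroot R 40 1 m isT isT hm) _.
by rewrite kroot1 invr1 mulr1.
Qed.

Let sumy : \sum_(k < n) y k <= 5.
Proof.
have -> : 5 = 1 + 4 :> R by ring.
apply: sum_all => //; first by rewrite /y kroot1 mulr1 invr1.
move=> m hm; apply: le_trans (@sum_inv_kroot R 4 1 m isT isT hm) _.
by rewrite kroot1 invr1 mulr1.
Qed.

Let Dn : (D <= n)%N. Proof. by rewrite /n -addnA -addnS leq_addr. Qed.

Let tail (a : nat -> R) : \sum_(k < n | (D <= k)%N) a k = \sum_(D <= k < n) a k.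
Proof.
by rewrite big_geq_mkord.
Qed.

(** The at most [K q] indices sharing [q] and [l] use up one power of [q], which leaves the
    convergent double sum of [q^(-1 - 1/40) (l + 1)^(-5/4)]. Either variable beyond [D] yields a
    factor at most a constant times [D^(-1/40)], and 40 * 5 + 41 * 4 <= 400. *)
Lemma singular_tail : (forall i, S i -> (D < q i)%N || (D <= l i)%N) ->
  \sum_(i | S i) singular_weight (q i) (l i) <= 400 * K%:R / kroot 40 D%:R.
Proof.
move=> SD.
pose w (k : 'I_n * 'I_n) : R :=
  if (D <= k.1)%N || (D <= k.2)%N then singular_weight k.1.+1 k.2 else 0.
have sw0 a b : 0 <= singular_weight a b.
  by rewrite invr_ge0 !mulr_ge0 ?kroot_ge0 ?exprn_ge0.
apply: (@le_trans _ _ (\sum_(k : 'I_n * 'I_n) (K * k.1.+1)%:R * w k)).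
  apply: (fiber_sum_le (key := key) (K := fun k => (K * k.1.+1)%N)) => //; first by move=> k; rewrite /w; case: ifP.
  move=> i Si; rewrite /w /= -ltnS prednK ?q0 // SD // .
have D1 : 1 <= D%:R :> R by rewrite ler1n.
have kD0 : 0 < kroot 40 D%:R :> R by rewrite kroot_gt0 // ltr0n.
have tx : \sum_(k < n | (D <= k)%N) x k <= 40 / kroot 40 D%:R.
  by rewrite tail; apply: sum_inv_kroot.
have ty : \sum_(k < n | (D <= k)%N) y k <= 4 / kroot 40 D%:R.
  rewrite tail; apply: le_trans (sum_inv_kroot _ _ _ _) _ => //.
  rewrite ler_wpM2l // lef_pV2 ?posrE ?kroot_gt0 ?ltr0n //.
  apply: kroot_le_exp => //; first exact: kroot_ge0.
  have -> : 40%N = (4 * 10)%N by []; rewrite exprM krootK //.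
  by rewrite -{1}[D%:R]expr1 ler_weXn2l.
apply: (@le_trans _ _ (\sum_(k : 'I_n * 'I_n) K%:R * ((if (D <= k.1)%N then x k.1 * y k.2 else 0) +
    (if (D <= k.2)%N then x k.1 * y k.2 else 0)))).
  apply: ler_sum => k _; rewrite natrM -mulrA ler_wpM2l // /w.
  have xy0 : 0 <= x k.1 * y k.2 by rewrite mulr_ge0.
  have e : k.1.+1%:R * singular_weight k.1.+1 k.2 = x k.1 * y k.2.
    rewrite /singular_weight /x /y; field; by rewrite !gt_eqF ?kroot_gt0 ?ltr0n // nat1r ltr0n.
  case: (D <= k.1)%N => /=; first by rewrite e lerDl; case: ifP.
  by case: (D <= k.2)%N; rewrite ?mulr0 ?e ?add0r.
rewrite -mulr_sumr [400 * _]mulrC -mulrA ler_wpM2l // big_split /=.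
have -> : \sum_(k : 'I_n * 'I_n) (if (D <= k.1)%N then x k.1 * y k.2 else 0) =
   (\sum_(k < n | (D <= k)%N) x k) * (\sum_(k < n) y k).
  by rewrite -big_mkcond /= big_distrlr /= pair_big /=; apply: eq_bigl => k; rewrite andbT.
have -> : \sum_(k : 'I_n * 'I_n) (if (D <= k.2)%N then x k.1 * y k.2 else 0) =
   (\sum_(k < n) x k) * (\sum_(k < n | (D <= k)%N) y k).
  by rewrite -big_mkcond /= big_distrlr /= pair_big /=; apply: eq_bigl => k.
have v0 : 0 <= (kroot 40 D%:R)^-1 :> R by rewrite invr_ge0 ltW.
apply: (@le_trans _ _ (40 / kroot 40 D%:R * 5 + 41 * (4 / kroot 40 D%:R))).
  apply: lerD; apply: ler_pM => //; exact: sumr_ge0.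
by move: v0; move: (_^-1) => v v0; lra.
Qed.

Lemma card_singular_small (S' : pred I) : (forall i, S' i -> [&& S i, (q i <= D)%N & (l i < D)%N]) ->
  (#|S'| <= K * D ^ 3)%N.
Proof.
move=> hS.
have [->|[i0 Si0]] : #|S'| = 0%N \/ exists i, S' i.
  have [i Si|h] := pickP S'; [by right; exists i|by left; rewrite eq_card0].
  by [].
have D0' := D0.
pose kk i : 'I_D * 'I_D := (insubd (Ordinal D0) (q i).-1, insubd (Ordinal D0) (l i)).
have ckk k : (#|[pred i | S' i & kk i == k]| <= K * D)%N.
  apply: (@leq_trans (K * k.1.+1)); last by rewrite leq_mul2l ltn_ord orbT.
  apply: leq_trans (fib k.1.+1 k.2); apply: subset_leq_card; apply/fintype.subsetP => i.
  rewrite !inE => /andP[/hS /and3P[Si qi li] /eqP <-] /=; rewrite Si /=.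
  have qi' : ((q i).-1 < D)%N by rewrite prednK // q0.
  by rewrite !val_insubd li qi' prednK ?q0 // !eqxx.
have : \sum_(i | S' i) (1 : R) <= \sum_(k : 'I_D * 'I_D) (K * D)%:R * 1.
  exact: (fiber_sum_le _ _ ckk).
rewrite !sumr_const card_prod !card_ord -[_ *+ (D * D)]mulr_natl mulr1 -natrM ler_nat => h.
by apply: leq_trans h _; rewrite !expnS expn0 muln1 mulnCA leq_mul2l mulnC !mulnA leqnn orbT.
Qed.

End SingularTail.

Lemma prod_exp_le (R : realType) k m (f : 'I_k -> R) (A : R) :
  (forall i, 0 <= f i) -> (forall i, f i ^+ m <= A) -> (\prod_(i < k) f i) ^+ m <= A ^+ k.
Proof.
move=> f0 fA; rewrite -prodrXl.
apply: (@le_trans _ _ (\prod_(i < k) A)); last by rewrite prodr_const card_ord.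
by apply: ler_prod => i _; rewrite exprn_ge0 //= fA.
Qed.

Definition cube_product (R : realType) (r : nat) (th : 'I_6 -> R) (t7 p1 p2 al : R) : complex R :=
  ((\prod_(i < 6) weyl_sum (r ^ 200) (th i) al) * weyl_sum (r ^ 200) t7 al) *
  (weyl_sum (r ^ 160) p1 al * weyl_sum (r ^ 160) p2 al).

(** * The product of the nine sums on minor and major arcs *)

Section Arcs.
Variables (R : realType) (B : nat) (hB : divisor_bound R B).
Variables (c : R) (hc : 650 * B%:R ^+ 3 <= c).
Variables (r : nat) (th : 'I_6 -> R) (t7 p1 p2 al : R).
Hypotheses (r2 : (2 <= r)%N) (al0 : 0 <= al).
Local Notation u := (@GRing.natmul R 1%R r).
Local Notation b := (@GRing.natmul R 1%R B).
Local Notation P := (r ^ 200)%N.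
Local Notation Y := (r ^ 160)%N.
Local Notation be q a := (`|6 * al - a%:R / q%:R|).

Let u1 : 1 <= u. Proof. by rewrite ler1n (leq_trans _ r2). Qed.
Let u0 : 0 < u. Proof. exact: lt_le_trans u1. Qed.
Let b1 : 1 <= (@GRing.natmul R 1%R B). Proof. by rewrite ler1n; case: hB. Qed.
Let b3 : 1 <= b ^+ 3. Proof. by rewrite exprn_ege1. Qed.
Let c1 : 1 <= c. Proof. by move: hc b3; move: (b ^+ 3) => x h1 h2; lra. Qed.
Let c0 : 0 < c. Proof. exact: lt_le_trans c1. Qed.

(** Five long sums are set aside for Weyl's inequality; each of the two others is paired with a
    short one for the mean square. *)
Lemma cmod_cube_product :
  cmod (cube_product r th t7 p1 p2 al) =
  (\prod_(i < 5) cmod (weyl_sum P (th (widen_ord (leqnSn 5) i)) al)) *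
  (cmod (weyl_sum P (th ord_max) al * weyl_sum Y p1 al) * cmod (weyl_sum P t7 al * weyl_sum Y p2 al)).
Proof. by rewrite /cube_product !cmodM cmod_prod big_ord_recr /=; ring. Qed.

(** 5 * 606 / 4 = 757.5 is rounded up to 758; the generous [c^9] agrees with the major arcs. *)
Lemma minor_product q a : (0 < q)%N -> coprime a q -> be q a * q%:R <= (r ^ 404)%:R^-1 ->
  (r ^ 196 <= q <= r ^ 404)%N ->
  \prod_(i < 5) cmod (weyl_sum P (th (widen_ord (leqnSn 5) i)) al) <= c ^+ 9 * u ^+ 758.
Proof.
move=> q0 caq ap hq.
have h i : cmod (weyl_sum P (th (widen_ord (leqnSn 5) i)) al) ^+ 4 <= c * u ^+ 606.
  apply: le_trans (weyl_minor_power hB r2 q0 caq al0 ap (th (widen_ord (leqnSn 5) i)) hq) _.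
  rewrite ler_wpM2r ?exprn_ge0 ?(ltW u0) //; apply: le_trans hc.
  have h1 : b ^+ 2 <= b ^+ 3 by rewrite ler_weXn2l.
  have h2 : 0 <= b ^+ 2 by rewrite exprn_ge0.
  by move: h1 h2; move: (b ^+ 2) (b ^+ 3) => x y h1 h2; lra.
have := prod_exp_le (fun i => cmod_ge0 _) h; set p := \prod_(i < 5) _ => hp.
have p0 : 0 <= p by apply: prodr_ge0 => i _; exact: cmod_ge0.
have U0 k : 0 <= u ^+ k by rewrite exprn_ge0 // ltW.
have C0 k : 0 <= c ^+ k by rewrite exprn_ge0 // ltW.
have X0 : 0 <= c ^+ 9 * u ^+ 758 by exact: mulr_ge0.
rewrite -(@ler_pXn2r _ 4 isT _ _ p0 X0); apply: le_trans hp _.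
rewrite (exprMn 5 c) (exprMn 4 (c ^+ 9)).
apply: ler_pM; [exact: C0|by rewrite -exprM; exact: U0|by rewrite -exprM ler_weXn2l|].
by rewrite -!exprM ler_weXn2l.
Qed.

(** With [z = q^(1/40)] and [rho] the fourth root of [1 + P^3 |beta|], the seven long sums save
    [z^(273/4) rho^(21/4)], weakened to [z^65 rho^5], and each short one saves [z^8]. In all this is
    [z^81 = q^(2 + 1/40)], just enough for convergence after summation over the numerators. *)
Lemma major_product q a : (0 < q)%N -> coprime a q -> be q a * q%:R <= (r ^ 404)%:R^-1 ->
  (q <= r ^ 196)%N ->
  cmod (cube_product r th t7 p1 p2 al) <=
  c ^+ 9 * (P%:R ^+ 7 * Y%:R ^+ 2) * singular_weight R q (Num.truncn (P%:R ^+ 3 * be q a)).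
Proof.
move=> q0 caq ap hq.
have top t := weyl_major_top hB r2 q0 caq al0 ap hq t.
have low t := weyl_major_low hB r2 q0 caq al0 ap hq t.
rewrite !natrX; rewrite /cube_product !cmodM cmod_prod.
set n := u ^+ 200 in top *; set m := u ^+ 160 in low *.
set J := 1 + n ^+ 3 * _ in top.
set rho := kroot 4 J in top; set z := kroot 40 _ in top low.
have n0 : 0 < n by rewrite exprn_gt0.
have m0 : 0 < m by rewrite exprn_gt0.
clearbody n m.
have q1 : 1 <= q%:R :> R by rewrite ler1n.
have z1 : 1 <= z by exact: kroot_ge1.
have nb0 : 0 <= n ^+ 3 * be q a by rewrite mulr_ge0 ?exprn_ge0 // ltW.
have J1 : 1 <= J by rewrite lerDl.
have rho1 : 1 <= rho by exact: kroot_ge1.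
have z0 : 0 < z by exact: lt_le_trans z1.
have rho0 : 0 < rho by exact: lt_le_trans rho1.
have zK : z ^+ 40 = q%:R by rewrite krootK.
have rhoK : rho ^+ 4 = J by rewrite krootK // (le_trans ler01).
have Z0 k : 0 <= z ^+ k by rewrite exprn_ge0 // ltW.
have Rh0 k : 0 <= rho ^+ k by rewrite exprn_ge0 // ltW.
have C0 k : 0 <= c ^+ k by rewrite exprn_ge0 // ltW.
have N0 k : 0 <= n ^+ k by rewrite exprn_ge0 // ltW.
have lowb t : cmod (weyl_sum Y t al) <= c * m / z ^+ 8.
  have X0 : 0 <= c * m / z ^+ 8 by rewrite divr_ge0 ?Z0 // mulr_ge0 ?(ltW c0) ?(ltW m0).
  rewrite -(@ler_pXn2r _ 4 isT _ _ (cmod_ge0 _) X0).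
  apply: le_trans (low t) _; rewrite (expr_div_n (c * m)) (exprMn 4 c) -[(z ^+ 8) ^+ 4]exprM.
  apply: ler_wpM2r; first by rewrite invr_ge0 Z0.
  apply: ler_wpM2r; first by rewrite exprn_ge0 // ltW.
  apply: (@le_trans _ _ c); last by rewrite -[X in X <= _]expr1 ler_weXn2l.
  apply: le_trans hc; have h1 : b ^+ 2 <= b ^+ 3 by rewrite ler_weXn2l.
  by rewrite ler_wpM2l.
pose A := c * n ^+ 4 / (z ^+ 39 * rho ^+ 3).
have topA t : cmod (weyl_sum P t al) ^+ 4 <= A.
  apply: le_trans (top t) _; apply: ler_wpM2r; first by rewrite invr_ge0 mulr_ge0.
  exact: ler_wpM2r.
set Pi := \prod_(i < 6) _.
have Pi0 : 0 <= Pi by apply: prodr_ge0 => i _; exact: cmod_ge0.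
have topb : Pi * cmod (weyl_sum P t7 al) <= c ^+ 7 * n ^+ 7 / (z ^+ 65 * rho ^+ 5).
  have X0 : 0 <= Pi * cmod (weyl_sum P t7 al) by rewrite mulr_ge0 // cmod_ge0.
  have X1 : 0 <= c ^+ 7 * n ^+ 7 / (z ^+ 65 * rho ^+ 5) by rewrite divr_ge0 // mulr_ge0.
  rewrite -(@ler_pXn2r _ 4 isT _ _ X0 X1).
  apply: (@le_trans _ _ (A ^+ 7)).
    rewrite (exprMn 4 Pi) (exprSr A 6); apply: ler_pM; [exact: exprn_ge0| |apply: prod_exp_le => // i; exact: cmod_ge0|exact: topA].
    exact: exprn_ge0 (cmod_ge0 _).
  rewrite /A (expr_div_n (c * n ^+ 4)) (expr_div_n (c ^+ 7 * n ^+ 7)) (exprMn 7 c) (exprMn 7 (z ^+ 39)).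
  rewrite (exprMn 4 (c ^+ 7)) (exprMn 4 (z ^+ 65)) -!exprM.
  apply: ler_pM; [by apply: mulr_ge0; [exact: C0|exact: N0]|by rewrite invr_ge0; apply: mulr_ge0; [exact: Z0|exact: Rh0]| |].
    apply: ler_wpM2r; [exact: N0|by rewrite ler_weXn2l].
  rewrite lef_pV2 ?posrE; last 2 first.
  - by apply: mulr_gt0; apply: exprn_gt0.
  - by apply: mulr_gt0; apply: exprn_gt0.
  by apply: ler_pM; [exact: Z0|exact: Rh0|rewrite ler_weXn2l|rewrite ler_weXn2l].
apply: (@le_trans _ _ (c ^+ 7 * n ^+ 7 / (z ^+ 65 * rho ^+ 5) * (c * m / z ^+ 8 * (c * m / z ^+ 8)))).
  apply: ler_pM; [by rewrite mulr_ge0 // cmod_ge0|by rewrite mulr_ge0 ?cmod_ge0|exact: topb|].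
  by apply: ler_pM; [exact: cmod_ge0|exact: cmod_ge0|exact: lowb|exact: lowb].
have -> : c ^+ 7 * n ^+ 7 / (z ^+ 65 * rho ^+ 5) * (c * m / z ^+ 8 * (c * m / z ^+ 8)) =
  c ^+ 9 * (n ^+ 7 * m ^+ 2) * ((z ^+ 40) ^+ 2 * z * (rho ^+ 4 * rho))^-1.
  by field; rewrite !gt_eqF.
rewrite zK rhoK; apply: ler_wpM2l.
  by apply: mulr_ge0 => //; apply: mulr_ge0 => //; exact: exprn_ge0 (ltW m0).
rewrite /singular_weight -/z.
set l := Num.truncn _.
have lJ : l.+1%:R <= J.
  by rewrite -natr1 addrC lerD2l; have /andP[] := Num.Theory.truncn_itv nb0.
have kl0 : 0 < kroot 4 (l.+1%:R : R) by rewrite kroot_gt0 // ltr0n.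
have qR : 0 < q%:R :> R by rewrite ltr0n.
have JR : 0 < J by exact: lt_le_trans J1.
have q2z : 0 < q%:R ^+ 2 * z by apply: mulr_gt0 => //; exact: exprn_gt0.
rewrite lef_pV2 ?posrE; last 2 first.
- by apply: mulr_gt0 => //; apply: mulr_gt0.
- by apply: mulr_gt0 => //; apply: mulr_gt0 => //; rewrite ltr0n.
apply: ler_wpM2l; first exact: ltW.
by apply: ler_pM => //; [exact: ltW|exact: le_kroot].
Qed.

Lemma arc_dichotomy :
  (\prod_(i < 5) cmod (weyl_sum P (th (widen_ord (leqnSn 5) i)) al) <= c ^+ 9 * u ^+ 758) \/
  exists q a : nat, [/\ (0 < q)%N, coprime a q, be q a * q%:R <= (r ^ 404)%:R^-1 &
    cmod (cube_product r th t7 p1 p2 al) <=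
    c ^+ 9 * (P%:R ^+ 7 * Y%:R ^+ 2) * singular_weight R q (Num.truncn (P%:R ^+ 3 * be q a))].
Proof.
have Q0 : (0 < r ^ 404)%N by rewrite expn_gt0 (leq_trans _ r2).
have al60 : 0 <= 6 * al by rewrite mulr_ge0.
have [q [a [/andP[q0 qQ] caq ap]]] := dirichlet Q0 al60.
have [hq|/ltnW hq] := leqP q (r ^ 196).
  by right; exists q, a; split => //; apply: major_product.
by left; apply: minor_product (q0) caq ap _; rewrite hq qQ.
Qed.

End Arcs.

(** Put [s = r^40], so that [P = s^5] and [Y = s^4]. The near coincidences number
    [O(s^9) = O(r^360)]; the modulus [N] contributes 600 and the harmonic sum one more factor
    [r]. *)
Lemma pair_mean_square (R : realType) (r T : nat) (t p : R) : (2 <= r)%N -> (0 < T)%N ->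
  (r ^ 200)%:R < t <= (r ^ 200)%:R + 1 -> (r ^ 160)%:R < p <= (r ^ 160)%:R + 1 ->
  \sum_(j < (T * (1000 * r ^ 600)).+1)
     cmod (weyl_sum (r ^ 200) t (j%:R / (1000 * r ^ 600)%:R) *
           weyl_sum (r ^ 160) p (j%:R / (1000 * r ^ 600)%:R)) ^+ 2 <=
  10 ^+ 7 * (4 * T%:R + 10 ^+ 6) * r%:R ^+ 961.
Proof.
move=> r2 T0 ht hp; set N := (1000 * r ^ 600)%N.
have r0 : (0 < r)%N by apply: leq_trans r2.
pose s := (r ^ 40)%N.
have eP : (r ^ 200 = s ^ 5)%N by rewrite /s -expnM.
have eY : (r ^ 160 = s ^ 4)%N by rewrite /s -expnM.
(* [s = (r^20)^2], and [2^11] already exceeds 2000. *)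
have hs : (2000 ^ 2 <= s)%N.
  have -> : s = ((r ^ 20) ^ 2)%N by rewrite /s -expnM.
  rewrite leq_exp2r // (@leq_trans (2 ^ 11)) // (@leq_trans (r ^ 11)) ?leq_exp2r // leq_pexp2l //.
rewrite eP eY in ht hp *.
have N0 : (0 < N)%N by rewrite muln_gt0 expn_gt0 r0.
have P0 : 0 < (s ^ 5)%:R :> R by rewrite ltr0n -eP expn_gt0 r0.
have Y0 : 0 < (s ^ 4)%:R :> R by rewrite ltr0n -eY expn_gt0 r0.
have YP : (s ^ 4)%:R <= (s ^ 5)%:R :> R.
  by rewrite ler_nat leq_pexp2l // /s expn_gt0 r0.
have NE : N%:R = 1000 * (s ^ 5)%:R ^+ 3 :> R by rewrite natrM -[_ ^+ 3]natrX -eP -expnM.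
move: (ht) (hp) => /andP[t1 t2] /andP[h1 h2].
have cub (n : nat) (x : 'I_n) (v : R) : n%:R < v -> v <= n%:R + 1 -> 0 <= (x%:R + v) ^+ 3 <= (2 * n%:R) ^+ 3.
  move=> v1 v2; have n0 : 0 <= n%:R :> R by [].
  have xv : 0 <= x%:R + v by rewrite addr_ge0 // (le_trans n0) // ltW.
  rewrite exprn_ge0 //= lerXn2r ?nnegrE ?mulr_ge0 //.
  have : x%:R + 1 <= n%:R :> R by rewrite natr1 ler_nat.
  by move: v2; clear; lra.
have c0 (z : 'I_(s ^ 5) * 'I_(s ^ 4)) : 0 <= cube_pair t p z :> R.
  by have /andP[a _] := cub _ z.1 _ t1 t2; have /andP[b _] := cub _ z.2 _ h1 h2; rewrite addr_ge0.
have cN (z : 'I_(s ^ 5) * 'I_(s ^ 4)) : 2 * cube_pair t p z <= N%:R :> R.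
  have /andP[_ a] := cub _ z.1 _ t1 t2; have /andP[_ b] := cub _ z.2 _ h1 h2.
  have b' : (2 * (s ^ 4)%:R) ^+ 3 <= (2 * (s ^ 5)%:R) ^+ 3 :> R.
    by rewrite lerXn2r ?nnegrE ?mulr_ge0 // ler_wpM2l.
  have P3 : 0 < (s ^ 5)%:R ^+ 3 :> R by rewrite exprn_gt0.
  rewrite /cube_pair NE; move: a (le_trans b b') P3; rewrite !exprMn.
  by move: ((s ^ 5)%:R ^+ 3) ((z.1%:R + t) ^+ 3) ((z.2%:R + p) ^+ 3) => x y w; clear; lra.
have := mean_square (T * N).+1 N0 c0 cN.
have -> : \sum_(j < (T * N).+1) cmod (\sum_i cexp (j%:R / N%:R * @cube_pair R s t p i)) ^+ 2 =
  \sum_(j < (T * N).+1) cmod (weyl_sum (s ^ 5) t (j%:R / N%:R) * weyl_sum (s ^ 4) p (j%:R / N%:R)) ^+ 2.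
  apply: eq_bigr => j _; congr (cmod _ ^+ 2); rewrite /weyl_sum big_distrlr /= pair_big /=.
  by apply: eq_bigr => z _; rewrite /cube_pair mulrDr cexpD.
move/le_trans; apply.
have hE : #|[pred z | `|@cube_pair R s t p z.1 - @cube_pair R s t p z.2| < 1]|%:R <=
    (1 + 2 * (2 + 200 * 6))%:R * (s ^ 9)%:R :> R.
  by rewrite -natrM ler_nat; have := card_near hs ht hp; rewrite /near_set cardsE.
have u1 : 1 <= r%:R :> R by rewrite ler1n.
have hN : harmonic_sum R N <= 10 ^+ 6 * r%:R.
  apply: le_trans (harmonic_sum_kroot _ _ (isT : (0 < 600)%N)) _.
  apply: (@le_trans _ _ (600%:R * (1000 * r%:R))).
    rewrite ler_wpM2l //; apply: kroot_le_exp => //; first by rewrite mulr_ge0.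
    rewrite natrM natrX exprMn; apply: ler_wpM2r; first exact: exprn_ge0.
    by rewrite -[X in X <= _]expr1; apply: ler_weXn2l; rewrite // ler1n.
  rewrite mulrA; apply: ler_wpM2r => //; clear; lra.
have TN : 2 * (T * N).+1%:R + N%:R * harmonic_sum R N <= N%:R * ((4 * T%:R + 10 ^+ 6) * r%:R).
  have a1 : (T * N).+1%:R <= 2 * (T%:R * N%:R) * r%:R :> R.
    apply: (@le_trans _ _ (2 * (T%:R * N%:R))); last by rewrite ler_peMr // !mulr_ge0.
    by rewrite -natr1 natrM mulr2n mulrDl mul1r lerD2l -natrM ler1n muln_gt0 T0.
  have a2 : N%:R * harmonic_sum R N <= N%:R * (10 ^+ 6 * r%:R) by rewrite ler_wpM2l.
  move: a1 a2; have -> : N%:R * ((4 * T%:R + 10 ^+ 6) * r%:R) =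
    2 * (2 * (T%:R * N%:R) * r%:R) + N%:R * (10 ^+ 6 * r%:R) :> R by ring.
  by move: (_ * harmonic_sum _ _) (N%:R * (_ * _)) ((T * N).+1%:R) (2 * _ * _) => *; lra.
apply: (@le_trans _ _ (2 * ((1 + 2 * (2 + 200 * 6))%:R * (s ^ 9)%:R) * (N%:R * ((4 * T%:R + 10 ^+ 6) * r%:R)))).
  apply: ler_pM => //; first by rewrite mulr_ge0.
    by rewrite addr_ge0 // mulr_ge0 // harmonic_sum_ge0.
  by rewrite ler_wpM2l.
have -> : (s ^ 9)%:R = r%:R ^+ 360 :> R by rewrite /s -expnM natrX.
have -> : 961%N = (600 + 1 + 360)%N by [].
rewrite /N natrM natrX !exprD expr1.
have -> : 2 * ((1 + 2 * (2 + 200 * 6))%:R * r%:R ^+ 360) * (1000 * r%:R ^+ 600 * ((4 * T%:R + 10 ^+ 6) * r%:R)) =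
  2 * (1 + 2 * (2 + 200 * 6))%:R * 1000 * (4 * T%:R + 10 ^+ 6) * (r%:R ^+ 600 * r%:R * r%:R ^+ 360) :> R.
  by move: (_ ^+ 360) (_ ^+ 600) (_ + 10 ^+ 6) => *; ring.
have X0 : 0 <= r%:R ^+ 600 * r%:R * r%:R ^+ 360 :> R.
  by apply: mulr_ge0; [apply: mulr_ge0; [exact: exprn_ge0|]|exact: exprn_ge0].
have K0 : 0 <= 4 * T%:R + 10 ^+ 6 :> R by rewrite addr_ge0 ?mulr_ge0 ?exprn_ge0.
rewrite ler_wpM2r // ler_wpM2r //.
have -> : 10 ^+ 7 = 10 ^+ 4 * 1000 :> R by ring.
apply: ler_wpM2r => //; have -> : (1 + 2 * (2 + 200 * 6) = 2405)%N by [].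
clear; lra.
Qed.

(** Subtracting [c0 / J] times the Fejer sum cancels the constant term, so the number of points
    [#|X|] need not be estimated. The Fejer sum then supplies [c0 c' U], the margin that the other
    frequencies must not exhaust. *)
Lemma detector_bound (R : realType) (X : finType) (t : X -> R) (N M J : nat) (eta U c' : R)
    (G : nat -> R) (e := 2 * eta ^+ 2 / N%:R ^+ 2) (c0 := det_c0 M e) :
  (0 < N)%N -> (0 < J)%N -> (J <= M)%N -> 0 < eta -> 0 < c0 ->
  (forall x, `|t x| <= N%:R / 2) ->
  (forall j, `|\sum_x cos (2 * pi * (j%:R * (t x / N%:R)))| <= G j) ->
  c' * (J%:R * U) <= \sum_x cmod (\sum_(j < J) cexp (j%:R * (t x / N%:R))) ^+ 2 ->
  \sum_(1 <= j < M.+1) `|det_c M e j - 2 * c0 * ((J - j)%:R / J%:R)| * G j < c0 * (c' * U) ->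
  exists x, `|t x| < eta.
Proof.
move=> N0 J0 JM eta0 c00 tN hG hV hsum.
apply: (@detector R X t N M eta) => //; first exact: leq_trans JM.
pose S j : R := \sum_x cos (2 * pi * (j%:R * (t x / N%:R))).
rewrite -/e -/c0.
have JR : 0 < J%:R :> R by rewrite ltr0n.
have VE : \sum_x cmod (\sum_(j < J) cexp (j%:R * (t x / N%:R))) ^+ 2 =
    J%:R * #|X|%:R + 2 * \sum_(1 <= j < M.+1) (J - j)%:R * S j.
  have -> : \sum_(1 <= j < M.+1) (J - j)%:R * S j = \sum_(1 <= j < J) (J - j)%:R * S j.
    rewrite (big_cat_nat J0 (leqW JM)) /=.
    rewrite [X in _ + X]big_nat_cond [X in _ + X]big1 ?addr0 //.
    by move=> j /andP[/andP[h _] _]; rewrite (eqP h) mul0r.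
  under eq_bigr do rewrite fejer_expand //.
  rewrite big_split /= sumr_const mulr_natr; congr (_ + _).
  rewrite -mulr_sumr exchange_big /=; congr (_ * _); apply: eq_bigr => j _.
  by rewrite mulr_sumr.
have -> : c0 * #|X|%:R + \sum_(1 <= j < M.+1) det_c M e j * S j =
   c0 / J%:R * (\sum_x cmod (\sum_(j < J) cexp (j%:R * (t x / N%:R))) ^+ 2) +
   \sum_(1 <= j < M.+1) (det_c M e j - 2 * c0 * ((J - j)%:R / J%:R)) * S j.
  rewrite VE mulrDr -addrA; congr (_ + _); first by rewrite mulrA mulfVK ?gt_eqF.
  rewrite mulr_sumr mulr_sumr -big_split /=; apply: eq_bigr => j _; field.
  by rewrite gt_eqF.
have h1 : c0 * (c' * U) <= c0 / J%:R * (\sum_x cmod (\sum_(j < J) cexp (j%:R * (t x / N%:R))) ^+ 2).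
  have -> : c0 * (c' * U) = c0 / J%:R * (c' * (J%:R * U)) by field; rewrite gt_eqF.
  by apply: ler_wpM2l => //; rewrite divr_ge0 // ltW.
have h2 : `|\sum_(1 <= j < M.+1) (det_c M e j - 2 * c0 * ((J - j)%:R / J%:R)) * S j| < c0 * (c' * U).
  apply: le_lt_trans hsum; apply: le_trans (ler_norm_sum _ _ _) _.
  by apply: ler_sum => j _; rewrite normrM; apply: ler_wpM2l => //; exact: hG.
move: h1 h2; rewrite ltr_norml => h1 /andP[h2 _].
by move: h1 h2; move: (c0 * (c' * U)) (c0 / _ * _) (\sum_(_ <= _ < _) _) => *; lra.
Qed.

(** The first estimate serves at all frequencies; the second, small with [j / J], is for the few
    frequencies near 0, where the Weyl sums save nothing. *)
Lemma detector_coef (R : realType) (T N J j : nat) (eta : R) (w := eta * T%:R)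
    (e := 2 * eta ^+ 2 / N%:R ^+ 2) (c0 := det_c0 (T * N) e) :
  (0 < N)%N -> (1 < T * N)%N -> (0 < J)%N -> (J <= T * N)%N -> (j <= T * N)%N -> 4 <= w ->
  [/\ 0 < c0,
      `|det_c (T * N) e j - 2 * c0 * ((J - j)%:R / J%:R)| <= c0 * (16 * w ^+ 2 + 18) &
      `|det_c (T * N) e j - 2 * c0 * ((J - j)%:R / J%:R)| <= c0 * (16 * w ^+ 2 + 18) * (j%:R / J%:R)].
Proof.
move=> N0 M1 J0 JM jM w4; set M := (T * N)%N in M1 JM jM c0 *.
have MR : 0 < M%:R :> R by rewrite ltr0n ltnW.
have JR : 0 < J%:R :> R by rewrite ltr0n.
have T0 : (0 < T)%N by move: (ltnW M1); rewrite muln_gt0 => /andP[].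
have eE : e = 2 * w ^+ 2 / M%:R ^+ 2.
  rewrite /e /w /M natrM; field; by rewrite !gt_eqF ?ltr0n.
have h0 := det_c0_ge M1 eE w4; rewrite -/c0 in h0.
have M3 : 0 < M%:R ^+ 3 :> R by rewrite exprn_gt0.
have c00 : 0 < c0 by apply: lt_le_trans h0; rewrite divr_gt0.
have W0 : 0 <= 4 * w ^+ 2 + 4 by rewrite addr_ge0 // mulr_ge0 // sqr_ge0.
have M3c : M%:R ^+ 3 * (4 * w ^+ 2 + 4) <= c0 * (16 * w ^+ 2 + 16).
  have -> : c0 * (16 * w ^+ 2 + 16) = (4 * c0) * (4 * w ^+ 2 + 4) by ring.
  by apply: ler_wpM2r => //; move: h0; move: (M%:R ^+ 3) => x h0; lra.
have v0 : 0 <= (J - j)%:R / J%:R :> R by rewrite divr_ge0.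
have v1 : (J - j)%:R / J%:R <= 1 :> R by rewrite ler_pdivrMr // mul1r ler_nat leq_subr.
have v2 : 1 - (J - j)%:R / J%:R <= j%:R / J%:R :> R.
  rewrite lerBlDl -mulrDl ler_pdivlMr // mul1r -natrD ler_nat; lia.
split => //.
  apply: le_trans (ler_normB _ _) _.
  have a1 := det_c_le j (ltnW M1) eE.
  have a2 : `|2 * c0 * ((J - j)%:R / J%:R)| <= 2 * c0.
    rewrite ger0_norm; last by rewrite mulr_ge0 // mulr_ge0 // ltW.
    by rewrite ler_piMr // mulr_ge0 // ltW.
  have -> : c0 * (16 * w ^+ 2 + 18) = c0 * (16 * w ^+ 2 + 16) + 2 * c0 by ring.
  exact: lerD (le_trans a1 M3c) a2.
have -> : det_c M e j - 2 * c0 * ((J - j)%:R / J%:R) =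
  (det_c M e j - 2 * c0) + 2 * c0 * (1 - (J - j)%:R / J%:R) by ring.
apply: le_trans (ler_normD _ _) _.
have a1 := det_c_near (ltnW M1) jM eE; rewrite -/c0 in a1.
have a2 : `|2 * c0 * (1 - (J - j)%:R / J%:R)| <= 2 * c0 * (j%:R / J%:R).
  rewrite ger0_norm; last by rewrite mulr_ge0 ?subr_ge0 // mulr_ge0 // ltW.
  by rewrite ler_wpM2l // mulr_ge0 // ltW.
have a3 : j%:R * M%:R ^+ 2 * (4 * w ^+ 2 + 4) <= c0 * (16 * w ^+ 2 + 16) * (j%:R / J%:R).
  have -> : j%:R * M%:R ^+ 2 * (4 * w ^+ 2 + 4) = M%:R ^+ 3 * (4 * w ^+ 2 + 4) * (j%:R / M%:R).
    by field; rewrite gt_eqF.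
  apply: ler_pM => //; first by rewrite mulr_ge0 // ltW.
    by rewrite divr_ge0.
  by rewrite ler_wpM2l // lef_pV2 ?posrE // ler_nat.
have -> : c0 * (16 * w ^+ 2 + 18) * (j%:R / J%:R) =
   c0 * (16 * w ^+ 2 + 16) * (j%:R / J%:R) + 2 * c0 * (j%:R / J%:R) by ring.
exact: lerD (le_trans a1 a3) a2.
Qed.

Lemma cube_product_le0 (R : realType) (r : nat) (th : 'I_6 -> R) (t7 p1 p2 al : R) :
  cmod (cube_product r th t7 p1 p2 al) <=
  cmod (weyl_sum (r ^ 200) (th ord0) al) * ((r ^ 200)%:R ^+ 6 * (r ^ 160)%:R ^+ 2).
Proof.
rewrite /cube_product !cmodM cmod_prod big_ord_recl -2!(mulrA (cmod _)).
apply: ler_wpM2l; first exact: cmod_ge0.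
set n := (r ^ 200)%N; set m := (r ^ 160)%N.
have h : \prod_(i < 5) cmod (weyl_sum n (th (lift ord0 i)) al) <= n%:R ^+ 5.
  apply: (@le_trans _ _ (\prod_(i < 5) n%:R)); last by rewrite prodr_const card_ord.
  by apply: ler_prod => i _; rewrite cmod_ge0 cmod_weyl_sum_le.
have -> : n%:R ^+ 6 * m%:R ^+ 2 = n%:R ^+ 5 * (n%:R * (m%:R * m%:R)) :> R by ring.
have wn k t : 0 <= cmod (weyl_sum k t al) <= k%:R by rewrite cmod_ge0 cmod_weyl_sum_le.
have [/andP[a1 a2] [/andP[b1 b2] /andP[d1 d2]]] := (wn n t7, (wn m p1, wn m p2)).
rewrite -[X in X <= _]mulrA; apply: ler_pM => //; first by apply: prodr_ge0 => i _; exact: cmod_ge0.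
  by rewrite !mulr_ge0.
by apply: ler_pM => //; [rewrite mulr_ge0|apply: ler_pM].
Qed.

Lemma cube_product_le (R : realType) (r : nat) (th : 'I_6 -> R) (t7 p1 p2 al : R) :
  cmod (cube_product r th t7 p1 p2 al) <= (r ^ 200)%:R ^+ 7 * (r ^ 160)%:R ^+ 2.
Proof.
apply: le_trans (cube_product_le0 _ _ _ _ _ _) _.
rewrite [_%:R ^+ 7]exprS -mulrA; apply: ler_wpM2r; last exact: cmod_weyl_sum_le.
by apply: mulr_ge0; apply: exprn_ge0.
Qed.

Lemma cos_sum_le (R : realType) (r j : nat) (th : 'I_6 -> R) (t7 p1 p2 tau N : R) :
  `|\sum_(x : cube_box (r ^ 200) (r ^ 160))
     cos (2 * pi * (j%:R * ((cube_sum th t7 p1 p2 x - tau) / N)))| <=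
  cmod (cube_product r th t7 p1 p2 (j%:R / N)).
Proof.
have -> : \sum_(x : cube_box (r ^ 200) (r ^ 160))
     cos (2 * pi * (j%:R * ((cube_sum th t7 p1 p2 x - tau) / N))) =
  Re (cexp (- (j%:R / N * tau)) * cube_product r th t7 p1 p2 (j%:R / N)).
  rewrite /cube_product -cexp_cube_sum mulr_sumr Re_sum; apply: eq_bigr => x _.
  rewrite -cexpD /=; congr (cos (_ * _)); ring.
by apply: le_trans (Re_cmod _) _; rewrite cmodM cmod_cexp mul1r.
Qed.

(** * Summation over all frequencies j/N *)

Section ArcSum.
Variables (R : realType) (B : nat) (hB : divisor_bound R B) (c : R) (hc : 650 * B%:R ^+ 3 <= c).
Variables (r T D J : nat) (th : 'I_6 -> R) (t7 p1 p2 eps kap : R) (coef : nat -> R).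
Hypotheses (r2 : (2 <= r)%N) (T0 : (0 < T)%N) (D0 : (0 < D)%N) (J0 : (0 < J)%N).
Local Notation P := (r ^ 200)%N.
Local Notation Y := (r ^ 160)%N.
Local Notation N := (1000 * r ^ 600)%N.
Local Notation M := (T * N)%N.
Local Notation al j := ((@GRing.natmul R 1%R j) / (@GRing.natmul R 1%R N)).
Local Notation F j := (cmod (cube_product r th t7 p1 p2 (al j))).
Local Notation be j d := (`|6 * al j - d.2.2%:R / d.2.1%:R|).
Local Notation K := (400 * (6 * T + 2))%N.
Local Notation U := ((@GRing.natmul R 1%R P) ^+ 7 * (@GRing.natmul R 1%R Y) ^+ 2).
Hypotheses (hth : P%:R < th ord_max <= P%:R + 1) (ht7 : P%:R < t7 <= P%:R + 1).
Hypotheses (hp1 : Y%:R < p1 <= Y%:R + 1) (hp2 : Y%:R < p2 <= Y%:R + 1).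
Hypotheses (eps0 : 0 <= eps) (kap0 : 0 <= kap).
Hypothesis coef0 : forall j, 0 <= coef j.
Hypothesis coef1 : forall j, (j <= M)%N -> coef j <= kap.
Hypothesis coef2 : forall j, (j <= M)%N -> coef j <= kap * (j%:R / J%:R).
Hypothesis irr : forall (a q : nat) (x : R), (0 < a <= (6 * T + 1) * D)%N -> (0 < q <= D)%N ->
  `|6 * x - a%:R / q%:R| * P%:R ^+ 3 <= D%:R -> cmod (weyl_sum P (th ord0) x) <= eps * P%:R.

Let r0 : (0 < r)%N. Proof. exact: leq_trans r2. Qed.
Let P0 : 0 < P%:R :> R. Proof. by rewrite ltr0n expn_gt0 r0. Qed.
Let N0 : 0 < N%:R :> R. Proof. by rewrite ltr0n muln_gt0 expn_gt0 r0. Qed.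
Let NE : N%:R = 1000 * P%:R ^+ 3 :> R.
Proof. by rewrite natrM -[_ ^+ 3]natrX -expnM. Qed.
Let al0 j : 0 <= al j :> R. Proof. by rewrite divr_ge0. Qed.
Let U0 : 0 <= U. Proof. by apply: mulr_ge0; apply: exprn_ge0. Qed.
Let c0 : 0 <= c. Proof. by apply: le_trans hc; apply: mulr_ge0 => //; exact: exprn_ge0. Qed.
Let c90 : 0 <= c ^+ 9. Proof. exact: exprn_ge0. Qed.

Let lf (j : nat) (d : bool * (nat * nat)) : nat := Num.truncn (P%:R ^+ 3 * be j d).

(** [d] records an arc for the frequency [j]: minor if [d.1] is false, otherwise major at [a/q] with
    [d.2 = (q, a)]. One arc is chosen for each [j], so overlapping arcs cause no double counting. *)
Let good (j : nat) (d : bool * (nat * nat)) :=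
  if d.1 then [/\ (0 < d.2.1)%N, coprime d.2.2 d.2.1, be j d * d.2.1%:R <= (r ^ 404)%:R^-1 &
      F j <= c ^+ 9 * U * singular_weight R d.2.1 (lf j d)]
  else \prod_(i < 5) cmod (weyl_sum P (th (widen_ord (leqnSn 5) i)) (al j)) <= c ^+ 9 * r%:R ^+ 758.

Let ex_good (j : 'I_M.+1) : exists d, good j d.
Proof.
have [h|[q [a [h1 h2 h3 h4]]]] := arc_dichotomy hB hc th t7 p1 p2 r2 (al0 j).
  by exists (false, (0%N, 0%N)).
by exists (true, (q, a)).
Qed.

Let be_scale (j : nat) (d : bool * (nat * nat)) : P%:R ^+ 3 * be j d = `|3 / 500 * j%:R - P%:R ^+ 3 * (d.2.2%:R / d.2.1%:R)| :> R.
Proof.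
have P3 : 0 < P%:R ^+ 3 :> R by rewrite exprn_gt0.
rewrite -{1}(gtr0_norm P3) -normrM mulrBr; congr (`|_ - _|); rewrite NE.
by move: (P%:R ^+ 3) P3 => x x0; field; rewrite gt_eqF.
Qed.

(** The frequency is at most [T], and the approximation moves [6 al q] by at most 1. *)
Let a_le (j : nat) d : (j <= M)%N -> good j d -> d.1 -> (d.2.2 <= (6 * T + 1) * d.2.1)%N.
Proof.
rewrite /good => jM g d1; move: g; rewrite d1 => -[q0 _ h _].
have qR : 0 < d.2.1%:R :> R by rewrite ltr0n.
have alT : al j <= T%:R :> R by rewrite ler_pdivrMr // -natrM ler_nat.
have h1 : `|6 * al j * d.2.1%:R - d.2.2%:R| <= 1 :> R.
  have -> : 6 * al j * d.2.1%:R - d.2.2%:R = (6 * al j - d.2.2%:R / d.2.1%:R) * d.2.1%:R :> R.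
    by rewrite mulrBl mulfVK ?gt_eqF.
  rewrite normrM (gtr0_norm qR); apply: le_trans h _.
  by rewrite invf_le1 ?ler1n ?ltr0n expn_gt0 r0.
rewrite -(ler_nat R) !natrM natrD natrM.
have h2 : 6 * al j * d.2.1%:R <= 6 * T%:R * d.2.1%:R :> R.
  by apply: ler_wpM2r; [exact: ltW|apply: ler_wpM2l].
have h3 : 1 <= d.2.1%:R :> R by rewrite ler1n.
move: h1; rewrite ler_norml => /andP[h1 _].
have -> : (6 * T%:R + 1) * d.2.1%:R = 6 * T%:R * d.2.1%:R + d.2.1%:R :> R by ring.
move: h1 h2 h3; move: (6 * al j * _) (6 * T%:R * _) => x y h1 h2 h3; lra.
Qed.

Section Chosen.
Variables (d : 'I_M.+1 -> bool * (nat * nat)) (hd : forall j : 'I_M.+1, good j (d j)).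
Let qf (j : 'I_M.+1) := (d j).2.1.
Let l (j : 'I_M.+1) := lf j (d j).

Let jM (j : 'I_M.+1) : (j <= M)%N. Proof. by rewrite -ltnS. Qed.

(** For given [q] there are at most [(6 T + 1) q + 1] numerators, and for each of them [P^3 |beta|]
    has a given integer part for at most 400 values of [j]. *)
Let fib (S : pred 'I_M.+1) : (forall j, S j -> (d j).1) -> forall q0 l0 : nat,
  (#|[pred j | S j & (qf j == q0) && (l j == l0)]| <= K * q0)%N.
Proof.
move=> hS q0 l0; set E := [pred j | _].
case: (posnP q0) => [q00|q00].
  rewrite eq_card0 // => j; apply/negbTE/negP; rewrite !inE => /andP[Sj /andP[/eqP e _]].
  by have := hd j; rewrite /good (hS _ Sj) -/(qf j) e q00 => -[].
pose m := ((6 * T + 1) * q0)%N.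
pose key (j : 'I_M.+1) : 'I_m.+1 := inord (d j).2.2.
have aE j : E j -> (d j).2.2 = key j :> nat.
  move=> /andP[Sj /andP[/eqP e _]]; rewrite inordK // ltnS /m -e.
  exact: a_le (jM j) (hd j) (hS _ Sj).
have ck k : (#|[pred j | E j & key j == k]| <= 400)%N.
  apply: leq_trans (card_dist_window M.+1 l0 (P%:R ^+ 3 * (k%:R / q0%:R) : R)).
  apply: subset_leq_card; apply/fintype.subsetP => j; rewrite !inE => /andP[Ej /eqP ek].
  have ea := aE _ Ej; move: Ej => /andP[Sj /andP[/eqP e /eqP el]].
  rewrite -ek -ea -el -e -be_scale /l /lf.
  have h0 : 0 <= P%:R ^+ 3 * be j (d j) :> R by rewrite mulr_ge0 // exprn_ge0.
  by rewrite natr1; exact: Num.Theory.truncn_itv.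
have : \sum_(j | E j) (1 : R) <= \sum_(k < m.+1) 400%:R * 1.
  exact: (fiber_sum_le (K := fun=> 400%N) (fun=> ler01) (fun _ _ => lexx _) ck).
rewrite !sumr_const card_ord mulr1 -[400%:R *+ _]mulr_natl -natrM ler_nat => h.
apply: (@leq_trans (m.+1 * 400)); first exact: h.
rewrite mulnC -mulnA leq_mul2l /= /m.
have -> : (6 * T + 2 = (6 * T + 1) + 1)%N by rewrite -addnA.
by rewrite (mulnDl (6 * T + 1)) mul1n -addn1 leq_add2l.
Qed.

Let minor (j : 'I_M.+1) := (0 < j)%N && ~~ (d j).1.
Let small (j : 'I_M.+1) := (qf j <= D)%N && (l j < D)%N.
Let S1 (j : 'I_M.+1) := ((0 < j)%N && (d j).1) && ~~ small j.
Let S2 (j : 'I_M.+1) := ((0 < j)%N && (d j).1) && small j.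

(** Five long sums are bounded pointwise; the product of the two pairs is at most half the sum of
    their squares, to which the mean square applies. *)
Lemma minor_sum : \sum_(j | minor j) coef j * F j <=
  kap * (c ^+ 9 * r%:R ^+ 758 * (10 ^+ 7 * (4 * T%:R + 10 ^+ 6) * r%:R ^+ 961)).
Proof.
pose gA (j : nat) : R := cmod (weyl_sum P (th ord_max) (al j) * weyl_sum Y p1 (al j)).
pose gB (j : nat) : R := cmod (weyl_sum P t7 (al j) * weyl_sum Y p2 (al j)).
have hA := pair_mean_square r2 T0 hth hp1.
have hB' := pair_mean_square r2 T0 ht7 hp2.
have W0 : 0 <= c ^+ 9 * r%:R ^+ 758 by apply: mulr_ge0 => //; apply: exprn_ge0.
apply: (@le_trans _ _ (\sum_(j < M.+1) kap * (c ^+ 9 * r%:R ^+ 758 * ((gA j ^+ 2 + gB j ^+ 2) / 2)))).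
  apply: (@le_trans _ _ (\sum_(j < M.+1 | minor j) kap * (c ^+ 9 * r%:R ^+ 758 * ((gA j ^+ 2 + gB j ^+ 2) / 2)))).
    apply: ler_sum => j /andP[_ dj]; apply: ler_pM => //; [exact: cmod_ge0|exact: coef1|].
    rewrite cmod_cube_product -/(gA j) -/(gB j).
    have := hd j; rewrite /good (negbTE dj) => h.
    have g0 : 0 <= gA j * gB j by rewrite mulr_ge0 // cmod_ge0.
    apply: ler_pM => //; first by apply: prodr_ge0 => i _; exact: cmod_ge0.
    by have := sqr_ge0 (gA j - gB j); move: (gA j) (gB j) => x y h'; nra.
  rewrite [X in _ <= X](bigID minor) /= lerDl sumr_ge0 // => j _.
  by apply: mulr_ge0 => //; apply: mulr_ge0 => //; rewrite divr_ge0 // addr_ge0 // exprn_ge0 // cmod_ge0.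
rewrite -mulr_sumr -mulr_sumr; apply: ler_wpM2l => //; apply: ler_wpM2l => //.
rewrite -mulr_suml big_split /=; move: hA hB'; rewrite -/(gA _) -/(gB _).
move: (\sum_(j < _) _) (\sum_(j < _) _) (_ * r%:R ^+ 961) => x y z h1 h2; lra.
Qed.

Lemma major_large_sum : \sum_(j | S1 j) coef j * F j <=
  kap * (c ^+ 9 * U * (400 * K%:R / kroot 40 D%:R)).
Proof.
apply: (@le_trans _ _ (\sum_(j | S1 j) kap * (c ^+ 9 * U * singular_weight R (qf j) (l j)))).
  apply: ler_sum => j /andP[/andP[_ dj] _]; apply: ler_pM => //; [exact: cmod_ge0|exact: coef1|].
  by have := hd j; rewrite /good dj => -[].
rewrite -mulr_sumr -mulr_sumr; apply: ler_wpM2l => //; apply: ler_wpM2l; first exact: mulr_ge0.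
apply: singular_tail => //.
- by move=> j /andP[/andP[_ dj] _]; have := hd j; rewrite /good dj => -[].
- by apply: fib => j /andP[/andP[]].
- by move=> j /andP[_]; rewrite negb_and -ltnNge -leqNgt.
Qed.

(** If the numerator is 0, then [3/500 j <= D], so [j <= 167 D] and the coefficient is small even
    though the sums may not be. Otherwise the sum with the irrational shift is at most [eps P]. *)
Lemma major_small_sum : \sum_(j | S2 j) coef j * F j <=
  kap * ((K * D ^ 3)%:R * ((167 * D%:R / J%:R + eps) * U)).
Proof.
have JR : 0 < J%:R :> R by rewrite ltr0n.
have x0 : 0 <= 167 * D%:R / J%:R :> R by rewrite divr_ge0 // mulr_ge0.
apply: (@le_trans _ _ (\sum_(j | S2 j) kap * ((167 * D%:R / J%:R + eps) * U))).
  apply: ler_sum => j /andP[/andP[j0 dj] /andP[qD lD]].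
  have := hd j; rewrite /good dj => -[q0 caq _ _].
  have beD : P%:R ^+ 3 * be j (d j) <= D%:R :> R.
    have h0 : 0 <= P%:R ^+ 3 * be j (d j) :> R by rewrite mulr_ge0 // exprn_ge0.
    have /andP[_ h1] := Num.Theory.truncn_itv h0.
    by apply: le_trans (ltW h1) _; rewrite ler_nat.
  case: (posnP (d j).2.2) => [a0|a0].
    have j167 : j%:R <= 167 * D%:R :> R.
      have e3 : 0 <= 3 / 500 * j%:R :> R by apply: mulr_ge0 => //; exact: divr_ge0.
      move: beD; rewrite be_scale a0 mul0r mulr0 subr0 (ger0_norm e3).
      have : 0 <= D%:R :> R by []; have : 0 <= j%:R :> R by [].
      by move: (D%:R) (j%:R) => x y h1 h2 h3; lra.
    apply: (@le_trans _ _ (kap * (167 * D%:R / J%:R) * U)).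
      apply: ler_pM => //; [exact: cmod_ge0| |exact: cube_product_le].
      apply: le_trans (coef2 (jM j)) _; apply: ler_wpM2l => //.
      by apply: ler_wpM2r => //; rewrite invr_ge0 ltW.
    rewrite -mulrA; apply: ler_wpM2l => //; apply: ler_wpM2r => //; by rewrite lerDl.
  have aD : (0 < (d j).2.2 <= (6 * T + 1) * D)%N.
    rewrite a0 (leq_trans (a_le (jM j) (hd j) dj)) // leq_mul2l qD orbT //.
  have qD' : (0 < (d j).2.1 <= D)%N by rewrite q0.
  have h := irr aD qD'; rewrite mulrC in beD; have {}h := h _ beD.
  apply: (@le_trans _ _ (kap * (eps * U))).
    apply: ler_pM => //; [exact: cmod_ge0|exact: coef1|].
    apply: le_trans (cube_product_le0 _ _ _ _ _ _) _.
    have -> : eps * U = eps * P%:R * (P%:R ^+ 6 * Y%:R ^+ 2) by rewrite [P%:R ^+ 7]exprS; ring.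
    by apply: ler_wpM2r => //; apply: mulr_ge0; apply: exprn_ge0.
  by apply: ler_wpM2l => //; apply: ler_wpM2r => //; rewrite lerDr.
rewrite sumr_const -[X in X <= _]mulr_natl mulrCA; apply: ler_wpM2l => //.
apply: ler_wpM2r; first by apply: mulr_ge0 => //; exact: addr_ge0.
rewrite ler_nat.
have hS2 j : S2 j -> (d j).1 by move=> /andP[/andP[]].
apply: (@card_singular_small R _ S2 qf l K D) => //.
- by move=> j /hS2 dj; have := hd j; rewrite /good dj => -[].
- exact: fib.
- by move=> j Sj; apply/and3P; move: (Sj) => /andP[_ /andP[h1 h2]]; split.
Qed.

Lemma chosen_sum : \sum_(1 <= j < M.+1) coef j * F j <=
  kap * (c ^+ 9 * r%:R ^+ 758 * (10 ^+ 7 * (4 * T%:R + 10 ^+ 6) * r%:R ^+ 961)) +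
  (kap * (c ^+ 9 * U * (400 * K%:R / kroot 40 D%:R)) +
   kap * ((K * D ^ 3)%:R * ((167 * D%:R / J%:R + eps) * U))).
Proof.
rewrite big_geq_mkord /= (bigID (fun j => (d j).1)) /= addrC; apply: lerD; first exact: minor_sum.
rewrite (bigID small) /= addrC; apply: lerD; first exact: major_large_sum.
exact: major_small_sum.
Qed.

End Chosen.

Lemma arc_sum : \sum_(1 <= j < M.+1) coef j * F j <=
  kap * (c ^+ 9 * r%:R ^+ 758 * (10 ^+ 7 * (4 * T%:R + 10 ^+ 6) * r%:R ^+ 961)) +
  (kap * (c ^+ 9 * U * (400 * K%:R / kroot 40 D%:R)) +
   kap * ((K * D ^ 3)%:R * ((167 * D%:R / J%:R + eps) * U))).
Proof. by have [d hd] := choice ex_good; exact: chosen_sum hd. Qed.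

End ArcSum.

Lemma cube_shift_bound (R : realType) (n : nat) (x : 'I_n) (v : R) :
  n%:R < v <= n%:R + 1 -> 0 <= (x%:R + v) ^+ 3 <= 8 * n%:R ^+ 3.
Proof.
move=> /andP[v1 v2]; have n0 : 0 <= n%:R :> R by [].
have xv : 0 <= x%:R + v by rewrite addr_ge0 // (le_trans n0) // ltW.
have -> : 8 * n%:R ^+ 3 = (2 * n%:R) ^+ 3 :> R by ring.
rewrite exprn_ge0 //= lerXn2r ?nnegrE ?mulr_ge0 //.
have : x%:R + 1 <= n%:R :> R by rewrite natr1 ler_nat.
by move: v2; clear; lra.
Qed.

Lemma cube_sum_bound (R : realType) (P Y : nat) (th : 'I_6 -> R) (t7 p1 p2 : R) (x : cube_box P Y) :
  (Y <= P)%N -> (forall i, P%:R < th i <= P%:R + 1) -> P%:R < t7 <= P%:R + 1 ->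
  Y%:R < p1 <= Y%:R + 1 -> Y%:R < p2 <= Y%:R + 1 ->
  0 <= cube_sum th t7 p1 p2 x <= 72 * P%:R ^+ 3.
Proof.
move=> YP hth h7 h1 h2; rewrite /cube_sum.
have /andP[a1 a2] := cube_shift_bound x.1.2 h7.
have /andP[b1 b2] := cube_shift_bound x.2.1 h1.
have /andP[c1 c2] := cube_shift_bound x.2.2 h2.
have Y3 : Y%:R ^+ 3 <= P%:R ^+ 3 :> R by rewrite lerXn2r ?nnegrE // ler_nat.
have s1 : 0 <= \sum_(i < 6) ((x.1.1 i)%:R + th i) ^+ 3.
  by apply: sumr_ge0 => i _; have /andP[] := cube_shift_bound (x.1.1 i) (hth i).
have s2 : \sum_(i < 6) ((x.1.1 i)%:R + th i) ^+ 3 <= 6 * (8 * P%:R ^+ 3).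
  apply: (@le_trans _ _ (\sum_(i < 6) 8 * P%:R ^+ 3)).
    by apply: ler_sum => i _; have /andP[] := cube_shift_bound (x.1.1 i) (hth i).
  by rewrite sumr_const card_ord -[X in X <= _]mulr_natl.
move: a1 a2 b1 b2 c1 c2 s1 s2 Y3; move: (\sum_(i < 6) _).
move: ((x.1.2%:R + t7) ^+ 3) ((x.2.1%:R + p1) ^+ 3) ((x.2.2%:R + p2) ^+ 3).
by move: (P%:R ^+ 3) (Y%:R ^+ 3) => p y b c d A *; apply/andP; split; lra.
Qed.

Lemma nat_above (R : realType) (x : R) : exists n : nat, x <= n%:R.
Proof. by exists (Num.truncn x).+1; exact/ltW/Num.Theory.truncnS_gt. Qed.

(** Only finitely many [(a, q)] occur; the sum of their thresholds plays the part of a maximum. *)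
Lemma ex_bounded_choice (R : realType) (mu eps : R) (A D : nat) : irrational mu -> 0 < eps ->
  exists n0 : nat, forall (n a q : nat) (m : int) (al : R), (n0 <= n)%N ->
    (0 < a <= A)%N -> (0 < q <= D)%N -> 0 <= m%:~R - mu <= n%:R + 1 ->
    `|6 * al - a%:R / q%:R| * n%:R ^+ 3 <= D%:R -> cmod (weyl_sum n (m%:~R - mu) al) <= eps * n%:R.
Proof.
move=> hmu eps0.
have /choice [f hf] : forall p : nat * nat, exists n0 : nat, (0 < p.1)%N -> (0 < p.2)%N ->
    forall (n : nat) (m : int) (al : R), (n0 <= n)%N -> 0 <= m%:~R - mu <= n%:R + 1 ->
    `|6 * al - p.1%:R / p.2%:R| * n%:R ^+ 3 <= D%:R -> cmod (weyl_sum n (m%:~R - mu) al) <= eps * n%:R.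
  move=> [a q] /=; case: (posnP a) => [->|a0]; first by exists 0%N.
  case: (posnP q) => [->|q0]; first by exists 0%N.
  have [n0 h] := weyl_irrational hmu a0 q0 (ler0n R D) eps0.
  by exists n0.
exists (\sum_(a < A.+1) \sum_(q < D.+1) f (a : nat, q : nat))%N.
move=> n a q m al hn /andP[a0 aA] /andP[q0 qD]; apply: (hf (a, q)) => //.
apply: leq_trans hn; rewrite (bigD1 (Ordinal (aA : (a < A.+1)%N))) //= (bigD1 (Ordinal (qD : (q < D.+1)%N))) //=.
by rewrite -addnA leq_addr.
Qed.

(** The order of choice matters: [T] from [eta], then [D] against the tail of the major arcs, then
    [J] against the arcs with numerator 0, then [eps], and [r] last. The minor arcs, the tail and
    the two kinds of small major arcs each take at most [c' U / 8], half of the margin in all. *)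
Lemma cubes_near (R : realType) (mu eta : R) : irrational mu -> 0 < eta ->
  exists r0 : nat, forall (r : nat) (m0 : int) (th : 'I_6 -> R) (t7 p1 p2 tau : R), (r0 <= r)%N ->
    th ord0 = m0%:~R - mu ->
    (forall i, (r ^ 200)%:R < th i <= (r ^ 200)%:R + 1) -> (r ^ 200)%:R < t7 <= (r ^ 200)%:R + 1 ->
    (r ^ 160)%:R < p1 <= (r ^ 160)%:R + 1 -> (r ^ 160)%:R < p2 <= (r ^ 160)%:R + 1 ->
    22 * (r ^ 200)%:R ^+ 3 <= tau <= 23 * (r ^ 200)%:R ^+ 3 ->
    exists x : cube_box (r ^ 200) (r ^ 160), `|cube_sum th t7 p1 p2 x - tau| < eta.
Proof.
move=> hmu eta0.
have [B hB] := ex_divisor_bound R.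
have [c hc] : exists c : R, 650 * B%:R ^+ 3 <= c by eexists.
have c90 : 0 <= c ^+ 9.
  by apply: exprn_ge0; apply: le_trans hc; apply: mulr_ge0 => //; exact: exprn_ge0.
(* [eta T >= 4] is the condition under which the mean of the detector is positive. *)
have [T hT] := nat_above (4 / eta).
have w4 : 4 <= eta * T%:R by rewrite mulrC -ler_pdivrMr.
have T0 : (0 < T)%N.
  by case: (posnP T) w4 => // ->; rewrite mulr0 leNgt ltr0n.
set kap := 16 * (eta * T%:R) ^+ 2 + 18.
have kap0 : 0 < kap by apply: ltr_wpDl => //; apply: mulr_ge0 => //; exact: sqr_ge0.
have [c' c'0 hc'] : exists2 c' : R, 0 < c' & c' = 8^-1 * 20^-1 ^+ 6.
  by eexists; [|reflexivity]; apply: mulr_gt0; rewrite ?invr_gt0 // exprn_gt0 // invr_gt0.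
set K := (400 * (6 * T + 2))%N.
have [D [D0 hD]] : exists D : nat, (0 < D)%N /\
    kap * (c ^+ 9 * (400 * K%:R / kroot 40 D%:R)) <= c' / 8.
  pose X := 8 * kap * c ^+ 9 * (400 * K%:R) / c'.
  have X0 : 0 <= X.
    by apply: divr_ge0; [apply: mulr_ge0; [apply: mulr_ge0 => //; apply: mulr_ge0 => //|exact: mulr_ge0]|]; exact: ltW.
  have [D hD] := nat_above (X ^+ 40); exists D.+1; split => //.
  have hXD : X <= kroot 40 D.+1%:R.
    by apply: le_kroot_exp => //; apply: le_trans hD _; rewrite ler_nat.
  have k0 : 0 < kroot 40 D.+1%:R :> R by rewrite kroot_gt0 // ltr0n.
  have -> : kap * (c ^+ 9 * (400 * K%:R / kroot 40 D.+1%:R)) = c' / 8 * (X / kroot 40 D.+1%:R).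
    by rewrite /X; move: (c ^+ 9) (kroot _ _) k0 => y k k0; field; rewrite !gt_eqF.
  by apply: ler_piMr; [apply: divr_ge0 => //; exact: ltW|rewrite ler_pdivrMr // mul1r].
set KD := (K * D ^ 3)%N.
have kKD : 0 <= kap * KD%:R by apply: mulr_ge0 => //; exact: ltW.
have [J [J10 hJ]] : exists J : nat, (10 <= J)%N /\ kap * (KD%:R * (167 * D%:R / J%:R)) <= c' / 8.
  pose X := 8 * (kap * KD%:R) * (167 * D%:R) / c'.
  have [J hJ] := nat_above X; exists (J + 10)%N; split; first exact: leq_addl.
  have hXJ : X <= (J + 10)%:R by apply: le_trans hJ _; rewrite ler_nat leq_addr.
  have k0 : 0 < (J + 10)%:R :> R by rewrite ltr0n addn_gt0 orbT.
  have -> : kap * (KD%:R * (167 * D%:R / (J + 10)%:R)) = c' / 8 * (X / (J + 10)%:R).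
    by rewrite /X; move: ((J + 10)%:R) k0 => k k0; field; rewrite !gt_eqF.
  by apply: ler_piMr; [apply: divr_ge0 => //; exact: ltW|rewrite ler_pdivrMr // mul1r].
have [eps [eps0 heps]] : exists eps : R, 0 < eps /\ kap * (KD%:R * eps) <= c' / 8.
  have e0 : 0 < kap * KD%:R + 1 by rewrite ltr_wpDl.
  exists (c' / 8 / (kap * KD%:R + 1)); split; first by rewrite !divr_gt0.
  rewrite mulrA mulrCA; apply: ler_piMr; first by apply: divr_ge0 => //; exact: ltW.
  by rewrite ler_pdivrMr // mul1r lerDl.
have [n0 hn0] := ex_bounded_choice ((6 * T + 1) * D) D hmu eps0.
(* The factor [r] gained on the minor arcs only has to exceed this constant. *)
have [r1 hr1] := nat_above (8 * kap * c ^+ 9 * (10 ^+ 7 * (4 * T%:R + 10 ^+ 6)) / c').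
exists (1000 + J + n0 + r1)%N => r m0 th t7 p1 p2 tau hr eth hth ht7 hp1 hp2 htau.
have r1000 : (1000 <= r)%N by move: hr; clear; lia.
have rJ : (J <= r)%N by move: hr; clear; lia.
have rn0 : (n0 <= r)%N by move: hr; clear; lia.
have rr1 : (r1 <= r)%N by apply: leq_trans hr; rewrite leq_addl.
clear hr.
have r2 : (2 <= r)%N by apply: leq_trans r1000.
have rpos : (0 < r)%N by apply: leq_trans r1000.
have rpow k : (0 < k)%N -> (r <= r ^ k)%N by move=> k0; rewrite -{1}[r]expn1 leq_pexp2l.
pose N := (1000 * r ^ 600)%N.
have N0 : (0 < N)%N by rewrite muln_gt0 expn_gt0 rpos.
have NE : N%:R = 1000 * (r ^ 200)%:R ^+ 3 :> R by rewrite natrM -[_ ^+ 3]natrX -expnM.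
have rN : (r <= N)%N by apply: leq_trans (rpow 600%N isT) _; rewrite leq_pmull.
have NM : (N <= T * N)%N by rewrite leq_pmull.
have J0 : (0 < J)%N by apply: leq_trans J10.
have JM : (J <= T * N)%N by apply: leq_trans rJ (leq_trans rN NM).
have M1 : (1 < T * N)%N by apply: leq_trans r2 (leq_trans rN NM).
have YP : (r ^ 160 <= r ^ 200)%N by rewrite leq_pexp2l.
pose e : R := 2 * eta ^+ 2 / N%:R ^+ 2.
pose c0 : R := det_c0 (T * N) e.
have hcoef j (jM : (j <= T * N)%N) := detector_coef N0 M1 J0 JM jM w4.
have c00 : 0 < c0 by have [] := hcoef 0%N isT.
pose u : R := r%:R.
pose U : R := (r ^ 200)%:R ^+ 7 * (r ^ 160)%:R ^+ 2.
have u0 : 0 < u by rewrite ltr0n.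
have UE : U = u ^+ 758 * u ^+ 961 * u.
  rewrite /U !natrX -!exprM -exprD -exprD -exprSr //.
have U0 : 0 < U by rewrite UE; apply: mulr_gt0 => //; apply: mulr_gt0; exact: exprn_gt0.
apply: (@detector_bound R _ (fun x => cube_sum th t7 p1 p2 x - tau) N (T * N) J eta U c'
   (fun j => cmod (cube_product r th t7 p1 p2 (j%:R / N%:R)))) => //.
- move=> x; have /andP[x1 x2] := cube_sum_bound x YP hth ht7 hp1 hp2.
  move: htau => /andP[ta tb]; rewrite NE ler_norml.
  by move: x1 x2 ta tb; move: ((r ^ 200)%:R ^+ 3) => p *; apply/andP; split; lra.
- by move=> j; exact: cos_sum_le.
- rewrite hc' NE; apply: cube_sum_count => //.
  + exact: leq_trans (rpow 200%N isT).
  + exact: leq_trans (rpow 200%N isT).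
  + have -> : 64 * (r ^ 160)%:R ^+ 3 = (4 * (r ^ 160)%:R) ^+ 3 :> R by ring.
    rewrite lerXn2r ?nnegrE ?mulr_ge0 // -natrM ler_nat.
    have -> : (r ^ 200 = r ^ 40 * r ^ 160)%N by rewrite -expnD.
    by rewrite leq_mul2r (leq_trans _ (rpow 40%N isT)) ?orbT // (leq_trans _ r1000).
rewrite -/e -/c0.
have ckap : 0 <= c0 * kap by apply: mulr_ge0; exact: ltW.
have irr : forall (a q : nat) (x : R), (0 < a <= (6 * T + 1) * D)%N -> (0 < q <= D)%N ->
    `|6 * x - a%:R / q%:R| * (r ^ 200)%:R ^+ 3 <= D%:R ->
    cmod (weyl_sum (r ^ 200) (th ord0) x) <= eps * (r ^ 200)%:R.
  move=> a q x ha hq hx; rewrite eth; apply: (hn0 _ a q) => //.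
    exact: leq_trans (rpow 200%N isT).
  by rewrite -eth; have /andP[h1 ->] := hth ord0; rewrite andbT (le_trans _ (ltW h1)).
have hsum := @arc_sum R B hB c hc r T D J th t7 p1 p2 eps (c0 * kap)
  (fun j => `|det_c (T * N) e j - 2 * c0 * ((J - j)%:R / J%:R)|)
  r2 T0 D0 J0 (hth _) ht7 hp1 hp2 (ltW eps0) ckap (fun=> normr_ge0 _)
  (fun j jM => let: And3 _ h _ := hcoef j jM in h) (fun j jM => let: And3 _ _ h := hcoef j jM in h) irr.
apply: le_lt_trans hsum _; rewrite -/U -/K -/KD -/u.
have e1 : kap * (c ^+ 9 * u ^+ 758 * (10 ^+ 7 * (4 * T%:R + 10 ^+ 6) * u ^+ 961)) <= c' / 8 * U.
  rewrite UE; set V := u ^+ 758 * u ^+ 961.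
  have V0 : 0 <= V by apply: mulr_ge0; apply: exprn_ge0; exact: ltW.
  have -> : kap * (c ^+ 9 * u ^+ 758 * (10 ^+ 7 * (4 * T%:R + 10 ^+ 6) * u ^+ 961)) =
     V * (kap * c ^+ 9 * (10 ^+ 7 * (4 * T%:R + 10 ^+ 6))).
    by rewrite /V; move: (u ^+ 758) (u ^+ 961) (c ^+ 9) (10 ^+ 7 * _) => *; ring.
  have -> : c' / 8 * (V * u) = V * (c' / 8 * u) by ring.
  apply: ler_wpM2l => //.
  have : 8 * kap * c ^+ 9 * (10 ^+ 7 * (4 * T%:R + 10 ^+ 6)) / c' <= u.
    by apply: le_trans hr1 _; rewrite ler_nat.
  rewrite ler_pdivrMr //; move: (c ^+ 9) (10 ^+ 7 * _) => x y.
  have -> : 8 * kap * x * y = 8 * (kap * x * y) by ring.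
  have -> : c' / 8 * u = (u * c') / 8 by ring.
  by move: (kap * x * y) (u * c') => a b h; lra.
have e2 : kap * (c ^+ 9 * U * (400 * K%:R / kroot 40 D%:R)) <= c' / 8 * U.
  have -> : kap * (c ^+ 9 * U * (400 * K%:R / kroot 40 D%:R)) =
    kap * (c ^+ 9 * (400 * K%:R / kroot 40 D%:R)) * U.
    by move: (c ^+ 9) (400 * _ / _) => *; ring.
  by apply: ler_wpM2r => //; exact: ltW.
have e3 : kap * (KD%:R * ((167 * D%:R / J%:R + eps) * U)) <= (c' / 8 + c' / 8) * U.
  have -> : kap * (KD%:R * ((167 * D%:R / J%:R + eps) * U)) =
    (kap * (KD%:R * (167 * D%:R / J%:R)) + kap * (KD%:R * eps)) * U.
    by move: (167 * _ / _) (KD%:R) => *; ring.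
  by apply: ler_wpM2r; [exact: ltW|exact: lerD].
rewrite -!(mulrA c0) -!mulrDr ltr_pM2l //.
have cU : 0 < c' * U by exact: mulr_gt0.
rewrite (mulrDr kap) (mulrDr kap); apply: (le_lt_trans (lerD e1 (lerD e2 e3))).
have -> : c' / 8 * U + (c' / 8 * U + (c' / 8 + c' / 8) * U) = c' * U / 2 by field.
by rewrite ltr_pdivrMr //; move: (c' * U) cU => y y0; lra.
Qed.

(** * Choice of the scale and the theorem *)

Lemma one_sub_mul_le_exp (R : realType) (x : R) (n : nat) : 0 <= x <= 1 -> 1 - n%:R * x <= (1 - x) ^+ n.
Proof.
move=> /andP[x0 x1]; elim: n => [|n IH]; first by rewrite mul0r subr0 expr0.
have h : (1 - n%:R * x) * (1 - x) <= (1 - x) ^+ n.+1.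
  by rewrite exprSr; apply: ler_wpM2r => //; rewrite subr_ge0.
apply: le_trans h; rewrite -[n.+1%:R]natr1.
have : 0 <= n%:R * x * x by rewrite !mulr_ge0.
have -> : (1 - n%:R * x) * (1 - x) = 1 - (n%:R + 1) * x + n%:R * x * x by ring.
by rewrite lerDl.
Qed.

(** The intervals from [22 r^600] to [23 r^600] overlap for consecutive [r] once
    [(1 + 1/r)^600 <= 23/22], which by Bernoulli's inequality holds from 600 * 23 = 13800 on; this
    is the [138 * 100] of the proof. *)
Lemma ex_scale (R : realType) (r0 : nat) : exists t0 : R, forall t, t0 <= t ->
  exists2 r : nat, (r0 <= r)%N & 22 * (r ^ 200)%:R ^+ 3 <= t <= 23 * (r ^ 200)%:R ^+ 3.
Proof.
pose r1 := (r0 + 138 * 100)%N; exists (22 * (r1 ^ 200)%:R ^+ 3) => t ht.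
pose Q k := 22 * ((r1 + k) ^ 200)%:R ^+ 3 <= t.
have Q0 : Q 0%N by rewrite /Q addn0.
have [n hn] := nat_above t.
have Qn : ~~ Q n.+1.
  rewrite /Q -ltNge; apply: le_lt_trans hn _.
  apply: (@lt_le_trans _ _ n.+1%:R); first by rewrite ltr_nat.
  apply: (@le_trans _ _ (((r1 + n.+1) ^ 200)%:R ^+ 3)); last first.
    by rewrite ler_peMl ?exprn_ge0 // ler1n.
  rewrite -natrX ler_nat -expnM (@leq_trans (r1 + n.+1)) ?leq_addl //.
  by rewrite -{1}[(r1 + n.+1)%N]expn1 leq_pexp2l // addnS.
have [k _ /andP[Qk nQk]] := discrete_crossing Q0 Qn.
exists (r1 + k)%N; first by rewrite /r1 -addnA leq_addr.
rewrite [X in X && _]Qk /=; move: nQk; rewrite /Q -ltNge => /ltW h; apply: le_trans h _.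
rewrite addnS; set r := (r1 + k)%N.
have rb : (138 * 100)%:R <= r%:R :> R by rewrite ler_nat /r /r1 -addnA addnCA leq_addr.
have eR (m : nat) : (m ^ 200)%:R ^+ 3 = m%:R ^+ 600 :> R by rewrite natrX -exprM.
rewrite !eR -[r.+1%:R]natr1.
set v := r%:R + 1; have v0 : 0 < v by rewrite /v; rewrite natrM in rb; lra.
have vx : 0 <= v^-1 <= 1.
  by rewrite invr_ge0 (ltW v0) /= invf_le1 // /v lerDr.
have := one_sub_mul_le_exp 600 vx.
have -> : 1 - v^-1 = r%:R / v by rewrite /v; field; rewrite gt_eqF.
have : 600%:R * v^-1 <= 23^-1.
  rewrite ler_pdivrMr // ler_pdivlMl // /v; rewrite natrM in rb; lra.
rewrite expr_div_n; move: (600%:R * v^-1) => y hy hx.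
have V0 : 0 < v ^+ 600 by exact: exprn_gt0.
have {}hx : 22 / 23 <= r%:R ^+ 600 / v ^+ 600 by lra.
move: hx; rewrite ler_pdivlMr //; move: (v ^+ 600) (r%:R ^+ 600) => a b h; lra.
Qed.

Definition box_coord P Y (x : cube_box P Y) (k : nat) : nat :=
  if (k < 6)%N then x.1.1 (inord k) : nat else if k == 6%N then x.1.2 : nat
  else if k == 7%N then x.2.1 : nat else x.2.2.

Lemma cube_sum_coord (R : realType) P Y (th : nat -> R) (x : cube_box P Y) :
  cube_sum (fun i => th i) (th 6%N) (th 7%N) (th 8%N) x =
  \sum_(k < 9) ((box_coord x k)%:R + th k) ^+ 3.
Proof.
rewrite !big_ord_recr /= /cube_sum !big_ord_recr !big_ord0 /= /box_coord /= -!addrA.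
by do !congr (_ + _); congr ((_%:R + _) ^+ 3); congr (nat_of_ord (x.1.1 _)); apply/val_inj; rewrite /= inordK.
Qed.

Theorem theorem1p1 (R : realType) (s : nat) (hs : (9 <= s)%N)
    (eta : R) (heta : 0 < eta) (mu : 'I_s -> R)
    (hmu : irrational (mu (Ordinal (leq_trans (ltn0Sn 8) hs)))) :
  exists tau0 : R, forall tau : R, tau0 <= tau ->
    exists x : 'I_s -> int,
      (forall i : 'I_s, mu i < (x i)%:~R) /\
      `|shifted_cubes mu (fun i => (x i)%:~R) - tau| < eta.
Proof.
pose nu k : R := mu (widen_ord hs (inord k)).
have nu0 : nu 0%N = mu (Ordinal (leq_trans (ltn0Sn 8) hs)).
  by congr mu; apply/val_inj; rewrite /= inordK.
have nu_irr : irrational (nu 0%N) by rewrite nu0.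
have [r0 hnear] := cubes_near nu_irr heta.
have [t0 scale] := ex_scale R r0.
(* The least integer strictly above [y]; this is why the shifts lie in intervals open on the left
   and closed on the right. *)
pose fl (y : R) : int := Num.floor y + 1.
have flP y : 0 < (fl y)%:~R - y <= 1.
  rewrite /fl intrD; have /andP[h1 h2] := Num.Theory.floor_itv y.
  by rewrite intrD in h2; apply/andP; split; move: h1 h2; move: (_%:~R) => z; lra.
pose rest : R := \sum_(i < s | ~~ (i < 9)%N) ((fl (mu i))%:~R - mu i) ^+ 3.
exists (t0 + rest) => tau htau.
have [r hr hr2] : exists2 r : nat, (r0 <= r)%N & 22 * (r ^ 200)%:R ^+ 3 <= tau - rest <= 23 * (r ^ 200)%:R ^+ 3.
  by apply: scale; rewrite lerBrDr.
pose base k := if (k < 7)%N then (r ^ 200)%N else (r ^ 160)%N.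
(* The variable will be [fl mu + base + coordinate], so [x - mu] is the coordinate plus [th]; at
   index 0 this has the form integer minus an irrational number. *)
pose th k : R := (fl (nu k) + (base k)%:Z)%:~R - nu k.
have thP k : (base k)%:R < th k <= (base k)%:R + 1.
  have := flP (nu k); rewrite /th intrD -pmulrn => /andP[h1 h2].
  by apply/andP; split; move: h1 h2; move: (nu k) ((fl (nu k))%:~R) ((base k)%:R) => y z b; lra.
have thP6 (i : 'I_6) : (r ^ 200)%:R < th i <= (r ^ 200)%:R + 1.
  by have := thP i; rewrite /base (ltn_trans (ltn_ord i)).
have [x hx]   := hnear r _ (fun i => th i) (th 6%N) (th 7%N) (th 8%N) (tau - rest) hr erefl thP6
  (thP 6%N) (thP 7%N) (thP 8%N) hr2.
exists (fun i => fl (mu i) + (if (i < 9)%N then (base i + box_coord x i)%:Z else 0)); split.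
  move=> i; have /andP[h1 _] := flP (mu i); rewrite -subr_gt0 intrD addrAC; apply: ltr_wpDr => //.
  by case: ifP => // _; rewrite -pmulrn.
rewrite /shifted_cubes (bigID (fun i : 'I_s => (i < 9)%N)) /= (big_ord_narrow hs) /=.
have -> : \sum_(i < s | ~~ (i < 9)%N) ((fl (mu i) + (if (i < 9)%N then (base i + box_coord x i)%:Z else 0))%:~R - mu i) ^+ 3 = rest.
  by apply: eq_bigr => i /negbTE ->; rewrite addr0.
have -> : \sum_(i < 9) ((fl (mu (widen_ord hs i)) + (if (i < 9)%N then (base i + box_coord x i)%:Z else 0))%:~R -
     mu (widen_ord hs i)) ^+ 3 = cube_sum (fun i => th i) (th 6%N) (th 7%N) (th 8%N) x.
  rewrite cube_sum_coord; apply: eq_bigr => i _; rewrite ltn_ord /th /nu inord_val; congr (_ ^+ 3).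
  by rewrite PoszD !intrD -!pmulrn; ring.
by have -> : forall a : R, a + rest - tau = a - (tau - rest) by move=> a; ring.
Qed.
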